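(* Let $A_N=(X^{(N)}_{i\wedge j,i\vee j})$ be generalised Wigner matrices, all defined on a common probability space, with $\mathbb EX^{(N)}_{i,j}=0$ for all $1\le i\le j\le N$, satisfying (S.1), (S.2), (S.3), and let $\Delta_N$ be the Laplacian of $A_N$. Then, with $A_1=\inf\sigma^2$ and $A_2=\sup\sigma^2$ as in (S.1), $$\liminf_{N\to\infty}\frac{\|\Delta_N\|}{\sqrt{2N\log N}}\ge A_1^{1/2}\ \text{a.s.},\qquad \limsup_{N\to\infty}\frac{\|\Delta_N\|}{\sqrt{2N\log N}}\le(2A_2)^{1/2}\ \text{a.s.},$$ where $\|\cdot\|$ is the spectral (operator $\ell^2$) norm.
   Context: For each $N$, $\{X^{(N)}_{i,j}:1\le i\le j\le N\}$ are independent real random variables, $A_N(i,j)=X^{(N)}_{i\wedge j,i\vee j}$, and $\Delta_N(i,j)=A_N(i,j)$ ($i\ne j$), $\Delta_N(i,i)=-\sum_{k\ne i}A_N(i,k)$. Let $\sigma_N(i,j)^2=\mathrm{Var}(X^{(N)}_{i\wedge j,i\vee j})$. Assumptions: (S.1) $A_1:=\inf_{N,i,j}\sigma_N(i,j)^2>0$ and $A_2:=\sup_{N,i,j}\sigma_N(i,j)^2\le1$. (S.2) There are $\delta>0$, $K<\infty$ with $\mathbb E|X^{(N)}_{i,j}-\mathbb EX^{(N)}_{i,j}|^{6+\delta}\le K$ for all $i,j,N$. (S.3) The empirical graphon $W_N$ ($W_N(x,y)=\sigma_N(i,j)^2$ on $I_i\times I_j$, $I_j=[\frac{j-1}N,\frac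 jN)$, $I_N$ closed) satisfies $\delta_\Box(W_N,W)\to0$ for some graphon $W$ (measurable symmetric $[0,1]^2\to[0,1]$), $\delta_\Box$ the cut metric $\inf_\sigma\sup_{S,T}|\int_{S\times T}(W_N-W^\sigma)|$ over measure-preserving bijections $\sigma$. *)

(* Defs.v *)
From HB Require Import structures.
From mathcomp Require Import all_boot all_order all_algebra.
From mathcomp Require Import all_classical all_reals all_analysis.
Set Implicit Arguments. Unset Strict Implicit. Unset Printing Implicit Defensive.
Import Order.TTheory GRing.Theory Num.Theory.
Import numFieldNormedType.Exports.
Local Open Scope classical_set_scope.
Local Open Scope ring_scope.

Section Defs.
Context (R : realType).

Definition I01 : set R := `[0%R, 1%R]%classic.

Definition opnorm n (M : 'M[R]_n) : R :=
  sup [set r | exists x : 'cV[R]_n,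
         \sum_i (x i 0) ^+ 2 = 1 /\ r = Num.sqrt (\sum_i ((M *m x) i 0) ^+ 2)].

Definition mp_bij (s : R -> R) : Prop :=
  set_bij I01 I01 s /\ measurable_fun I01 s /\
  (forall A : set R, measurable A -> A `<=` I01 ->
     measurable (s @^-1` A `&` I01) /\
     lebesgue_measure (s @^-1` A `&` I01) = lebesgue_measure A) /\
  (forall A : set R, measurable A -> A `<=` I01 ->
     measurable (s @` A) /\ lebesgue_measure (s @` A) = lebesgue_measure A).

Definition graphon (W : R -> R -> R) : Prop :=
  measurable_fun (I01 `*` I01) (fun z : R * R => W z.1 z.2) /\
  (forall x y, I01 x -> I01 y -> W x y = W y x) /\
  (forall x y, I01 x -> I01 y -> 0 <= W x y <= 1).

Definition sq_integral (U : R -> R -> R) (S T : set R) : \bar R :=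
  (\int[(lebesgue_measure \x lebesgue_measure)%E]_(z in S `*` T) (U z.1 z.2)%:E)%E.

Definition cut_dist (U W : R -> R -> R) : \bar R :=
  ereal_inf [set e | exists s : R -> R, mp_bij s /\
    e = ereal_sup [set r | exists S T : set R,
          measurable S /\ S `<=` I01 /\ measurable T /\ T `<=` I01 /\
          r = `| sq_integral (fun x y => (U x y - W (s x) (s y))%R) S T |%E]].

(** Block index (0-based) of x in [0,1] for the partition
    I_j = [(j-1)/N, j/N), I_N closed: floor(N x), capped at N-1. *)
Definition blk (N : nat) (x : R) : nat := minn (Num.truncn (x * N%:R)) N.-1.

Definition emp_graphon (N : nat) (s2 : nat -> nat -> R) : R -> R -> R :=
  fun x y => s2 (blk N x) (blk N y).

End Defs.

Section Prob.
Context d (T : measurableType d) (R : realType) (P : probability T R).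

Definition mutually_independent (I : eqType) (J : set I) (Y : I -> T -> R) : Prop :=
  forall s : seq I, uniq s -> (forall i, i \in s -> J i) ->
  forall B : I -> set R, (forall i, measurable (B i)) ->
    P (\bigcap_(i in [set` s]) (Y i @^-1` B i)) = (\prod_(i <- s) P (Y i @^-1` B i))%E.

Definition entA (X : nat -> nat -> nat -> T -> R) (N i j : nat) : T -> R :=
  X N (minn i j) (maxn i j).

Definition sig2 (X : nat -> nat -> nat -> T -> R) (N i j : nat) : R :=
  fine (variance P (entA X N i j)).

Definition laplacian (X : nat -> nat -> nat -> T -> R) (N : nat) (w : T) : 'M[R]_N :=
  \matrix_(i < N, j < N)
    (if i == j then - (\sum_(k < N | k != i) entA X N i k w) else entA X N i j w).

End Prob.

(* Main.v *)
(** Let [L = ln N]. Cut the entries at [N^(1/2 - eta)]; with [6 + delta] moments and a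
    small [eta], Markov's inequality and Borel-Cantelli show that almost surely, for all
    large [N], no entry of [A_N] is cut. The Laplacian is the off-diagonal part of [A_N] minus the
    diagonal of its row sums.

    The off-diagonal part has norm [O(sqrt N)], hence negligible against [sqrt (N L)].
    Its entries are split at a fixed small power of [N]: for the small ones, the bilinear
    form is bounded on grids of unit vectors by Chernoff bounds, vectors with only large
    coordinates being handled through the Gram matrix of the rows; the large ones are so
    rare that Schur's test on absolute row sums suffices.

    Upper bound: by Chernoff, a row sum exceeds [sqrt (2 A2 (1 + g)) sqrt (2 N L)] with
    probability about [N^(-2 - 2g)]; a factor [N] is lost in the union over the rows, and
    the rest is summable. This is where the factor 2 against the lower bound comes from.

    Lower bound: take [m = k0 N] rows and the sums of their entries in columns beyond [m].
    These are independent, and a Kolmogorov-type lower bound makes each of them exceed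
    [c sqrt (2 N L)], [c^2 < A1], with probability at least [N^(-1 + epsilon)], so at least
    one does except with probability [exp (- N^epsilon)]. The omitted [m] entries of that
    row contribute at most [(c - b) sqrt (2 N L)] by Chernoff, as [k0] is small. *)

Require Import Defs.
From HB Require Import structures.
From mathcomp Require Import all_boot all_order all_algebra.
From mathcomp Require Import all_classical all_reals all_analysis.
From mathcomp Require Import measurable_realfun ring lra zify.
Import Order.TTheory GRing.Theory Num.Theory.
Import numFieldNormedType.Exports.
Local Open Scope classical_set_scope.
Local Open Scope ring_scope.

Set Implicit Arguments.
Unset Strict Implicit.
Unset Printing Implicit Defensive.

(** * Exponential bounds *)

(** Independence is assumed only inside each matrix, so only the convergence half of Borel-Cantelli
    is available, and the lower bound too needs a summable failure probability. Full row sums share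
    entries by symmetry, which is why partial row sums over disjoint sets of entries are used; one
    diagonal entry then bounds the norm from below. The cut [N^(1/2 - eta)] is a compromise. It is
    high enough for [N^2] entries to be uncut up to a summable probability, and low enough for
    deviations of order [sqrt (N L)]: their exponential tilt is of order [sqrt (L / N)], tilt times
    cut tends to 0, and the moment generating functions are Gaussian to leading order, with the
    sharp coefficient 1/2. Cut entries are not recentred: their means are at most [K / t^5], so the
    bias of a whole row is a negative power of [N]. For the off-diagonal part, a net of the unit
    ball has [exp (C N)] points, so Chernoff must use a tilt of order [sqrt N]. Multiplied by an
    entry and by two large coordinates this tilt is no longer bounded; this obstacle forces the
    splitting of vectors by coordinate size. *)

Section ExpInequalities.
Context (R : realType).
Implicit Types x y z t : R.

Lemma nondecreasing_from_derivative (f f' : R -> R) :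
  (forall x, is_derive x 1 f (f' x)) ->
  forall a b, a <= b -> (forall x, a < x < b -> 0 <= f' x) -> f a <= f b.
Proof.
move=> df a b ab f'ge0.
have cf x : {for x, continuous f}.
  by apply/differentiable_continuous/derivable1_diffP; have [h _] := df x; exact: h.
have d1 x : x \in `]a, b[ -> derivable f x 1 by move=> _; have [] := df x.
have d2 x : x \in `]a, b[ -> 0 <= f^`()%classic x.
  by rewrite in_itv/= => /f'ge0; rewrite derive1E; have [_ ->] := df x.
exact: (ger0_derive1_ndecr d1 d2 (continuous_subspaceT cf) (lexx a) ab (lexx b)).
Qed.

Lemma nonneg_from_derivative (f f' : R -> R) :
  (forall x, is_derive x 1 f (f' x)) -> f 0 = 0 ->
  (forall x, 0 <= x -> 0 <= f' x) -> forall x, 0 <= x -> 0 <= f x.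
Proof.
move=> df f0 f'ge0 x x0; have := nondecreasing_from_derivative df x0.
by rewrite f0; apply=> y /andP[/ltW/f'ge0].
Qed.

Lemma expR_ge_quad z : 0 <= z -> 1 + z + z ^+ 2 / 2 <= expR z.
Proof.
move=> z0; rewrite -subr_ge0.
apply: (@nonneg_from_derivative (fun x => expR x - (1 + x + x ^+ 2 / 2))
  (fun x => expR x - (1 + x))) => //.
- move=> x; apply: is_derive_eq; rewrite /GRing.scale/= ?expr1; lra.
- by rewrite expR0; lra.
- by move=> x _; rewrite subr_ge0 expR_ge1Dx.
Qed.

Lemma expRN_le_quad z : 0 <= z -> expR (- z) <= 1 - z + z ^+ 2 / 2.
Proof.
move=> z0; rewrite -subr_ge0.
apply: (@nonneg_from_derivative (fun x => (1 - x + x ^+ 2 / 2) - expR (- x))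
  (fun x => expR (- x) - (1 - x))) => //.
- move=> x; apply: is_derive_eq; rewrite /GRing.scale/= ?expr1; lra.
- by rewrite oppr0 expR0; lra.
- by move=> x _; rewrite subr_ge0 expR_ge1Dx.
Qed.

(** The Taylor bounds form a ladder: the derivative of each gap is the gap of the bound before it,
    starting from [expR_ge1Dx]. *)
Lemma expRN_ge_cubic z : 0 <= z -> 1 - z + z ^+ 2 / 2 - z ^+ 3 / 6 <= expR (- z).
Proof.
move=> z0; rewrite -subr_ge0.
apply: (@nonneg_from_derivative
  (fun x => expR (- x) - (1 - x + x ^+ 2 / 2 - x ^+ 3 / 6))
  (fun x => (1 - x + x ^+ 2 / 2) - expR (- x))) => //.
- move=> x; apply: is_derive_eq; rewrite /GRing.scale/= ?expr1; lra.
- by rewrite oppr0 expR0; lra.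
- by move=> x x0; rewrite subr_ge0 expRN_le_quad.
Qed.

(** A coefficient within [t] of 1/2 is what keeps the Chernoff exponents sharp. For nonnegative [z],
    [expR z] is the inverse of [expR (- z)], which is bounded below by its cubic Taylor polynomial;
    the product of that cubic with [1 + z + z^2/2 + z^3] is at least 1, and [z^3 <= t z^2]. *)
Lemma expR_le_taylor t z : t <= 1 -> `|z| <= t ->
  expR z <= 1 + z + (2^-1 + t) * z ^+ 2.
Proof.
move=> t1; have [z0|/ltW z0] := leP 0 z; [rewrite ger0_norm// => zt|].
  have e0 := expRN_ge_cubic z0.
  have p0 : 0 < 1 - z + z ^+ 2 / 2 - z ^+ 3 / 6.
    have : 0 <= z ^+ 2 * (1 - z / 3) by rewrite mulr_ge0 ?sqr_ge0//; lra.
    have : z <= 1 by lra.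
    rewrite exprS; nra.
  have h : (1 - z + z ^+ 2 / 2 - z ^+ 3 / 6)^-1 <= 1 + z + z ^+ 2 / 2 + z ^+ 3.
    rewrite -[leLHS]mul1r ler_pdivrMr//.
    have -> : (1 + z + z ^+ 2 / 2 + z ^+ 3) * (1 - z + z ^+ 2 / 2 - z ^+ 3 / 6) =
      1 + z ^+ 3 * (5 / 6 - 11 / 12 * z + 5 / 12 * z ^+ 2 - z ^+ 3 / 6) by field.
    rewrite lerDl mulr_ge0 ?exprn_ge0//.
    have z1 : z <= 1 by lra.
    have : 0 <= (1 - z) ^+ 2 by exact: sqr_ge0.
    have : z ^+ 3 <= z ^+ 2 by rewrite exprS ler_piMl// sqr_ge0.
    by rewrite expr2; nra.
  apply: (@le_trans _ _ (1 - z + z ^+ 2 / 2 - z ^+ 3 / 6)^-1).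
    rewrite -[X in expR X]opprK expRN lef_pV2// posrE//.
    exact: expR_gt0.
  apply: (le_trans h); rewrite mulrDl [2^-1 * _]mulrC addrA lerD2l.
  by rewrite exprS ler_wpM2r ?sqr_ge0.
rewrite ler0_norm// => zt.
have := @expRN_le_quad (- z) ltac:(lra); rewrite opprK sqrrN => h.
apply: (le_trans h).
have : 0 <= t * z ^+ 2 by rewrite mulr_ge0 ?sqr_ge0//; lra.
by move=> ?; rewrite mulrDl; lra.
Qed.

Lemma expR_ge_taylor t z : `|z| <= t ->
  1 + z + (2^-1 - t) * z ^+ 2 <= expR z.
Proof.
have [z0|/ltW z0] := leP 0 z; [rewrite ger0_norm// => zt|rewrite ler0_norm// => zt].
- apply: le_trans (expR_ge_quad z0).
  have : 0 <= t * z ^+ 2 by rewrite mulr_ge0 ?sqr_ge0//; lra.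
  by rewrite mulrBl; lra.
- have := @expRN_ge_cubic (- z) ltac:(lra); rewrite opprK sqrrN => h.
  apply: le_trans h.
have -> : (- z) ^+ 3 = - z * z ^+ 2 by rewrite exprS sqrrN.
have : - z * z ^+ 2 <= t * z ^+ 2 by rewrite ler_wpM2r ?sqr_ge0.
have : 0 <= - z * z ^+ 2 by rewrite mulr_ge0 ?sqr_ge0//; lra.
by rewrite mulrBl; lra.
Qed.

(** Turns a factor [1 + z] of a product into an exponential at a quadratic loss. It rests on
    [(1 - z + z^2) (1 + z) = 1 + z^3]. *)
Lemma expR_subsq_le z : 0 <= z -> expR (z - z ^+ 2) <= 1 + z.
Proof.
move=> z0; rewrite -[X in expR X]opprK expRN.
have h : (1 + z)^-1 <= expR (- (z - z ^+ 2)).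
  apply: le_trans (expR_ge1Dx _).
  rewrite -[leLHS]mul1r ler_pdivrMr; last lra.
  have -> : (1 + - (z - z ^+ 2)) * (1 + z) = 1 + z ^+ 3 by ring.
  by rewrite lerDl exprn_ge0.
rewrite -[leRHS]invrK lef_pV2// posrE ?expR_gt0// invr_gt0; lra.
Qed.

End ExpInequalities.

(** * Expectation, tail events and independence *)

Section BoundedMeasurable.
Context (R : realType) d (T : measurableType d).
Implicit Types f g : T -> R.

(** A class closed under sums, products and exponentials in which integrability is automatic;
    truncation brings all the variables that are estimated into it. *)
Definition bounded_measurable f :=
  measurable_fun setT f /\ exists C, forall x, `|f x| <= C.

Lemma bm_cst c : bounded_measurable (fun=> c).
Proof. by split; [exact: measurable_cst|exists `|c|]. Qed.

Lemma bm_ext f g : f =1 g -> bounded_measurable f -> bounded_measurable g.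
Proof. by move=> /funext ->. Qed.

Lemma bm_add f g : bounded_measurable f -> bounded_measurable g ->
  bounded_measurable (fun x => f x + g x).
Proof.
move=> [mf [C fC]] [mg [D gD]]; split; first exact: measurable_funD.
by exists (C + D) => x; rewrite (le_trans (ler_normD _ _))// lerD.
Qed.

Lemma bm_mul f g : bounded_measurable f -> bounded_measurable g ->
  bounded_measurable (fun x => f x * g x).
Proof.
move=> [mf [C fC]] [mg [D gD]]; split; first exact: measurable_funM.
by exists (C * D) => x; rewrite normrM ler_pM.
Qed.

Lemma bm_scale c f : bounded_measurable f -> bounded_measurable (fun x => c * f x).
Proof. by move=> bf; apply: bm_mul => //; exact: bm_cst. Qed.

Lemma bm_opp f : bounded_measurable f -> bounded_measurable (fun x => - f x).
Proof.
move=> [mf [C fC]]; split; first exact: measurableT_comp.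
by exists C => x; rewrite normrN.
Qed.

Lemma bm_sub f g : bounded_measurable f -> bounded_measurable g ->
  bounded_measurable (fun x => f x - g x).
Proof. by move=> bf bg; apply: bm_add => //; exact: bm_opp. Qed.

Lemma bm_sum I (s : seq I) (Q : pred I) (F : I -> T -> R) :
  (forall i, Q i -> bounded_measurable (F i)) ->
  bounded_measurable (fun x => \sum_(i <- s | Q i) F i x).
Proof.
move=> bF; elim: s => [|i s IH].
  by apply: (bm_ext (f := fun=> 0)); [move=> x; rewrite big_nil|exact: bm_cst].
apply: (bm_ext (f := fun x => (if Q i then F i x else 0) +
    \sum_(j <- s | Q j) F j x)).
  by move=> x; rewrite big_cons; case: ifP; rewrite ?add0r.
by apply: bm_add => //; case Qi: (Q i); [exact: bF|exact: bm_cst].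
Qed.

Lemma bm_prod I (s : seq I) (Q : pred I) (F : I -> T -> R) :
  (forall i, Q i -> bounded_measurable (F i)) ->
  bounded_measurable (fun x => \prod_(i <- s | Q i) F i x).
Proof.
move=> bF; elim: s => [|i s IH].
  by apply: (bm_ext (f := fun=> 1)); [move=> x; rewrite big_nil|exact: bm_cst].
apply: (bm_ext (f := fun x => (if Q i then F i x else 1) *
    \prod_(j <- s | Q j) F j x)).
  by move=> x; rewrite big_cons; case: ifP; rewrite ?mul1r.
by apply: bm_mul => //; case Qi: (Q i); [exact: bF|exact: bm_cst].
Qed.

Lemma bm_indic (A : set T) : measurable A -> bounded_measurable (\1_A : T -> R).
Proof.
move=> mA; split; first exact: measurable_indic.
by exists 1 => x; rewrite indicE; case: (_ \in _); rewrite ?normr1 ?normr0.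
Qed.

Lemma bm_expR f : bounded_measurable f -> bounded_measurable (fun x => expR (f x)).
Proof.
move=> [mf [C fC]]; split.
  by apply: measurableT_comp => //; exact: measurable_expR.
exists (expR C) => x; rewrite ger0_norm ?expR_ge0// ler_expR.
exact: le_trans (ler_norm _) (fC x).
Qed.

End BoundedMeasurable.

Lemma bm_comp (R : realType) d1 d2 (T1 : measurableType d1) (T2 : measurableType d2)
    (g : T2 -> R) (f : T1 -> T2) : bounded_measurable g ->
  measurable_fun setT f -> bounded_measurable (fun x => g (f x)).
Proof.
move=> [mg [C gC]] mf; split; last by exists C.
by apply: (measurableT_comp mg).
Qed.

(** The sum counts the multiples of [e] up to [v], so it is the integer part of [v / e]. This writes
    a bounded function, up to a uniform error, as a finite combination of indicators of its
    superlevel sets. *)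
Lemma staircase_approx (R : realType) (C e v : R) : 0 < e -> 0 <= v <= C ->
  `|e * \sum_(k < (Num.truncn (C / e)).+1) ((k.+1%:R * e <= v)%R : nat)%:R - v| <= e.
Proof.
move=> e0 /andP[v0 vC].
set n := Num.truncn (C / e).
have tE k : (k.+1%:R * e <= v) = (k < Num.truncn (v / e))%N.
  by rewrite -ler_pdivlMr// truncn_gt_nat.
have tn : (Num.truncn (v / e) <= n)%N.
  by apply: le_truncn; rewrite ler_pM2r// invr_gt0.
have -> : \sum_(k < n.+1) ((k.+1%:R * e <= v)%R : nat)%:R = (Num.truncn (v / e))%:R :> R.
  rewrite -natr_sum; congr (_%:R).
  under eq_bigr do rewrite tE.
  rewrite -(big_mkord xpredT (fun k => ((k < Num.truncn (v / e))%N : nat))).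
  rewrite (@big_cat_nat _ _ _ (Num.truncn (v / e)))//=; last by rewrite (leq_trans tn).
  rewrite (eq_big_nat _ _ (F2 := fun=> 1%N)); last by move=> i; rewrite leq0n => /= ->.
  rewrite [X in (_ + X)%N](eq_big_nat _ _ (F2 := fun=> 0%N)).
    by rewrite !sum_nat_const_nat subn0 muln1 muln0 addn0.
  by move=> i /andP[hi _]; rewrite ltnNge hi.
have /truncn_itv /andP[h1 h2] : 0 <= v / e by rewrite divr_ge0// ltW.
have h1' : (Num.truncn (v / e))%:R * e <= v by rewrite -ler_pdivlMr.
have h2' : v < (Num.truncn (v / e)).+1%:R * e by rewrite -ltr_pdivrMr.
move: h2'; rewrite -natr1 mulrDl mul1r => h2'.
by rewrite mulrC ler_norml; lra.
Qed.

Section Expectation.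
Context (R : realType) d (T : measurableType d) (P : probability T R).
Implicit Types (f g : T -> R) (A E : set T).

Definition Ex f : R := Rintegral P setT f.

Lemma bm_integrable f : bounded_measurable f -> P.-integrable setT (EFin \o f).
Proof.
move=> [mf [C fC]]; apply: measurable_bounded_integrable => //.
  by rewrite (le_lt_trans (probability_le1 P _))// ltry.
exists C; split; first exact: num_real.
by move=> M CM x _ /=; rewrite (le_trans (fC x))// ltW.
Qed.

Lemma Ex_cst c : Ex (fun=> c) = c.
Proof.
rewrite /Ex Rintegral_cst//; transitivity (c * fine (1%E : \bar R)); last exact: mulr1.
by congr (_ * fine _); exact: probability_setT.
Qed.

Lemma Ex_add f g : bounded_measurable f -> bounded_measurable g ->
  Ex (fun w => f w + g w) = Ex f + Ex g.
Proof. by move=> /bm_integrable bf /bm_integrable bg; rewrite /Ex RintegralD. Qed.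

Lemma Ex_scale c f : bounded_measurable f -> Ex (fun w => c * f w) = c * Ex f.
Proof. by move=> /bm_integrable bf; rewrite /Ex RintegralZl. Qed.

Lemma Ex_sub f g : bounded_measurable f -> bounded_measurable g ->
  Ex (fun w => f w - g w) = Ex f - Ex g.
Proof. by move=> /bm_integrable bf /bm_integrable bg; rewrite /Ex RintegralB. Qed.

Lemma Ex_ext f g : f =1 g -> Ex f = Ex g.
Proof. by move=> /funext ->. Qed.

Lemma Ex_sum I (s : seq I) (Q : pred I) (F : I -> T -> R) :
  (forall i, Q i -> bounded_measurable (F i)) ->
  Ex (fun w => \sum_(i <- s | Q i) F i w) = \sum_(i <- s | Q i) Ex (F i).
Proof.
move=> bF; elim: s => [|i s IH].
  by rewrite big_nil -[RHS](Ex_cst 0); apply: Ex_ext => w; rewrite big_nil.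
rewrite big_cons -IH; case: ifPn => Qi; last first.
  by apply: Ex_ext => w; rewrite big_cons (negbTE Qi).
rewrite -Ex_add; [|exact: bF|exact: bm_sum].
by apply: Ex_ext => w; rewrite big_cons Qi.
Qed.

Lemma Ex_le f g : bounded_measurable f -> bounded_measurable g ->
  (forall w, f w <= g w) -> Ex f <= Ex g.
Proof. by move=> /bm_integrable bf /bm_integrable bg fg; apply: le_Rintegral. Qed.

Lemma Ex_ge0 f : (forall w, 0 <= f w) -> 0 <= Ex f.
Proof. by move=> f0; apply: Rintegral_ge0. Qed.

Lemma Ex_norm_le f c : bounded_measurable f -> (forall w, `|f w| <= c) ->
  `|Ex f| <= c.
Proof.
move=> bf fc; rewrite ler_norml -{2}(Ex_cst c) -{1}(Ex_cst (- c)).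
apply/andP; split; apply: Ex_le => //; try exact: bm_cst.
- by move=> w; have := fc w; rewrite ler_norml => /andP[].
- by move=> w; have := fc w; rewrite ler_norml => /andP[].
Qed.

Lemma Ex_dist_le f g c : bounded_measurable f -> bounded_measurable g ->
  (forall w, `|f w - g w| <= c) -> `|Ex f - Ex g| <= c.
Proof.
by move=> bf bg h; rewrite -Ex_sub//; apply: Ex_norm_le => //; exact: bm_sub.
Qed.

Lemma Ex_indic A : measurable A -> Ex (\1_A : T -> R) = fine (P A).
Proof. by move=> mA; rewrite /Ex /Rintegral integral_indic// setIT. Qed.

(** Linearity extends the product rule from indicators to staircase functions, and uniform
    approximation extends it from these to [f]. *)
Lemma Ex_decouple (X : T -> R) G (f : R -> R) :
  measurable_fun setT X -> bounded_measurable G -> bounded_measurable f ->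
  (forall B, measurable B ->
    Ex (fun w => G w * \1_B (X w)) = Ex G * Ex (fun w => \1_B (X w))) ->
  Ex (fun w => G w * f (X w)) = Ex G * Ex (fun w => f (X w)).
Proof.
move=> mX bG bf GX; have [_ [Cg GC]] := bG; have [mf [C fC]] := bf.
have C0 : 0 <= C by exact: le_trans (normr_ge0 (f 0)) (fC 0).
have Cg0 : 0 <= Cg.
  by rewrite -(Ex_cst Cg); apply: Ex_ge0 => w; exact: le_trans (GC w).
apply/eqP; rewrite -subr_eq0 -normr_le0; apply/ler_addgt0Pl => e e0.
rewrite addr0.
(* Two errors of at most [Cg * h] have to fit in [e]; the added 1 keeps the denominator positive
   when [Cg] is 0. *)
pose h := e / (2 * (Cg + 1)).
have h0 : 0 < h by rewrite divr_gt0//; lra.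
pose n := (Num.truncn (2 * C / h)).+1.
pose B (k : 'I_n) := [set x | k.+1%:R * h <= f x + C].
have mB k : measurable (B k).
  have -> : B k = setT `&` f @^-1` `[k.+1%:R * h - C, +oo[.
    by rewrite setTI; apply/seteqP; split=> x; rewrite /B/= in_itv/= andbT lerBlDr.
  exact: mf.
pose fe x := h * \sum_(k < n) \1_(B k) x - C.
have bfe : bounded_measurable fe.
  apply: bm_sub; last exact: bm_cst.
  by apply: bm_scale; apply: bm_sum => k _; exact: bm_indic.
have ffe x : `|fe x - f x| <= h.
  have vC : 0 <= f x + C <= 2 * C by have := fC x; rewrite ler_norml; lra.
  have := staircase_approx h0 vC.
  rewrite /fe -addrA -opprD [C + _]addrC; congr (`|_ * _ - _| <= _).
  by apply: eq_bigr => k _; rewrite indicE mem_setE.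
have bGf : bounded_measurable (fun w => G w * f (X w)) by apply: bm_mul => //; exact: bm_comp.
have bGfe : bounded_measurable (fun w => G w * fe (X w)) by apply: bm_mul => //; exact: bm_comp.
have e1 : `|Ex (fun w => G w * fe (X w)) - Ex (fun w => G w * f (X w))| <= Cg * h.
  apply: Ex_dist_le => // w; rewrite -mulrBr normrM ler_pM//; exact: ffe.
have e2 : `|Ex (fun w => fe (X w)) - Ex (fun w => f (X w))| <= h.
  by apply: Ex_dist_le => [||w]; [exact: bm_comp|exact: bm_comp|exact: ffe].
have e3 : `|Ex G| <= Cg by exact: Ex_norm_le.
have bI k : bounded_measurable (fun w => \1_(B k) (X w) : R).
  by apply: bm_comp => //; exact: bm_indic.
have key : Ex (fun w => G w * fe (X w)) = Ex G * Ex (fun w => fe (X w)).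
  transitivity (h * (\sum_(k < n) Ex (fun w => G w * \1_(B k) (X w))) - C * Ex G).
    rewrite -Ex_sum => [|k _]; last exact: bm_mul.
    rewrite -Ex_scale; last by apply: bm_sum => k _; exact: bm_mul.
    rewrite -Ex_scale// -Ex_sub; last 2 first.
    - by apply: bm_scale; apply: bm_sum => k _; exact: bm_mul.
    - exact: bm_scale.
    by apply: Ex_ext => w; rewrite /fe mulrBr mulrCA mulr_sumr [G w * C]mulrC.
  rewrite (eq_bigr _ (fun k _ => GX _ (mB k))) -mulr_sumr.
  have -> : Ex (fun w => fe (X w)) = h * (\sum_(k < n) Ex (fun w => \1_(B k) (X w))) - C.
    rewrite -Ex_sum// -Ex_scale; last by apply: bm_sum.
    rewrite -[in RHS](Ex_cst C) -Ex_sub//; last exact: bm_cst.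
    by apply: bm_scale; exact: bm_sum.
  by ring.
have e4 : `|Ex G * (Ex (fun w => fe (X w)) - Ex (fun w => f (X w)))| <= Cg * h.
  by rewrite normrM ler_pM.
have -> : Ex (fun w => G w * f (X w)) - Ex G * Ex (fun w => f (X w)) =
  - (Ex (fun w => G w * fe (X w)) - Ex (fun w => G w * f (X w))) +
   Ex G * (Ex (fun w => fe (X w)) - Ex (fun w => f (X w))) by rewrite key; ring.
apply: (le_trans (ler_normD _ _)); rewrite normrN.
apply: (le_trans (lerD e1 e4)).
have -> : e = h * (2 * (Cg + 1)) by rewrite /h divfK//; apply/lt0r_neq0; lra.
by nra.
Qed.

(** An outer measure bound. The events of interest involve suprema over uncountably many vectors,
    and this form spares every proof of their measurability while still supporting union bounds and
    Borel-Cantelli. *)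
Definition outer E (p : R) :=
  exists F, [/\ measurable F, E `<=` F & (P F <= p%:E)%E].

Lemma outer_sub E E' p : E `<=` E' -> outer E' p -> outer E p.
Proof. by move=> EE' [F [mF E'F PF]]; exists F; split=> // w /EE' /E'F. Qed.

Lemma outer_le E p q : p <= q -> outer E p -> outer E q.
Proof.
by move=> pq [F [mF EF PF]]; exists F; split=> //; rewrite (le_trans PF)// lee_fin.
Qed.

Lemma outer0 E : E `<=` set0 -> outer E 0.
Proof. by move=> E0; exists set0; split=> //; rewrite measure0. Qed.

Lemma outerU E E' p q : outer E p -> outer E' q -> outer (E `|` E') (p + q).
Proof.
move=> [F [mF EF PF]] [F' [mF' EF' PF']]; exists (F `|` F'); split.
- exact: measurableU.
- by move=> w [/EF|/EF']; [left|right].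
- by rewrite EFinD (le_trans (measureU2 P mF mF'))// leeD.
Qed.

Lemma outer_bigcup (I : finType) (Q : pred I) (E : I -> set T) (p : I -> R) :
  (forall i, Q i -> outer (E i) (p i)) ->
  outer [set w | exists i, Q i /\ E i w] (\sum_(i | Q i) p i).
Proof.
move=> oE.
suff : outer [set w | exists i, [/\ i \in enum I, Q i & E i w]]
    (\sum_(i <- enum I | Q i) p i).
  rewrite big_enum_cond; apply: outer_sub => w [i [Qi Ei]].
  by exists i; split=> //; rewrite mem_enum.
elim: (enum I) => [|j s IH].
  by rewrite big_nil; apply: outer0 => w [i []].
rewrite big_cons; case: ifPn => Qj.
  apply: outer_sub (outerU (oE j Qj) IH) => w [i []].
  rewrite inE => /orP[/eqP ->|js Qi Ei]; first by left.
  by right; exists i.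
apply: outer_sub IH => w [i []].
rewrite inE => /orP[/eqP ->|js Qi Ei]; first by rewrite (negbTE Qj).
by exists i.
Qed.

Lemma markov_outer E g : bounded_measurable g -> (forall w, 0 <= g w) ->
  (forall w, E w -> 1 <= g w) -> outer E (Ex g).
Proof.
move=> bg g0 Eg.
have mF : measurable [set w | 1 <= g w].
  have -> : [set w | 1 <= g w] = setT `&` g @^-1` `[1, +oo[.
    by rewrite setTI; apply/seteqP; split=> x /=; rewrite in_itv/= andbT.
  by have [mg _] := bg; exact: mg.
exists [set w | 1 <= g w]; split=> //.
rewrite -[leLHS]fineK ?fin_num_measure// lee_fin -Ex_indic//.
apply: Ex_le => //; first exact: bm_indic.
move=> w; rewrite indicE; case: (boolP (w \in _)); [by rewrite inE; exact|by move=> _; exact: g0].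
Qed.

End Expectation.

Section Independence.
Context (R : realType) d (T : measurableType d) (P : probability T R).
Context (I : choiceType) (J : set I) (X : I -> T -> R).
Hypothesis mX : forall i, measurable_fun setT (X i).
Hypothesis indX : mutually_independent P J X.
Context (E : eqType) (v : E -> I).

Lemma indep_indic (t : seq E) (B : E -> set R) :
  uniq (map v t) -> (forall e, e \in t -> J (v e)) -> (forall e, measurable (B e)) ->
  Ex P (fun w => \prod_(e <- t) \1_(B e) (X (v e) w)) =
  \prod_(e <- t) Ex P (fun w => \1_(B e) (X (v e) w)).
Proof.
move=> ut Jt mB.
(* Independence takes a family of sets indexed by all of [I], so [B] is transported along [v],
   injective on [t]; [setT] is the value at indices that are not reached. *)
pose B' i := nth setT (map B t) (index i (map v t)).
have B'E : {in t, forall e, B' (v e) = B e}.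
  rewrite /B' {Jt B'}; elim: t ut => //= a s IH /andP[va us] e.
  rewrite inE => /predU1P[->|es]; first by rewrite eqxx.
  rewrite ifN; first exact: IH.
  by apply: contra va => /eqP ->; exact: map_f.
have mB' i : measurable (B' i).
  rewrite /B'; have [it|it] := ltnP (index i (map v t)) (size t); last first.
    by rewrite nth_default ?size_map.
  case: t it {ut Jt B'E} @B' => // a s it B'.
  by rewrite (nth_map a).
have mXB i : measurable (X i @^-1` B' i) by rewrite -[_ @^-1` _]setTI; exact: mX.
have := indX ut _ mB'.
move=> /(_ ltac:(by move=> i /mapP[e et ->]; exact: Jt)).
rewrite big_map => /(congr1 fine).
have mcap (s : seq I) : measurable (\bigcap_(i in [set` s]) (X i @^-1` B' i)).
  by rewrite bigcap_seq; apply: bigsetI_measurable => i _; exact: mXB.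
have -> : fine (P (\bigcap_(i in [set` map v t]) (X i @^-1` B' i))) =
   Ex P (fun w => \prod_(e <- t) \1_(B e) (X (v e) w)).
  rewrite -Ex_indic//; apply: Ex_ext => w.
  rewrite indicE.
  have -> : \prod_(e <- t) \1_(B e) (X (v e) w) =
    \prod_(e <- t) \1_(B' (v e)) (X (v e) w) :> R.
    by apply: eq_big_seq => e et; rewrite B'E.
  case: (boolP (w \in _)) => [|]; rewrite ?inE ?notin_setE.
    move=> h; rewrite big_seq big1// => e et; rewrite indicE mem_set//.
    by apply: h => /=; exact: map_f.
  move=> /existsNP[i /not_implyP[/= /mapP[e et ->]] nB].
  by rewrite (big_rem e)//= indicE memNset// mul0r.
move=> ->.
have -> : (\prod_(j <- t) P (X (v j) @^-1` B' (v j)) =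
   (\prod_(e <- t) Ex P (fun w => \1_(B e) (X (v e) w)))%:E)%E.
  rewrite -prodEFin; apply: eq_big_seq => e et.
  have -> : Ex P (fun w => \1_(B e) (X (v e) w)) = Ex P (\1_(X (v e) @^-1` B' (v e)) : T -> R).
    by apply: Ex_ext => w; rewrite !indicE B'E// mem_setE.
  by rewrite Ex_indic// fineK// fin_num_measure.
by [].
Qed.

(** Induction on [s], whose members carry arbitrary bounded functions, while those of [t] carry
    indicators. To free the function at [a], [Ex_decouple] asks for the product rule with indicators
    at [a], and this is the induction hypothesis with [a] moved to the list [t]. *)
Lemma indep_prod_seq (s t : seq E) (h : E -> R -> R) :
  uniq (map v (s ++ t)) -> (forall e, e \in s ++ t -> J (v e)) ->
  (forall e, bounded_measurable (h e)) ->
  (forall e, e \in t -> exists2 B, measurable B & h e = \1_B) ->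
  Ex P (fun w => \prod_(e <- s ++ t) h e (X (v e) w)) =
  \prod_(e <- s ++ t) Ex P (fun w => h e (X (v e) w)).
Proof.
elim: s t h => [|a s IH] t h us Jst bh indh.
  pose B e := if pselect (e \in t) is left et then sval (cid2 (indh e et)) else set0.
  have BP e : e \in t -> h e = \1_(B e).
    by move=> et; rewrite /B; case: pselect => // et'; case: cid2.
  have mB e : measurable (B e).
    by rewrite /B; case: pselect => // et'; case: cid2.
  rewrite /= [RHS](eq_big_seq (fun e => Ex P (fun w => \1_(B e) (X (v e) w)))); last first.
    by move=> e et; rewrite BP.
  rewrite -indep_indic//; apply: Ex_ext => w.
  by apply: eq_big_seq => e et; rewrite BP.
have ua : perm_eq (s ++ a :: t) (a :: s ++ t) by rewrite perm_catC /= perm_cons perm_catC.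
have us' : uniq (map v (s ++ a :: t)) by rewrite (perm_uniq (perm_map v ua)).
have ust : uniq (map v (s ++ t)) by move: us => /= /andP[].
have na : a \notin s ++ t by move: us => /= /andP[+ _]; apply: contra; exact: map_f.
rewrite /= big_cons -(IH t h)//; last first.
  by move=> e es; apply: Jst; rewrite /= inE es orbT.
have bG : bounded_measurable (fun w => \prod_(e <- s ++ t) h e (X (v e) w)).
  by apply: bm_prod => e _; exact: bm_comp.
rewrite mulrC -(@Ex_decouple _ _ _ P (X (v a)))//.
  by apply: Ex_ext => w; rewrite big_cons mulrC.
move=> B mB.
pose h' e := if e == a then (\1_B : R -> R) else h e.
have h'a : h' a = \1_B by rewrite /h' eqxx.
have h'E e : e \in s ++ t -> h' e = h e.
  by rewrite /h'; case: eqP => // ->; rewrite (negbTE na).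
have := IH (a :: t) h' us' _ _ _.
rewrite (perm_big _ ua)/= big_cons h'a.
rewrite (eq_big_seq (fun e => Ex P (fun w => h e (X (v e) w)))); last first.
  by move=> e es; rewrite h'E.
rewrite -(IH t h)//; last first.
  by move=> e es; apply: Jst; rewrite /= inE es orbT.
rewrite mulrC => <-.
- apply: Ex_ext => w; rewrite (perm_big _ ua)/= big_cons h'a mulrC; congr (_ * _).
  by apply: eq_big_seq => e es; rewrite h'E.
- by move=> e; rewrite (perm_mem ua); exact: Jst.
- by move=> e; rewrite /h'; case: ifP => // _; exact: bm_indic.
- move=> e; rewrite inE => /predU1P[->|et]; first by exists B.
  by rewrite h'E ?mem_cat ?et ?orbT//; exact: indh.
Qed.

End Independence.

Section IndependenceFinite.
Context (R : realType) d (T : measurableType d) (P : probability T R).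
Context (I : choiceType) (J : set I) (X : I -> T -> R).
Hypothesis mX : forall i, measurable_fun setT (X i).
Hypothesis indX : mutually_independent P J X.

Lemma indep_prod (E : finType) (Q : pred E) (v : E -> I) (h : E -> R -> R) :
  {in Q &, injective v} -> (forall e, Q e -> J (v e)) ->
  (forall e, bounded_measurable (h e)) ->
  Ex P (fun w => \prod_(e | Q e) h e (X (v e) w)) =
  \prod_(e | Q e) Ex P (fun w => h e (X (v e) w)).
Proof.
move=> vinj JQ bh.
have := @indep_prod_seq _ _ _ P _ J X mX indX _ v (enum Q) [::] h.
rewrite cats0 !big_enum/= => <- //.
- by apply: Ex_ext => w; rewrite big_enum.
- by rewrite map_inj_in_uniq ?enum_uniq// => x y; rewrite !mem_enum; exact: vinj.
- by move=> e; rewrite mem_enum; exact: JQ.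
Qed.

(* Each block enters through a finite sum of products: this covers both inner products
   of rows and sums of exponentials. *)
Lemma indep_blocks (A K L : finType) (Q : A -> pred K) (v : A * K -> I)
    (c : A -> L -> R) (h : A -> L -> K -> R -> R) :
  {in (fun e => Q e.1 e.2) &, injective v} ->
  (forall e, Q e.1 e.2 -> J (v e)) ->
  (forall a l k, bounded_measurable (h a l k)) ->
  Ex P (fun w => \prod_a \sum_l c a l * \prod_(k | Q a k) h a l k (X (v (a, k)) w)) =
  \prod_a \sum_l c a l * \prod_(k | Q a k) Ex P (fun w => h a l k (X (v (a, k)) w)).
Proof.
move=> vinj JQ bh.
rewrite bigA_distr_bigA/=.
under [RHS]eq_bigr => f _.
  rewrite big_split/=.
  rewrite (pair_big_dep xpredT (fun a k => Q a k)
    (fun a k => Ex P (fun w => h a (f a) k (X (v (a, k)) w))))/=.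
  rewrite (eq_bigr (fun p => Ex P (fun w => h p.1 (f p.1) p.2 (X (v p) w)))); last first.
    by move=> [a k] _.
  rewrite -(@indep_prod _ _ v (fun p => h p.1 (f p.1) p.2))//.
  rewrite -Ex_scale; last by apply: bm_prod => e _; exact: bm_comp.
  over.
rewrite -Ex_sum; last first.
  by move=> f _; apply: bm_scale; apply: bm_prod => e _; exact: bm_comp.
apply: Ex_ext => w; rewrite bigA_distr_bigA/=; apply: eq_bigr => f _.
rewrite big_split/=; congr (_ * _).
rewrite (pair_big_dep xpredT (fun a k => Q a k)
    (fun a k => h a (f a) k (X (v (a, k)) w)))/=.
by apply: eq_bigr => [[a k] _].
Qed.

End IndependenceFinite.

(** * Growth in [L = ln N] and the convergence half of Borel-Cantelli *)

Section Asymptotics.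
Context (R : realType).

Lemma near_pinfty_ge (A : R) : \forall L \near +oo, A <= L.
Proof. by apply: nbhs_pinfty_ge; exact: num_real. Qed.

Lemma expR_dominates (k C : R) : 0 < k ->
  \forall L \near +oo, C * (1 + L) <= expR (k * L).
Proof.
move=> k0; near=> L.
have L1 : 1 <= L by near: L; exact: near_pinfty_ge.
have LC : 4 * `|C| / k ^+ 2 <= L by near: L; exact: near_pinfty_ge.
have k2 : 0 < k ^+ 2 by rewrite exprn_gt0.
have h1 : 4 * `|C| <= L * k ^+ 2 by rewrite -ler_pdivrMr.
have h2 : (k * L) ^+ 2 / 2 <= expR (k * L).
  apply: le_trans (expR_ge_quad _); last by rewrite mulr_ge0//; lra.
  by rewrite lerDr addr_ge0// mulr_ge0//; lra.
apply: le_trans h2; have h3 := ler_norm C; have h4 := normr_ge0 C.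
rewrite exprMn; move: (k ^+ 2) k2 h1 => K K0 h1.
have : 4 * `|C| * L <= L * K * L by rewrite ler_wpM2r//; lra.
by rewrite expr2; nra.
Unshelve. all: by end_near. Qed.

Lemma expR_ge_near (k C : R) : 0 < k -> \forall L \near +oo, C <= expR (k * L).
Proof.
move=> k0; near=> L.
apply: (@le_trans _ _ (`|C| * (1 + L))); last by near: L; exact: expR_dominates.
have L1 : 0 <= L by near: L; exact: near_pinfty_ge.
rewrite (le_trans (ler_norm C))// ler_peMr//; lra.
Unshelve. all: by end_near. Qed.

(* With [L = ln N]: a stretched exponential in [N] beats every power of [N]. *)
Lemma expRN_expR_le (k C q : R) : 0 < k ->
  \forall L \near +oo, expR (C - expR (k * L)) <= expR (- (q * L)).
Proof.
move=> k0; near=> L.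
have L1 : 0 <= L by near: L; exact: near_pinfty_ge.
rewrite ler_expR lerBlDr.
have : (`|C| + `|q|) * (1 + L) <= expR (k * L) by near: L; exact: expR_dominates.
have := ler_norm C; have := ler_norm q; have := normr_ge0 C; have := normr_ge0 q.
nra.
Unshelve. all: by end_near. Qed.

Lemma near_ln (Q : R -> Prop) : (\forall L \near +oo, Q L) ->
  \forall n \near \oo, Q (ln (n%:R : R)).
Proof.
move=> [A [_ AQ]].
near=> n; apply: AQ.
have : expR (A + 1) <= n%:R by near: n; exact: (cvgry_ge (@cvgr_idn R)).
have n0 : 0 < n%:R :> R by rewrite ltr0n; near: n; exact: nbhs_infty_gt.
by rewrite -ler_ln ?posrE ?expR_gt0// expRK; lra.
Unshelve. all: by end_near. Qed.

Lemma expR_ln_nat n : (0 < n)%N -> expR (ln n%:R) = n%:R :> R.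
Proof. by move=> n0; rewrite lnK// posrE ltr0n. Qed.

Lemma ln_nat_ge0 n : 0 <= ln (n%:R : R).
Proof.
case: n => [|n]; first by rewrite ln0.
by rewrite ln_ge0// ler1n.
Qed.

(** A telescoping replacement for the integral test on the sum of [n^(-1 - g)]. From
    [ln (n + 1) - ln n >= 1 / (n + 1)] the relative decrease of [n^(-g)] is at least
    [g / (n + 1 + g)], and [n + 1 + g <= (2 + g) n] for [n >= 1] gives the constant. *)
Lemma zeta_term_telescope (g : R) n : 0 < g -> (0 < n)%N ->
  expR (- (1 + g) * ln n%:R) <=
    (2 + g) / g * (expR (- g * ln n%:R) - expR (- g * ln n.+1%:R)).
Proof.
move=> g0 n0.
have N0 : 0 < n%:R :> R by rewrite ltr0n.
have N1 : 1 <= n%:R :> R by rewrite ler1n.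
have -> : expR (- (1 + g) * ln n%:R) = expR (- g * ln n%:R) / n%:R :> R.
  by rewrite mulNr mulrDl mul1r opprD addrC -mulNr expRB expR_ln_nat.
have -> : expR (- g * ln n%:R) - expR (- g * ln n.+1%:R) =
  expR (- g * ln n%:R) * (1 - expR (- (g * (ln n.+1%:R - ln n%:R)))) :> R.
  by rewrite mulrBr mulr1 -expRD; congr (_ - expR _); ring.
rewrite mulrCA ler_wpM2l ?expR_ge0//.
set u := g * _.
have hu : g / (n%:R + 1) <= u.
  rewrite ler_wpM2l ?(ltW g0)//.
  have : ln (1 + (- (n%:R + 1)^-1)) <= - (n%:R + 1)^-1 :> R.
    by apply: le_ln1Dx; rewrite ltrN2 invf_lt1; lra.
  have -> : 1 + - (n%:R + 1)^-1 = n%:R / n.+1%:R :> R.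
    by rewrite -natr1; field; lra.
  by rewrite ln_div ?posrE ?ltr0n//; lra.
have gp : 0 <= g / (n%:R + 1) by rewrite divr_ge0//; lra.
have u1 : expR (- u) <= (1 + g / (n%:R + 1))^-1.
  rewrite expRN lef_pV2 ?posrE ?expR_gt0//.
    by apply: le_trans (expR_ge1Dx _); rewrite lerD2l.
  lra.
have : (2 + g) / g * (1 - (1 + g / (n%:R + 1))^-1) <= (2 + g) / g * (1 - expR (- u)).
  by rewrite ler_wpM2l ?divr_ge0//; lra.
apply: le_trans.
have -> : (2 + g) / g * (1 - (1 + g / (n%:R + 1))^-1) = (2 + g) / (n%:R + 1 + g).
  by field; apply/and3P; split; apply/lt0r_neq0; lra.
rewrite ler_pdivlMr; last lra.
by rewrite mulrC ler_pdivrMr//; nra.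
Qed.

End Asymptotics.

Section BorelCantelli.
Context (R : realType) d (T : measurableType d) (P : probability T R).

Lemma borel_cantelli_outer (E : nat -> set T) (g C : R) : 0 < g ->
  (\forall n \near \oo, outer P (E n) (C * expR (- (1 + g) * ln n%:R))) ->
  {ae P, forall w, \forall n \near \oo, ~ E n w}.
Proof.
move=> g0 [n0 _ oE].
pose n1 := maxn n0 1.
have oE1 n : (n1 <= n)%N -> outer P (E n) (C * expR (- (1 + g) * ln n%:R)).
  by rewrite geq_max => /andP[/oE].
(* Measurable covers of the events, empty below [n1]. Since [n1 >= 1], the index 0, to which the
   telescoping bound does not apply, contributes nothing. *)
pose F n := if pselect (n1 <= n)%N is left h then sval (cid (oE1 n h)) else set0.
have mF n : measurable (F n).
  by rewrite /F; case: pselect => // h; case: cid => /= G [].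
have EF n : (n1 <= n)%N -> E n `<=` F n.
  by rewrite /F; case: pselect => // h _; case: cid => /= G [].
pose D := `|C| * ((2 + g) / g).
have D0 : 0 <= D by rewrite mulr_ge0// divr_ge0//; lra.
have PF n : (0 < n)%N -> (P (F n) <= (D * (expR (- g * ln n%:R) - expR (- g * ln n.+1%:R)))%:E)%E.
  move=> np; have h1 := zeta_term_telescope g0 np.
  have h2 : `|C| * expR (- (1 + g) * ln n%:R) <=
    D * (expR (- g * ln n%:R) - expR (- g * ln n.+1%:R)).
    by rewrite /D -mulrA ler_wpM2l.
  rewrite /F; case: pselect => h.
    case: cid => /= G [_ _ PG]; apply: (le_trans PG); rewrite lee_fin.
    by apply: le_trans h2; rewrite ler_wpM2r ?expR_ge0// ler_norm.
  rewrite measure0 lee_fin; apply: le_trans h2.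
  by rewrite mulr_ge0// expR_ge0.
have P0 : P (F 0%N) = 0%E.
  rewrite /F; case: pselect => [h|_]; last by rewrite measure0.
  by exfalso; move: h; rewrite geq_max ltn0 andbF.
have sumF k : (\sum_(0 <= n < k) P (F n) <= D%:E)%E.
  suff : (\sum_(0 <= n < k.+1) P (F n) <= (D * (1 - expR (- g * ln k.+1%:R)))%:E)%E.
    move=> h; apply: (@le_trans _ _ (\sum_(0 <= n < k.+1) P (F n))%E).
      by rewrite big_nat_recr//= leeDl.
    by apply: (le_trans h); rewrite lee_fin ler_piMr// lerBlDr lerDl expR_ge0.
  elim: k => [|k IH].
    by rewrite big_nat1 P0 ln1 mulr0 expR0 subrr mulr0.
  rewrite big_nat_recr//= (le_trans (leeD IH (PF k.+1 _)))// -EFinD lee_fin.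
  by rewrite -mulrDr ler_wpM2l//; lra.
have lim0 : P (lim_sup_set F) = 0%E.
  apply: lim_sup_set_cvg0 => //; apply: (@le_lt_trans _ _ D%:E); last exact: ltry.
  apply: lime_le; first by apply: is_cvg_nneseries.
  by apply: nearW => k; exact: sumF.
exists (lim_sup_set F); split=> //.
  by apply: bigcapT_measurable => k; apply: bigcup_measurable.
move=> w /= nE k _.
apply: contrapT => nF; apply: nE.
exists (maxn k n1) => // n; rewrite /= geq_max => /andP[kn n1n] Ew.
by apply: nF; exists n => //=; exact: EF.
Qed.

End BorelCantelli.

(** * Bilinear forms and nets *)

Section BilinearForms.
Context (R : realType) (n : nat).
Implicit Types (x y : 'I_n -> R) (H : 'I_n -> 'I_n -> R).

Definition nrm2 x := \sum_i x i ^+ 2.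

Definition bil H x y := \sum_i \sum_j x i * H i j * y j.

(** An operator norm bound as a predicate, without a supremum. The one-sided form loses nothing,
    since [x] may be replaced by its opposite. *)
Definition opb H (h : R) := forall x y, nrm2 x <= 1 -> nrm2 y <= 1 -> bil H x y <= h.

Lemma nrm2_ge0 x : 0 <= nrm2 x.
Proof. by apply: sumr_ge0 => i _; exact: sqr_ge0. Qed.

Lemma sqr_le_nrm2 x i : x i ^+ 2 <= nrm2 x.
Proof. by rewrite /nrm2 (bigD1 i)//= lerDl sumr_ge0// => j _; exact: sqr_ge0. Qed.

Lemma nrm2_le_norm x y : (forall i, `|x i| <= `|y i|) -> nrm2 x <= nrm2 y.
Proof.
move=> xy; apply: ler_sum => i _.
by rewrite -[x i ^+ 2]real_normK ?num_real// -[y i ^+ 2]real_normK ?num_real// lerXn2r ?nnegrE.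
Qed.

Lemma norm_le_nrm2 x i : nrm2 x <= 1 -> `|x i| <= 1.
Proof.
move=> x1; rewrite -(@ler_pXn2r _ 2)// ?nnegrE//.
by rewrite expr1n real_normK ?num_real// (le_trans (sqr_le_nrm2 x i)).
Qed.

Lemma nrm2_scale a x : nrm2 (fun i => a * x i) = a ^+ 2 * nrm2 x.
Proof. by rewrite /nrm2 mulr_sumr; apply: eq_bigr => i _; rewrite exprMn. Qed.

Lemma bil_scale H a b x y :
  bil H (fun i => a * x i) (fun i => b * y i) = a * b * bil H x y.
Proof.
rewrite /bil mulr_sumr; apply: eq_bigr => i _; rewrite mulr_sumr.
by apply: eq_bigr => j _; ring.
Qed.

Lemma bilDl H x x' y : bil H (fun i => x i + x' i) y = bil H x y + bil H x' y.
Proof.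
rewrite /bil -big_split; apply: eq_bigr => i _; rewrite -big_split.
by apply: eq_bigr => j _ /=; ring.
Qed.

Lemma bilDr H x y y' : bil H x (fun i => y i + y' i) = bil H x y + bil H x y'.
Proof.
rewrite /bil -big_split; apply: eq_bigr => i _; rewrite -big_split.
by apply: eq_bigr => j _ /=; ring.
Qed.

Lemma bil_ext H x x' y y' : x =1 x' -> y =1 y' -> bil H x y = bil H x' y'.
Proof. by move=> /funext -> /funext ->. Qed.

Lemma bil_sym H x y : (forall i j, H i j = H j i) -> bil H x y = bil H y x.
Proof.
move=> sH; rewrite /bil exchange_big/=; apply: eq_bigr => i _.
by apply: eq_bigr => j _; rewrite sH; ring.
Qed.

Lemma opb_ge0 H h : opb H h -> 0 <= h.
Proof.
have z : nrm2 (fun=> 0) <= 1.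
  by rewrite /nrm2 big1 ?ler01// => i _; rewrite expr0n.
move=> /(_ _ _ z z); rewrite /bil big1// => i _.
by rewrite big1// => j _; rewrite mulr0.
Qed.

Lemma opb_ext H H' h : (forall i j, H i j = H' i j) -> opb H h -> opb H' h.
Proof.
by move=> HH'; rewrite (_ : H = H')//; apply/funext => i; apply/funext => j.
Qed.

Lemma opbD H H' h h' : opb H h -> opb H' h' -> opb (fun i j => H i j + H' i j) (h + h').
Proof.
move=> oH oH' x y x1 y1; apply: le_trans (lerD (oH _ _ x1 y1) (oH' _ _ x1 y1)).
rewrite /bil -big_split ler_sum// => i _; rewrite -big_split ler_sum// => j _ /=.
by rewrite mulrDr mulrDl.
Qed.

Lemma opb_sum H : opb H (\sum_i \sum_j `|H i j|).
Proof.
move=> x y x1 y1; apply: ler_sum => i _; apply: ler_sum => j _.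
apply: (le_trans (ler_norm _)); rewrite !normrM.
rewrite -[leRHS]mulr1 ler_pM ?mulr_ge0 ?norm_le_nrm2//.
by rewrite ler_piMl ?norm_le_nrm2.
Qed.

Lemma opb_scaled H h a b x y : opb H h -> 0 < a -> 0 < b ->
  nrm2 x <= a ^+ 2 -> nrm2 y <= b ^+ 2 -> bil H x y <= a * b * h.
Proof.
move=> oH a0 b0 xa yb.
have := oH (fun i => a^-1 * x i) (fun i => b^-1 * y i).
rewrite !nrm2_scale bil_scale !exprVn => /(_ _ _).
rewrite mulrC ler_pdivrMr ?exprn_gt0// mul1r => /(_ xa).
rewrite mulrC ler_pdivrMr ?exprn_gt0// mul1r => /(_ yb).
by rewrite -invfM mulrC ler_pdivrMr ?mulr_gt0// mulrC.
Qed.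

Lemma amgm (u v : R) : u * v <= (u ^+ 2 + v ^+ 2) / 2.
Proof. by have := sqr_ge0 (u - v); rewrite !expr2; nra. Qed.

Lemma opb_diag (D : 'I_n -> R) h : (forall i, `|D i| <= h) -> 0 <= h ->
  opb (fun i j => if i == j then D i else 0) h.
Proof.
move=> Dh h0 x y x1 y1.
apply: (@le_trans _ _ (\sum_i h * ((x i ^+ 2 + y i ^+ 2) / 2))).
  apply: ler_sum => i _; rewrite (bigD1 i)//= eqxx big1 ?addr0; last first.
    by move=> j ji; rewrite eq_sym (negbTE ji) mulr0 mul0r.
  apply: (le_trans (ler_norm _)); rewrite !normrM mulrAC mulrC.
  apply: ler_pM; rewrite ?mulr_ge0//.
  by apply: (le_trans (amgm _ _)); rewrite !real_normK ?num_real.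
rewrite -mulr_sumr -mulr_suml big_split/= -/(nrm2 x) -/(nrm2 y).
by rewrite -[leRHS]mulr1 ler_wpM2l//; lra.
Qed.

Lemma opb_schur H h : 0 <= h -> (forall i, \sum_j `|H i j| <= h) ->
  (forall j, \sum_i `|H i j| <= h) -> opb H h.
Proof.
move=> h0 hr hc x y x1 y1.
apply: (@le_trans _ _ (\sum_i \sum_j (x i ^+ 2 / 2 * `|H i j| + y j ^+ 2 / 2 * `|H i j|))).
  apply: ler_sum => i _; apply: ler_sum => j _.
  apply: (le_trans (ler_norm _)); rewrite !normrM mulrAC -mulrDl.
  rewrite ler_wpM2r// (le_trans (amgm _ _))// !real_normK ?num_real//.
  by rewrite mulrDl.
under eq_bigr do rewrite big_split/=.
rewrite big_split/= [X in _ + X]exchange_big/=.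
under eq_bigr do rewrite -mulr_sumr.
under [X in _ + X]eq_bigr do rewrite -mulr_sumr.
have : \sum_i (x i ^+ 2 / 2 * \sum_j `|H i j|) <= nrm2 x / 2 * h.
  rewrite /nrm2 mulr_suml mulr_suml; apply: ler_sum => i _.
  by rewrite ler_wpM2l// divr_ge0// sqr_ge0.
have : \sum_j (y j ^+ 2 / 2 * \sum_i `|H i j|) <= nrm2 y / 2 * h.
  rewrite /nrm2 mulr_suml mulr_suml; apply: ler_sum => i _.
  by rewrite ler_wpM2l// divr_ge0// sqr_ge0.
have : nrm2 x / 2 * h <= h / 2 by nra.
have : nrm2 y / 2 * h <= h / 2 by nra.
lra.
Qed.

Lemma supp_card_le x (th : R) : 0 <= th -> nrm2 x <= 1 ->
  (forall i, x i != 0 -> th <= `|x i|) ->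
  #|[set i | x i != 0]%SET|%:R * th ^+ 2 <= 1.
Proof.
move=> th0 x1 xth; apply: le_trans x1.
rewrite mulrC mulr_natr -sumr_const.
under eq_bigl do rewrite inE.
rewrite /nrm2 [leRHS](bigID (fun i => x i != 0))/= -[leLHS]addr0 lerD//.
  apply: ler_sum => i xi; rewrite -[leRHS]real_normK ?num_real//.
  by rewrite lerXn2r ?nnegrE// xth.
by apply: sumr_ge0 => i _; exact: sqr_ge0.
Qed.

(** The squared length of [x^T H] is the quadratic form of the Gram matrix of the rows at [x]. Its
    diagonal contributes at most [R0], and its off-diagonal part at most [t] times the squared l1
    norm of [x], which is at most the size of the support of [x], hence at most [th^(-2)]. *)
Lemma bil_sparse_gram H (R0 t th g : R) x y :
  (forall i, \sum_k H i k ^+ 2 <= R0) ->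
  (forall i j, i != j -> `|\sum_k H i k * H j k| <= t) ->
  0 < th -> 0 < g -> 0 <= R0 -> 0 <= t -> R0 + t / th ^+ 2 <= g ^+ 2 ->
  nrm2 x <= 1 -> nrm2 y <= 1 -> (forall i, x i != 0 -> th <= `|x i|) ->
  bil H x y <= g.
Proof.
move=> HR Ht th0 g0 R00 t0 Rg x1 y1 xth.
pose z k := \sum_i x i * H i k.
have -> : bil H x y = \sum_k z k * y k.
  by rewrite /bil exchange_big/=; apply: eq_bigr => k _; rewrite /z mulr_suml.
have zg : \sum_k z k ^+ 2 <= g ^+ 2.
  apply: le_trans Rg.
  have -> : \sum_k z k ^+ 2 = \sum_i \sum_j x i * x j * \sum_k H i k * H j k.
    under eq_bigr do rewrite expr2 /z mulr_suml.
    rewrite exchange_big/=; apply: eq_bigr => i _.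
    under eq_bigr do rewrite mulr_sumr.
    rewrite exchange_big/=; apply: eq_bigr => j _; rewrite mulr_sumr.
    by apply: eq_bigr => k _; ring.
  apply: (@le_trans _ _ (\sum_i \sum_j ((if i == j then x i ^+ 2 * R0 else 0) +
      t * (`|x i| * `|x j|)))).
    apply: ler_sum => i _; apply: ler_sum => j _; case: eqVneq => [<-|ij].
      rewrite -expr2 -[leLHS]addr0 lerD//; last by rewrite !mulr_ge0.
      rewrite ler_wpM2l ?sqr_ge0//; under eq_bigr do rewrite -expr2; exact: HR.
    rewrite add0r; apply: (le_trans (ler_norm _)); rewrite !normrM mulrC.
    by rewrite ler_wpM2r ?mulr_ge0// Ht.
  under eq_bigr do rewrite big_split/=.
  rewrite big_split/= lerD//.
    have -> : \sum_i \sum_j (if i == j then x i ^+ 2 * R0 else 0) = nrm2 x * R0.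
      rewrite /nrm2 mulr_suml; apply: eq_bigr => i _.
      by rewrite -big_mkcond/= (big_pred1 i)// => j; rewrite /= eq_sym.
    by rewrite ler_piMl.
  under eq_bigr do rewrite -mulr_sumr.
  rewrite -mulr_sumr ler_wpM2l//.
  pose S := [set i | x i != 0]%SET.
  have suppS i : i \notin S -> x i = 0 by rewrite inE negbK => /eqP.
  have -> : \sum_i \sum_j `|x i| * `|x j| = \sum_(i in S) \sum_(j in S) `|x i| * `|x j|.
    rewrite [LHS](bigID (mem S))/= [X in _ + X]big1 ?addr0; last first.
      by move=> i /suppS ->; rewrite big1// => j _; rewrite normr0 mul0r.
    apply: eq_bigr => i _; rewrite [LHS](bigID (mem S))/= [X in _ + X]big1 ?addr0//.
    by move=> j /suppS ->; rewrite normr0 mulr0.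
  apply: (@le_trans _ _ (\sum_(i in S) \sum_(j in S) (x i ^+ 2 / 2 + x j ^+ 2 / 2))).
    apply: ler_sum => i _; apply: ler_sum => j _.
    by apply: (le_trans (amgm _ _)); rewrite !real_normK ?num_real// mulrDl.
  under eq_bigr do rewrite big_split/= sumr_const.
  rewrite big_split/= sumr_const sumrMnl -!mulr_suml.
  have -> : \sum_(i in S) x i ^+ 2 = nrm2 x.
    rewrite /nrm2 [RHS](bigID (mem S))/= [X in _ = _ + X]big1 ?addr0//.
    by move=> i /suppS ->; rewrite expr0n.
  rewrite -mulrnDl -splitr -mulr_natr.
  rewrite -[(th ^+ 2)^-1]mul1r ler_pdivlMr ?exprn_gt0//.
  apply: (@le_trans _ _ (#|S|%:R * th ^+ 2)); last exact: supp_card_le (ltW th0) x1 xth.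
  by rewrite -mulrA ler_piMl// mulr_ge0// sqr_ge0.
(* Cauchy-Schwarz as AM-GM with weight [g]: each of the two sums is at most [g / 2]. *)
apply: (@le_trans _ _ (\sum_k (g^-1 * (z k ^+ 2 / 2) + g * (y k ^+ 2 / 2)))).
  apply: ler_sum => k _.
  have h := sqr_ge0 (z k - g * y k).
  rewrite -(ler_pM2l g0) mulrDr (mulrA g g^-1) divff ?mul1r ?gt_eqF//.
  by move: h; rewrite !expr2; nra.
rewrite big_split/= -!mulr_sumr -!mulr_suml -/(nrm2 y).
have h1 : g^-1 * ((\sum_k z k ^+ 2) / 2) <= g / 2.
  by rewrite -(ler_pM2l g0) (mulrA g g^-1) divff ?mul1r ?gt_eqF//; move: zg; lra.
have h2 : g * (nrm2 y / 2) <= g / 2 by rewrite ler_wpM2l ?(ltW g0)//; lra.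
lra.
Qed.

End BilinearForms.

Section OperatorNorm.
Context (R : realType) (n : nat).
Implicit Types (x y : 'I_n -> R) (H : 'I_n -> 'I_n -> R) (M : 'M[R]_n).

Lemma opb_norm M h (x : 'cV[R]_n) : opb M h -> \sum_i (x i 0) ^+ 2 = 1 ->
  Num.sqrt (\sum_i ((M *m x) i 0) ^+ 2) <= h.
Proof.
move=> oM x1; have h0 := opb_ge0 oM.
pose u i := (M *m x) i 0; rewrite -/(nrm2 u).
have [u0|un0] := eqVneq (nrm2 u) 0; first by rewrite u0 sqrtr0.
have up : 0 < nrm2 u by rewrite lt_neqAle eq_sym un0 nrm2_ge0.
have sp : 0 < Num.sqrt (nrm2 u) by rewrite sqrtr_gt0.
have s2 : Num.sqrt (nrm2 u) ^+ 2 = nrm2 u by rewrite sqr_sqrtr// ltW.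
have := @opb_scaled _ _ _ _ (Num.sqrt (nrm2 u)) 1 u (fun i => x i 0) oM sp ltr01.
rewrite s2 expr1n /nrm2 x1 !lexx -/(nrm2 u) => /(_ isT isT).
have -> : bil M u (fun i => x i 0) = nrm2 u.
  rewrite /bil; apply: eq_bigr => i _; rewrite expr2 [X in _ = _ * X]mxE mulr_sumr.
  by apply: eq_bigr => j _; rewrite mulrA.
by rewrite -[X in X <= _]s2 expr2 mulr1 ler_pM2l.
Qed.

Lemma opnorm_le M h : (0 < n)%N -> opb M h -> opnorm M <= h.
Proof.
move=> n0 oM; apply: ge_sup.
  exists (Num.sqrt (\sum_i ((M *m (delta_mx (Ordinal n0) 0 : 'cV_n)) i 0) ^+ 2)) => /=.
  exists (delta_mx (Ordinal n0) 0); split=> //.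
  rewrite (bigD1 (Ordinal n0))//= mxE !eqxx expr1n big1 ?addr0// => i ni.
  by rewrite mxE (negbTE ni) expr0n.
by move=> r [x [x1 ->]]; exact: opb_norm.
Qed.

Lemma opnorm_ge_diag M (i : 'I_n) : `|M i i| <= opnorm M.
Proof.
apply: (@le_trans _ _ (Num.sqrt (\sum_k ((M *m (delta_mx i 0 : 'cV_n)) k 0) ^+ 2))).
  rewrite -sqrtr_sqr ler_sqrt ?sumr_ge0// => [|k _]; last exact: sqr_ge0.
  rewrite (bigD1 i)//= -colE mxE lerDl sumr_ge0// => k _; exact: sqr_ge0.
apply: ub_le_sup.
  (* The crude bound only serves to show that the supremum defining [opnorm] is over a bounded
     set. *)
  exists (\sum_i \sum_j `|M i j|) => r [x [x1 ->]].
  by apply: opb_norm => //; exact: opb_sum.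
exists (delta_mx i 0); split=> //.
rewrite (bigD1 i)//= mxE !eqxx expr1n big1 ?addr0// => j ni.
by rewrite mxE (negbTE ni) expr0n.
Qed.

(** Discretisation errors are proportional to the unknown norm itself. Applied to the best bound
    [h], finite by [opb_sum], the hypothesis gives [h <= B + h / 2], and the error is absorbed. *)
Lemma opb_absorb H (B : R) :
  (forall h, opb H h -> opb H (B + h / 2)) -> opb H (2 * B).
Proof.
move=> HB x y x1 y1.
pose h := sup [set r | exists x y, [/\ nrm2 x <= 1, nrm2 y <= 1 & r = bil H x y]].
have ub : has_ubound [set r | exists x y, [/\ nrm2 x <= 1, nrm2 y <= 1 & r = bil H x y]].
  exists (\sum_i \sum_j `|H i j|) => r [x' [y' [x1' y1' ->]]].
  exact: opb_sum.
have oh : opb H h.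
  by move=> x' y' x1' y1'; apply: ub_le_sup => //; exists x', y'.
have : h <= B + h / 2.
  apply: ge_sup; first by exists (bil H x y), x, y.
  by move=> r [x' [y' [x1' y1' ->]]]; exact: HB.
have := oh x y x1 y1; lra.
Qed.

Definition gridvec m (h0 : R) (f : {ffun 'I_n -> bool * 'I_m}) (i : 'I_n) : R :=
  (-1) ^+ (f i).1 * (f i).2%:R * h0.

(* Zero is represented with a single sign, so that sparse grid vectors are few. *)
Definition grid_reduced m (f : {ffun 'I_n -> bool * 'I_m}) :=
  [forall i, ((f i).2 == 0 :> nat) ==> ~~ (f i).1].

(** Rounding is towards zero, so no coordinate grows and no zero coordinate becomes nonzero: size
    thresholds and support bounds pass from [x] to its grid vector. *)
Lemma grid_round m (h0 c : R) x : 0 < h0 -> h0^-1 < m%:R -> n%:R * h0 ^+ 2 <= c ^+ 2 ->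
  nrm2 x <= 1 ->
  exists f : {ffun 'I_n -> bool * 'I_m}, [/\ grid_reduced f,
    forall i, `|gridvec h0 f i| <= `|x i| &
    nrm2 (fun i => x i - gridvec h0 f i) <= c ^+ 2].
Proof.
move=> h00 hm nc x1.
have tm i : (Num.truncn (`|x i| / h0) < m)%N.
  rewrite truncn_lt_nat ?divr_ge0// ?ltW//; apply: le_lt_trans hm.
  by rewrite ler_piMl ?invr_ge0 ?(ltW h00)// norm_le_nrm2.
(* The sign bit is dropped when the magnitude rounds to 0, which makes [f] reduced. *)
pose f := [ffun i => ((x i < 0) && (Num.truncn (`|x i| / h0) != 0%N), Ordinal (tm i))].
have hi i : 0 <= `|x i| - (Num.truncn (`|x i| / h0))%:R * h0 <= h0.
  have /truncn_itv /andP[] : 0 <= `|x i| / h0 by rewrite divr_ge0// ltW.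
  rewrite ler_pdivlMr// ltr_pdivrMr// -natr1 mulrDl mul1r; lra.
have gE i : gridvec h0 f i = (-1) ^+ (x i < 0)%R * ((Num.truncn (`|x i| / h0))%:R * h0).
  rewrite /gridvec ffunE mulrA/=; case: eqP => [->|_]; last by rewrite andbT.
  by rewrite !mulr0.
exists f; split=> [|i|].
- by apply/forallP => i; rewrite ffunE/=; apply/implyP => /eqP ->; rewrite andbF.
- rewrite gE normrMsign ger0_norm; last by rewrite mulr_ge0// ltW.
  by have := hi i; lra.
- apply: le_trans nc; rewrite mulr_natl -[X in _ *+ X]card_ord -sumr_const.
apply: ler_sum => i _.
have -> : x i - gridvec h0 f i =
    (-1) ^+ (x i < 0)%R * (`|x i| - (Num.truncn (`|x i| / h0))%:R * h0).
  by rewrite gE mulrBr -numEsign.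
by rewrite exprMn sqrr_sign mul1r lerXn2r ?nnegrE ?(ltW h00)//; have /andP[] := hi i.
Qed.

Lemma bil_round H h c x y x' y' : opb H h -> 0 < c ->
  nrm2 y <= 1 -> nrm2 x' <= 1 ->
  nrm2 (fun i => x i - x' i) <= c ^+ 2 -> nrm2 (fun i => y i - y' i) <= c ^+ 2 ->
  bil H x y <= bil H x' y' + 2 * c * h.
Proof.
move=> oH c0 y1 x1 xc yc.
have -> : bil H x y = bil H (fun i => x i - x' i) y +
    (bil H x' y' + bil H x' (fun i => y i - y' i)).
  rewrite -bilDr (bil_ext _ (x := x') (x' := x') (y' := y))//; last by move=> i; ring.
  by rewrite -bilDl; apply: bil_ext => i //; ring.
have h1 : bil H (fun i => x i - x' i) y <= c * 1 * h.
  by apply: opb_scaled => //; rewrite expr1n.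
have h2 : bil H x' (fun i => y i - y' i) <= 1 * c * h.
  by apply: opb_scaled => //; rewrite expr1n.
lra.
Qed.

(* Unit vectors are split by coordinate size at the thresholds [th2 <= th1]; the
   constant 1/12 lets the six rounding errors be absorbed. *)
Lemma opb_levels H m (h0 th1 th2 g t2 t3 : R) :
  (forall i j, H i j = H j i) ->
  0 < h0 -> h0^-1 < m%:R -> n%:R * h0 ^+ 2 <= 12^-1 ^+ 2 -> 0 <= th2 -> th2 <= th1 ->
  (forall x y, nrm2 x <= 1 -> nrm2 y <= 1 ->
     (forall i, x i != 0 -> th1 <= `|x i|) -> bil H x y <= g) ->
  (forall f f' : {ffun 'I_n -> bool * 'I_m}, grid_reduced f -> grid_reduced f' ->
     nrm2 (gridvec h0 f) <= 1 -> nrm2 (gridvec h0 f') <= 1 ->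
     (forall i, `|gridvec h0 f i| <= th1) -> (forall i, `|gridvec h0 f' i| <= th1) ->
     #|[set i | gridvec h0 f i != 0]%SET|%:R * th2 ^+ 2 <= 1 ->
     #|[set i | gridvec h0 f' i != 0]%SET|%:R * th2 ^+ 2 <= 1 ->
     bil H (gridvec h0 f) (gridvec h0 f') <= t2) ->
  (forall f f' : {ffun 'I_n -> bool * 'I_m},
     nrm2 (gridvec h0 f) <= 1 -> nrm2 (gridvec h0 f') <= 1 ->
     (forall i, `|gridvec h0 f i| <= th2) -> (forall i, `|gridvec h0 f' i| <= th1) ->
     bil H (gridvec h0 f) (gridvec h0 f') <= t3) ->
  opb H (2 * (2 * g + t2 + 2 * t3)).
Proof.
move=> sH h00 hm nc th20 th21 HG H2 H3; apply: opb_absorb => h oH x y x1 y1.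
pose a1 z (i : 'I_n) : R := if th1 < `|z i| then z i else 0.
pose a2 z (i : 'I_n) : R := if th2 < `|z i| <= th1 then z i else 0.
pose a3 z (i : 'I_n) : R := if `|z i| <= th2 then z i else 0.
pose a23 z (i : 'I_n) : R := if `|z i| <= th1 then z i else 0.
have dec z : z =1 (fun i => a1 z i + a23 z i).
  by move=> i; rewrite /a1 /a23; case: ltP; rewrite ?addr0 ?add0r.
have dec' z : a23 z =1 (fun i => a2 z i + a3 z i).
  move=> i; rewrite /a2 /a3 /a23; case: (ltP th2) => h1/=; first by rewrite addr0.
  by rewrite add0r (le_trans h1).
have le_nrm (q : ('I_n -> R) -> 'I_n -> bool) z : nrm2 z <= 1 ->
    nrm2 (fun i => if q z i then z i else 0) <= 1.
  by apply: le_trans; apply: nrm2_le_norm => i; case: ifP => // _; rewrite normr0.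
have n1 z : nrm2 z <= 1 -> nrm2 (a1 z) <= 1 by exact: (le_nrm (fun z i => th1 < `|z i|)).
have n2 z : nrm2 z <= 1 -> nrm2 (a2 z) <= 1 by exact: (le_nrm (fun z i => th2 < `|z i| <= th1)).
have n3 z : nrm2 z <= 1 -> nrm2 (a3 z) <= 1 by exact: (le_nrm (fun z i => `|z i| <= th2)).
have n23 z : nrm2 z <= 1 -> nrm2 (a23 z) <= 1 by exact: (le_nrm (fun z i => `|z i| <= th1)).
have s1 z i : a1 z i != 0 -> th1 <= `|a1 z i|.
  by rewrite /a1; case: ifP; rewrite ?eqxx// => /ltW.
have s2 z i : a2 z i != 0 -> th2 <= `|a2 z i|.
  by rewrite /a2; case: ifP; rewrite ?eqxx// => /andP[/ltW].
have th10 : 0 <= th1 by exact: le_trans th21.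
have b2 z i : `|a2 z i| <= th1.
  by rewrite /a2; case: ifP; rewrite ?normr0// => /andP[].
have b3 z i : `|a3 z i| <= th2 by rewrite /a3; case: ifP; rewrite ?normr0.
have b23 z i : `|a23 z i| <= th1 by rewrite /a23; case: ifP; rewrite ?normr0.
have gr z := @grid_round m h0 12^-1 z h00 hm nc.
have c0 : 0 < 12^-1 :> R by lra.
have g1 : bil H (a1 x) y <= g by apply: HG => //; [exact: n1|exact: s1].
have g2 : bil H (a23 x) (a1 y) <= g.
  by rewrite bil_sym//; apply: HG; [exact: n1|exact: n23|exact: s1].
have r3 z z' : nrm2 z <= 1 -> nrm2 z' <= 1 -> (forall i, `|z i| <= th2) ->
    (forall i, `|z' i| <= th1) -> bil H z z' <= t3 + 2 * 12^-1 * h.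
  move=> z1 z1' zb zb'.
  have [f [_ fz fc]] := gr z z1; have [f' [_ fz' fc']] := gr z' z1'.
  have fn : nrm2 (gridvec h0 f) <= 1 by exact: le_trans (nrm2_le_norm fz) z1.
  apply: (le_trans (bil_round oH c0 z1' fn fc fc')); rewrite lerD2r; apply: H3 => //.
  - exact: le_trans (nrm2_le_norm fz') z1'.
  - by move=> i; apply: le_trans (fz i) (zb i).
  - by move=> i; apply: le_trans (fz' i) (zb' i).
have r2 : bil H (a2 x) (a2 y) <= t2 + 2 * 12^-1 * h.
  have [f [fr fz fc]] := gr _ (n2 x x1); have [f' [fr' fz' fc']] := gr _ (n2 y y1).
  have fn : nrm2 (gridvec h0 f) <= 1 by exact: le_trans (nrm2_le_norm fz) (n2 x x1).
  apply: (le_trans (bil_round oH c0 (n2 y y1) fn fc fc')); rewrite lerD2r.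
  have sub (F : {ffun 'I_n -> bool * 'I_m}) z : nrm2 z <= 1 ->
      (forall i, `|gridvec h0 F i| <= `|a2 z i|) ->
      #|[set i | gridvec h0 F i != 0]%SET|%:R * th2 ^+ 2 <= 1.
    move=> z1 Fz; apply: le_trans (supp_card_le th20 (n2 z z1) (s2 z)).
    rewrite ler_wpM2r ?sqr_ge0// ler_nat subset_leq_card//.
    apply/fintype.subsetP => i; rewrite !inE; apply: contra => /eqP ai.
    by have := Fz i; rewrite ai normr0 normr_le0.
  apply: H2 => //.
  - exact: le_trans (nrm2_le_norm fz') (n2 y y1).
  - by move=> i; apply: le_trans (fz i) (b2 x i).
  - by move=> i; apply: le_trans (fz' i) (b2 y i).
  - exact: sub fz.
  - exact: sub fz'.
have r31 := r3 _ _ (n3 x x1) (n23 y y1) (b3 x) (b23 y).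
have r32 := r3 _ _ (n3 y y1) (n2 x x1) (b3 y) (b2 x).
(* The form splits into five pieces: ([a1 x], [y]) and ([a23 x], [a1 y]) cost [g] each, ([a2 x],
   [a2 y]) costs [t2], and ([a3 x], [a23 y]) and ([a2 x], [a3 y]) cost [t3] each. The last three are
   rounded, at a cost of [h / 6] apiece. *)
rewrite (bil_ext _ (dec x) (fun=> erefl)) bilDl.
rewrite (bil_ext (x' := a23 x) _ (fun=> erefl) (dec y)) bilDr.
rewrite (bil_ext (y' := a23 y) _ (dec' x) (fun=> erefl)) bilDl.
rewrite (bil_ext (x' := a2 x) _ (fun=> erefl) (dec' y)) bilDr.
rewrite (bil_sym (a2 x) (a3 y))//.
lra.
Qed.

End OperatorNorm.

Section GridCounting.
Context (R : realType) (n m : nat).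
Notation grid := {ffun 'I_n -> bool * 'I_m}.
Implicit Types (f : grid).

Lemma sum_grid_prod (w : bool * 'I_m -> R) :
  \sum_(f : grid) \prod_i w (f i) = (\sum_p w p) ^+ n.
Proof.
by rewrite -(bigA_distr_bigA (fun=> w))/= prodr_const card_ord.
Qed.

(** An exponential Markov inequality for the counting measure: a product weight that is at least
    [1 / C] on [Q] reduces the count to a sum over one coordinate. *)
Lemma card_le_weight (Q : pred grid) (w : bool * 'I_m -> R) (C : R) :
  (forall p, 0 <= w p) -> 0 <= C -> (forall f, Q f -> 1 <= C * \prod_i w (f i)) ->
  #|Q|%:R <= C * (\sum_p w p) ^+ n.
Proof.
move=> w0 C0 Qw; rewrite -sum_grid_prod mulr_sumr -sum1_card natr_sum.
rewrite [leRHS](bigID Q)/= -[leLHS]addr0 lerD//; first exact: ler_sum.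
by apply: sumr_ge0 => f _; rewrite mulr_ge0// prodr_ge0.
Qed.

Lemma geometric_expRN_le k : \sum_(i < k) expR (- (i%:R : R)) <= 2.
Proof.
suff : \sum_(i < k) expR (- (i%:R : R)) <= 2 - 2 * expR (- (k%:R)).
  by have := expR_ge0 (- (k%:R) : R); lra.
elim: k => [|k IH]; first by rewrite big_ord0 oppr0 expR0; lra.
rewrite big_ord_recr/= -[k.+1%:R]natr1 opprD expRD.
have h : expR (- 1) <= 2^-1 :> R.
  by rewrite expRN lef_pV2 ?posrE ?expR_gt0//; have := expR_ge1Dx (1 : R); lra.
have := expR_gt0 (- (k%:R) : R); move: IH h; set a := expR (- k%:R); set b := expR (- 1).
nra.
Qed.

(** The weight is [exp (- k)] for a coordinate of magnitude [k h0]. In the unit ball the squares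
    [k^2] add up to at most [h0^(-2)], hence so do the [k]; one coordinate with its two signs has
    total weight at most 4, below [exp 2]. *)
Lemma card_grid_ball (h0 : R) : 0 < h0 ->
  #|[pred f : grid | nrm2 (gridvec h0 f) <= 1]|%:R <= expR (h0 ^- 2 + 2 * n%:R).
Proof.
move=> h00.
apply: le_trans (card_le_weight (w := fun p => expR (- (p.2%:R))) (C := expR (h0 ^- 2)) _ _ _) _.
- by move=> p; exact: expR_ge0.
- exact: expR_ge0.
- move=> f /= f1; rewrite -expR_sum -expRD -[leLHS]expR0 ler_expR sumrN subr_ge0.
  rewrite -[leRHS]mul1r ler_pdivlMr ?exprn_gt0//; apply: le_trans f1.
  rewrite mulr_suml; apply: ler_sum => i _.
  rewrite /gridvec exprMn ler_wpM2r ?sqr_ge0// exprMn sqrr_sign mul1r -natrX. rewrite ler_nat.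
  by case: (nat_of_ord _) => // k; rewrite leq_pmulr.
- rewrite expRD ler_wpM2l ?expR_ge0//.
  rewrite mulrC expRM_natl; apply: lerXn2r; rewrite ?nnegrE ?expR_ge0//.
    by apply: sumr_ge0 => p _; exact: expR_ge0.
  rewrite -(pair_bigA _ (fun (b : bool) (k : 'I_m) => expR (- (k%:R))))/=.
  rewrite big_bool/=; have := geometric_expRN_le m.
  have : 2 <= expR 1 :> R by have := expR_ge1Dx (1 : R); lra.
  have -> : expR 2 = expR 1 * expR 1 :> R by rewrite -expRD; congr expR; lra.
  nra.
Qed.

(** A nonzero coordinate gets weight [1 / u] with [u = 2 m n], and the reduced zero gets weight 1.
    One coordinate then has total weight at most [1 + 1 / n], whose [n]-th power is below [exp 1],
    while a support of size at most [th^(-2)] costs a factor [u^(th^(-2))]. *)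
Lemma card_grid_sparse (h0 th : R) : (0 < n)%N -> (0 < m)%N -> 0 < h0 -> 0 < th ->
  #|[pred f : grid | grid_reduced f &&
     (#|[set i | gridvec h0 f i != 0]%SET|%:R * th ^+ 2 <= 1)]|%:R <=
  expR (th ^- 2 * ln (2 * m%:R * n%:R) + 1).
Proof.
move=> n0 m0 h00 th0.
have n1 : 1 <= n%:R :> R by rewrite ler1n.
have m1 : 1 <= m%:R :> R by rewrite ler1n.
pose u : R := 2 * m%:R * n%:R.
have u1 : 1 <= u by rewrite /u; nra.
have up : 0 < u by lra.
pose w (p : bool * 'I_m) : R := if p.2 != 0%N :> nat then u^-1 else (~~ p.1)%:R.
have w0 p : 0 <= w p by rewrite /w; case: ifP => // _; rewrite invr_ge0 ltW.
apply: le_trans (card_le_weight (w := w) (C := expR (th ^- 2 * ln u)) w0 _ _) _.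
- exact: expR_ge0.
- move=> f /= /andP[/forallP fr fth].
  have wE i : w (f i) = expR (- ((gridvec h0 f i != 0)%R%:R * ln u)).
    have /implyP := fr i; rewrite /w /gridvec.
    rewrite !mulf_eq0 signr_eq0 (gt_eqF h00) orbF/= pnatr_eq0.
    case: eqP => [_ /(_ isT) ->|_ _] /=.
      by rewrite mul0r oppr0 expR0.
    by rewrite mul1r expRN lnK.
  rewrite (eq_bigr _ (fun i _ => wE i)) -expR_sum -expRD -[leLHS]expR0 ler_expR sumrN.
  rewrite subr_ge0 -mulr_suml ler_wpM2r ?ln_ge0//.
  rewrite -[leRHS]mul1r ler_pdivlMr ?exprn_gt0//; apply: le_trans fth.
  rewrite ler_wpM2r ?sqr_ge0// -natr_sum ler_nat -big_mkcond/= sum1_card.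
  by rewrite (eq_card (B := mem [set i | gridvec h0 f i != 0]%SET))// => i; rewrite inE.
- rewrite expRD ler_wpM2l ?expR_ge0//.
  have ws : \sum_p w p <= 1 + n%:R^-1.
    rewrite -(pair_bigA _ (fun (b : bool) (k : 'I_m) => w (b, k)))/= big_bool/=.
    have h1 : \sum_(k < m) w (true, k) <= m%:R * u^-1.
      rewrite mulr_natl -[X in _ *+ X]card_ord -sumr_const; apply: ler_sum => k _.
      by rewrite /w; case: ifP => //= _; rewrite invr_ge0 ltW.
    have h2 : \sum_(k < m) w (false, k) <= 1 + m%:R * u^-1.
      rewrite (bigD1 (Ordinal m0))//= lerD//.
      rewrite mulr_natl -[X in _ *+ X]card_ord -sumr_const.
      rewrite [leRHS](bigD1 (Ordinal m0))//= -[leLHS]add0r lerD ?invr_ge0 ?(ltW up)//.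
      by apply: ler_sum => k k0; rewrite /w/= ifT.
    have -> : n%:R^-1 = m%:R * u^-1 + m%:R * u^-1.
      by rewrite /u; field; rewrite !pnatr_eq0 -!lt0n n0 m0.
    lra.
  apply: (@le_trans _ _ (expR (n%:R^-1) ^+ n)).
    apply: lerXn2r; rewrite ?nnegrE ?expR_ge0 ?sumr_ge0//.
    by apply: (le_trans ws); exact: expR_ge1Dx.
  by rewrite -expRM_natl mulfV// pnatr_eq0 -lt0n.
Qed.

End GridCounting.

(** * Truncated sums *)

Section TruncatedSums.
Context (R : realType) d (T : measurableType d) (P : probability T R).

Definition trunc (t x : R) : R := if `|x| <= t then x else 0.

Lemma trunc_le (t x : R) : 0 <= t -> `|trunc t x| <= t.
Proof. by move=> t0; rewrite /trunc; case: ifP; rewrite ?normr0. Qed.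

Lemma bm_trunc (t : R) : 0 <= t -> bounded_measurable (trunc t).
Proof.
move=> t0; split.
  apply: measurable_fun_ifT => //; apply: measurable_fun_ler => //.
by exists t => x; exact: trunc_le.
Qed.

(** [Z] is not assumed centred: truncation destroys centring, and the mean that remains is carried
    along as an explicit linear error. *)
Lemma mgf_le (Z : T -> R) (l b t : R) : bounded_measurable Z ->
  (forall w, `|Z w| <= b) -> `|l| * b <= t -> t <= 1 ->
  Ex P (fun w => expR (l * Z w)) <=
  expR (`|l| * `|Ex P Z| + (2^-1 + t) * l ^+ 2 * Ex P (fun w => Z w ^+ 2)).
Proof.
move=> bZ Zb lb t1.
have bZ2 : bounded_measurable (fun w => Z w ^+ 2) by exact: bm_mul.
apply: le_trans (expR_ge1Dx _).
apply: (@le_trans _ _ (Ex P (fun w => 1 + (l * Z w + (2^-1 + t) * l ^+ 2 * Z w ^+ 2)))).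
  apply: Ex_le; first by apply/bm_expR/bm_scale.
    by apply: bm_add; [exact: bm_cst|apply: bm_add; exact: bm_scale].
  move=> w; apply: le_trans (@expR_le_taylor _ t _ t1 _) _.
    by rewrite normrM (le_trans _ lb)// ler_wpM2l.
  by rewrite exprMn -mulrA addrA.
rewrite Ex_add; [|exact: bm_cst|by apply: bm_add; exact: bm_scale].
rewrite Ex_cst Ex_add; [|exact: bm_scale|exact: bm_scale].
by rewrite !Ex_scale// lerD2l lerD2r -normrM ler_norm.
Qed.

Lemma mgf_ge (Z : T -> R) (l b t : R) : bounded_measurable Z ->
  (forall w, `|Z w| <= b) -> `|l| * b <= t ->
  let u := (2^-1 - t) * l ^+ 2 * Ex P (fun w => Z w ^+ 2) - `|l| * `|Ex P Z| in
  0 <= u -> expR (u - u ^+ 2) <= Ex P (fun w => expR (l * Z w)).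
Proof.
move=> bZ Zb lb u u0.
have bZ2 : bounded_measurable (fun w => Z w ^+ 2) by exact: bm_mul.
apply: (le_trans (expR_subsq_le u0)).
apply: (@le_trans _ _ (Ex P (fun w => 1 + (l * Z w + (2^-1 - t) * l ^+ 2 * Z w ^+ 2)))).
  rewrite Ex_add; [|exact: bm_cst|by apply: bm_add; exact: bm_scale].
  rewrite Ex_cst Ex_add; [|exact: bm_scale|exact: bm_scale].
  rewrite !Ex_scale// lerD2l /u addrC lerD2r -normrM.
  by rewrite lerNl -normrN ler_norm.
apply: Ex_le; [by apply: bm_add; [exact: bm_cst|apply: bm_add; exact: bm_scale]| |].
  by apply/bm_expR/bm_scale.
move=> w; apply: le_trans (@expR_ge_taylor _ t _ _); first by rewrite exprMn -mulrA addrA.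
by rewrite normrM (le_trans _ lb)// ler_wpM2l.
Qed.

(** For [0 <= z <= 1] the Taylor bound [1 + z + 3/2 z^2] is at most [1 + 5/2 z], so for nonnegative
    variables the mean alone suffices. *)
Lemma mgf_nonneg_le (Z : T -> R) (l b : R) : bounded_measurable Z ->
  (forall w, 0 <= Z w <= b) -> 0 <= l -> l * b <= 1 ->
  Ex P (fun w => expR (l * Z w)) <= expR (5 / 2 * l * Ex P Z).
Proof.
move=> bZ Zb l0 lb; apply: le_trans (expR_ge1Dx _).
rewrite -Ex_scale// -[X in X + _](Ex_cst P 1) -Ex_add; [|exact: bm_cst|exact: bm_scale].
apply: Ex_le; first by apply/bm_expR/bm_scale.
  by apply: bm_add; [exact: bm_cst|exact: bm_scale].
move=> w; have /andP[Z0 Zb'] := Zb w.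
have lZ1 : l * Z w <= 1 by rewrite (le_trans _ lb)// ler_wpM2l.
have lZ0 : 0 <= l * Z w by rewrite mulr_ge0.
have := @expR_le_taylor _ 1 (l * Z w) (lexx _).
rewrite ger0_norm// => /(_ lZ1) h; apply: (le_trans h).
have -> : 5 / 2 * l * Z w = 5 / 2 * (l * Z w) by ring.
by move: (l * Z w) lZ1 lZ0 => z; nra.
Qed.

Context (I : choiceType) (J : set I) (X : I -> T -> R).
Hypothesis mX : forall i, measurable_fun setT (X i).
Hypothesis indX : mutually_independent P J X.
Context (E : finType) (Q : pred E) (v : E -> I).
Hypothesis vinj : {in Q &, injective v}.
Hypothesis vJ : forall e, Q e -> J (v e).

Lemma mgf_sum_le (t tau m s : R) (c : E -> R) :
  0 <= t -> 0 <= tau <= 1 ->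
  (forall e, Q e -> `|Ex P (fun w => trunc t (X (v e) w))| <= m) ->
  (forall e, Q e -> Ex P (fun w => trunc t (X (v e) w) ^+ 2) <= s) ->
  (forall e, Q e -> `|c e| * t <= tau) ->
  Ex P (fun w => expR (\sum_(e | Q e) c e * trunc t (X (v e) w))) <=
  expR (m * \sum_(e | Q e) `|c e| + (2^-1 + tau) * s * \sum_(e | Q e) c e ^+ 2).
Proof.
move=> t0 /andP[tau0 tau1] Xm Xs ct.
have bt := bm_trunc t0.
rewrite (Ex_ext _ (g := fun w => \prod_(e | Q e) expR (c e * trunc t (X (v e) w)))); last first.
  by move=> w; rewrite expR_sum.
rewrite (indep_prod mX indX (h := fun e x => expR (c e * trunc t x)) vinj vJ); last first.
  by move=> e; apply/bm_expR/bm_scale.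
rewrite !mulr_sumr -big_split/= expR_sum; apply: ler_prod => e Qe.
apply/andP; split; first by apply: Ex_ge0 => w; exact: expR_ge0.
have bX : bounded_measurable (fun w => trunc t (X (v e) w)) by exact: bm_comp.
apply: le_trans (mgf_le bX _ (ct e Qe) tau1) _; first by move=> w; exact: trunc_le.
rewrite ler_expR lerD//; first by rewrite mulrC ler_wpM2r// Xm.
rewrite mulrAC ler_wpM2r ?sqr_ge0// ler_wpM2l ?addr_ge0//; exact: Xs.
Qed.

Lemma chernoff_sum (t tau m s l a C1 C2 : R) (c : E -> R) :
  0 <= t -> 0 <= tau <= 1 -> 0 <= m -> 0 <= s -> 0 <= l ->
  (forall e, Q e -> `|Ex P (fun w => trunc t (X (v e) w))| <= m) ->
  (forall e, Q e -> Ex P (fun w => trunc t (X (v e) w) ^+ 2) <= s) ->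
  (forall e, Q e -> l * `|c e| * t <= tau) ->
  \sum_(e | Q e) `|c e| <= C1 -> \sum_(e | Q e) c e ^+ 2 <= C2 ->
  outer P [set w | a <= \sum_(e | Q e) c e * trunc t (X (v e) w)]
    (expR (- (l * a) + l * m * C1 + (2^-1 + tau) * s * l ^+ 2 * C2)).
Proof.
move=> t0 tau01 m0 s0 l0 Xm Xs ct cC1 cC2.
have bt := bm_trunc t0.
have bS : bounded_measurable (fun w => \sum_(e | Q e) (l * c e) * trunc t (X (v e) w)).
  by apply: bm_sum => e _; apply: bm_scale; exact: bm_comp.
apply: (outer_le _ (@markov_outer _ _ _ P _
   (fun w => expR (- (l * a)) * expR (\sum_(e | Q e) (l * c e) * trunc t (X (v e) w))) _ _ _)).
- rewrite Ex_scale; last exact: bm_expR.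
  rewrite -addrA expRD ler_wpM2l ?expR_ge0//.
  apply: le_trans (mgf_sum_le t0 tau01 Xm Xs _) _.
    by move=> e Qe; rewrite normrM ger0_norm//; exact: ct.
  rewrite ler_expR.
  under eq_bigr do rewrite normrM (ger0_norm l0).
  under [X in _ * s * X]eq_bigr do rewrite exprMn.
  rewrite -!mulr_sumr lerD//; first by rewrite mulrCA -[leRHS]mulrA !ler_wpM2l.
  by rewrite mulrA ler_wpM2l// !mulr_ge0 ?sqr_ge0// addr_ge0//; case/andP: tau01.
- by apply: bm_scale; exact: bm_expR.
- by move=> w; rewrite mulr_ge0// expR_ge0.
- move=> w /= aS; rewrite -expRD -[leLHS]expR0 ler_expR addrC subr_ge0.
  under eq_bigr do rewrite -mulrA.
  by rewrite -mulr_sumr ler_wpM2l.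
Qed.

Lemma chernoff_nonneg (g : R -> R) (b m l a C : R) :
  bounded_measurable g -> (forall x, 0 <= g x <= b) -> 0 <= m -> 0 <= l -> l * b <= 1 ->
  (forall e, Q e -> Ex P (fun w => g (X (v e) w)) <= m) ->
  #|Q|%:R <= C ->
  outer P [set w | a <= \sum_(e | Q e) g (X (v e) w)] (expR (- (l * a) + 5 / 2 * l * m * C)).
Proof.
move=> bg gb m0 l0 lb gm QC.
have bgX e : bounded_measurable (fun w => g (X (v e) w)) by exact: bm_comp.
apply: (outer_le _ (@markov_outer _ _ _ P _
   (fun w => expR (- (l * a)) * expR (\sum_(e | Q e) l * g (X (v e) w))) _ _ _)).
- rewrite Ex_scale; last by apply/bm_expR/bm_sum => e _; exact: bm_scale.
  rewrite expRD ler_wpM2l ?expR_ge0//.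
  rewrite (Ex_ext _ (g := fun w => \prod_(e | Q e) expR (l * g (X (v e) w)))); last first.
    by move=> w; rewrite expR_sum.
  rewrite (indep_prod mX indX (h := fun e x => expR (l * g x)) vinj vJ); last first.
    by move=> e; apply/bm_expR/bm_scale.
  apply: (@le_trans _ _ (\prod_(e | Q e) expR (5 / 2 * l * m))).
    apply: ler_prod => e Qe; apply/andP; split; first by apply: Ex_ge0 => w; exact: expR_ge0.
    apply: le_trans (mgf_nonneg_le (bgX e) (fun w => gb _) l0 lb) _.
    by rewrite ler_expR ler_wpM2l ?gm// mulr_ge0//; lra.
  rewrite prodr_const -expRM_natl ler_expR mulrC ler_wpM2l//.
  by rewrite !mulr_ge0//; lra.
- by apply/bm_scale/bm_expR/bm_sum => e _; exact: bm_scale.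
- by move=> w; rewrite mulr_ge0// expR_ge0.
- move=> w /= aS; rewrite -expRD -[leLHS]expR0 ler_expR addrC subr_ge0.
  by rewrite -mulr_sumr ler_wpM2l.
Qed.

End TruncatedSums.

(** * Chernoff bounds for rows, bilinear forms and inner products of rows *)

Definition edge (i j : nat) : nat * nat := (minn i j, maxn i j).

Lemma edge_sym i j : edge i j = edge j i.
Proof. by rewrite /edge minnC maxnC. Qed.

Lemma edge_inj i : injective (edge i).
Proof. by move=> k k' []; lia. Qed.

Definition upper_pairs (N : nat) : set (nat * nat) := [set p | (p.1 <= p.2 < N)%N].

Lemma edge_upper N (i j : 'I_N) : upper_pairs N (edge i j).
Proof. by have := ltn_ord i; have := ltn_ord j; rewrite /upper_pairs/=; lia. Qed.

Section MatrixEvents.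
Context (R : realType) d (T : measurableType d) (P : probability T R).
Context (N : nat) (X : nat * nat -> T -> R).
Hypothesis mX : forall p, measurable_fun setT (X p).
Hypothesis indX : mutually_independent P (upper_pairs N) X.

Definition tail_between (M t x : R) : R := if M < `|x| <= t then x else 0.

Definition offdiag (g : R -> R) (w : T) (i j : 'I_N) : R :=
  if i == j then 0 else g (X (edge i j) w).

Lemma offdiag_sym g w i j : offdiag g w i j = offdiag g w j i.
Proof. by rewrite /offdiag eq_sym edge_sym. Qed.

Lemma trunc_split (M t x : R) : M <= t -> trunc t x = trunc M x + tail_between M t x.
Proof.
move=> Mt; rewrite /trunc /tail_between; case: (leP `|x| M) => h /=; last by rewrite add0r.
by rewrite (le_trans h Mt) addr0.
Qed.

Lemma bm_tail_between (M t : R) : 0 <= t -> bounded_measurable (tail_between M t).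
Proof.
move=> t0; split.
  apply: measurable_fun_ifT => //; apply: measurable_and; last exact: measurable_fun_ler.
  exact: measurable_fun_ltr.
exists t => x; rewrite /tail_between; case: ifP; rewrite ?normr0//.
by move=> /andP[].
Qed.

Lemma row_sums_nonneg (g : R -> R) (b m l a : R) :
  bounded_measurable g -> (forall x, 0 <= g x <= b) -> 0 <= m -> 0 <= l -> l * b <= 1 ->
  (forall p, upper_pairs N p -> Ex P (fun w => g (X p w)) <= m) ->
  outer P [set w | exists i, a <= \sum_j offdiag g w i j]
    (N%:R * expR (- (l * a) + 5 / 2 * l * m * N%:R)).
Proof.
move=> bg gb m0 l0 lb gm.
rewrite mulr_natl -[X in _ *+ X]card_ord -sumr_const.
apply: outer_sub (outer_bigcup (Q := predT) (E := fun i : 'I_N => [set w |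
   a <= \sum_(j | j != i) g (X (edge i j) w)]) _).
  move=> w [i]; rewrite (bigD1 i)//= /offdiag eqxx add0r => h; exists i; split=> //=.
  apply: (le_trans h); rewrite le_eqVlt; apply/orP; left; apply/eqP.
  by apply: eq_bigr => j ji; rewrite eq_sym (negbTE ji).
move=> i _; apply: (chernoff_nonneg mX indX (v := fun j : 'I_N => edge i j)) => //.
- by move=> j k _ _ /edge_inj/val_inj.
- by move=> j _; exact: edge_upper.
- by move=> j _; apply: gm; exact: edge_upper.
- by rewrite ler_nat -[leqRHS]card_ord max_card.
Qed.

(** Both occurrences of an entry of the symmetric matrix are collected, so that the form becomes a
    linear combination of independent variables. *)
Lemma bil_offdiag g w x y :
  bil (offdiag g w) x y =
  \sum_(e : 'I_N * 'I_N | (e.1 < e.2)%N)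
     (x e.1 * y e.2 + x e.2 * y e.1) * g (X (edge e.1 e.2) w).
Proof.
rewrite /bil pair_bigA/= (bigID (fun e : 'I_N * 'I_N => (e.1 < e.2)%N))/=.
rewrite [X in _ + X](bigID (fun e : 'I_N * 'I_N => (e.2 < e.1)%N))/=.
rewrite [X in _ + (_ + X)]big1 ?addr0; last first.
  move=> [i j] /= /andP[h1 h2]; rewrite /offdiag ifT ?mulr0 ?mul0r//.
  by apply/eqP/val_inj => /=; lia.
rewrite [X in _ + X](reindex_inj (h := fun e : 'I_N * 'I_N => (e.2, e.1)))/=; last first.
  by move=> [i j] [i' j'] [-> ->].
rewrite [X in _ + X](eq_bigl (fun e : 'I_N * 'I_N => (e.1 < e.2)%N)); last first.
  by move=> [i j] /=; lia.
rewrite -big_split/=; apply: eq_bigr => [[i j]] /= ij.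
rewrite /offdiag ifN; last by apply: contraTneq ij => ->; rewrite ltnn.
rewrite ifN; last by apply: contraTneq ij => ->; rewrite ltnn.
by rewrite [edge j i]edge_sym; ring.
Qed.

(** The collected coefficients have sum of squares at most 2 and absolute sum at most [N]. Chernoff
    with [tau = 1] then gives the quadratic term [(1/2 + 1) * 2 * l^2 = 3 l^2]; the last hypothesis
    bounds the tilt times the largest coefficient times the truncation level. *)
Lemma bil_tail (M m l a th th' : R) x y :
  0 <= M -> 0 <= m -> 0 <= l -> 0 <= th ->
  (forall p, upper_pairs N p -> `|Ex P (fun w => trunc M (X p w))| <= m) ->
  (forall p, upper_pairs N p -> Ex P (fun w => trunc M (X p w) ^+ 2) <= 1) ->
  nrm2 x <= 1 -> nrm2 y <= 1 -> (forall i, `|x i| <= th) -> (forall i, `|y i| <= th') ->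
  l * (2 * th * th') * M <= 1 ->
  outer P [set w | a <= bil (offdiag (trunc M) w) x y]
    (expR (- (l * a) + l * m * N%:R + 3 * l ^+ 2)).
Proof.
move=> M0 m0 l0 th0 Xm Xs x1 y1 xth yth lM.
pose c (e : 'I_N * 'I_N) := x e.1 * y e.2 + x e.2 * y e.1.
have c2 : \sum_(e : 'I_N * 'I_N | (e.1 < e.2)%N) c e ^+ 2 <= 2.
  apply: (@le_trans _ _ (\sum_(e : 'I_N * 'I_N | (e.1 < e.2)%N)
     (2 * (x e.1 ^+ 2 * y e.2 ^+ 2) + 2 * (x e.2 ^+ 2 * y e.1 ^+ 2)))).
    apply: ler_sum => e _; rewrite /c.
    have := sqr_ge0 (x e.1 * y e.2 - x e.2 * y e.1).
    by rewrite -!exprMn !expr2; nra.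
  rewrite big_split/= -!mulr_sumr -mulrDr ler_piMr//.
  rewrite [X in _ + X](reindex_inj (h := fun e : 'I_N * 'I_N => (e.2, e.1)))/=; last first.
    by move=> [i j] [i' j'] [-> ->].
  apply: (@le_trans _ _ (\sum_(e : 'I_N * 'I_N) x e.1 ^+ 2 * y e.2 ^+ 2)).
    rewrite [leRHS](bigID (fun e : 'I_N * 'I_N => (e.1 < e.2)%N))/= lerD2l.
    rewrite [leRHS](bigID (fun e : 'I_N * 'I_N => (e.2 < e.1)%N))/=.
    rewrite [X in X + _](eq_bigl (fun e : 'I_N * 'I_N => (e.2 < e.1)%N)); last first.
      by move=> [i j] /=; lia.
    by rewrite lerDl sumr_ge0// => e _; rewrite mulr_ge0// sqr_ge0.
  rewrite -(pair_bigA _ (fun i j => x i ^+ 2 * y j ^+ 2))/=.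
  under eq_bigr do rewrite -mulr_sumr -/(nrm2 y).
  by rewrite -mulr_suml -/(nrm2 x) mulr_ile1// nrm2_ge0.
have c1 : \sum_(e : 'I_N * 'I_N | (e.1 < e.2)%N) `|c e| <= N%:R.
  apply: (@le_trans _ _ (\sum_(e : 'I_N * 'I_N | (e.1 < e.2)%N)
     ((x e.1 ^+ 2 + y e.2 ^+ 2) / 2 + (x e.2 ^+ 2 + y e.1 ^+ 2) / 2))).
    apply: ler_sum => e _; apply: (le_trans (ler_normD _ _)); rewrite !normrM.
    by apply: lerD; apply: (le_trans (amgm _ _)); rewrite !real_normK ?num_real.
  rewrite big_split/=.
  rewrite [X in _ + X](reindex_inj (h := fun e : 'I_N * 'I_N => (e.2, e.1)))/=; last first.
    by move=> [i j] [i' j'] [-> ->].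
  apply: (@le_trans _ _ (\sum_(e : 'I_N * 'I_N) (x e.1 ^+ 2 + y e.2 ^+ 2) / 2)).
    rewrite [leRHS](bigID (fun e : 'I_N * 'I_N => (e.1 < e.2)%N))/= lerD2l.
    rewrite [leRHS](bigID (fun e : 'I_N * 'I_N => (e.2 < e.1)%N))/=.
    rewrite [X in X + _](eq_bigl (fun e : 'I_N * 'I_N => (e.2 < e.1)%N)); last first.
      by move=> [i j] /=; lia.
    by rewrite lerDl sumr_ge0// => e _; rewrite divr_ge0// addr_ge0// sqr_ge0.
  rewrite -(pair_bigA _ (fun i j => (x i ^+ 2 + y j ^+ 2) / 2))/=.
  under eq_bigr do rewrite -mulr_suml big_split/= sumr_const card_ord -/(nrm2 y).
  rewrite -mulr_suml big_split/= sumr_const card_ord sumrMnl -/(nrm2 x).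
  rewrite -mulrnDl -[X in X / 2]mulr_natr; have := ler0n R N; nra.
rewrite (_ : [set w | _] = [set w | a <= \sum_(e : 'I_N * 'I_N | (e.1 < e.2)%N)
     c e * trunc M (X (edge e.1 e.2) w)]); last first.
  by apply/seteqP; split => w /=; rewrite bil_offdiag.
have inj : {in (fun e : 'I_N * 'I_N => (e.1 < e.2)%N) &,
    injective (fun e : 'I_N * 'I_N => edge e.1 e.2)}.
  move=> [i j] [i' j']; rewrite /in_mem/= => ij ij' [h1 h2].
  by congr pair; apply: val_inj => /=; move: ij ij' h1 h2; clear; lia.
apply: outer_le (chernoff_sum mX indX inj _ a M0 (tau := 1) _ m0 ler01 l0 _ _ _ c1 c2).
- by rewrite ler_expR lerD2l; lra.
- by move=> [i j] _; exact: edge_upper.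
- by rewrite ler01 lexx.
- by move=> [i j] _; apply: Xm; exact: edge_upper.
- by move=> [i j] _; apply: Xs; exact: edge_upper.
- move=> [i j] _; apply: le_trans lM; rewrite ler_wpM2r// ler_wpM2l//.
  apply: (le_trans (ler_normD _ _)); rewrite !normrM.
  have := ler_pM (normr_ge0 _) (normr_ge0 _) (xth i) (yth j).
  have := ler_pM (normr_ge0 _) (normr_ge0 _) (xth j) (yth i).
  by rewrite /=; lra.
Qed.

(** The entry shared by rows [i] and [j] occurs only in columns [i] and [j], where the zero diagonal
    kills the product; the other columns involve disjoint sets of entries. A product of two entries
    has no exponential that factorises, so [exp z] is first replaced by the polynomial
    [1 + z + 3/2 z^2], whose monomials do factorise. *)
Lemma row_inner_products (M m l a sg : R) (i j : 'I_N) : i != j ->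
  0 <= M -> 0 <= m -> 0 <= l -> l * M ^+ 2 <= 1 -> `|sg| = 1 ->
  (forall p, upper_pairs N p -> `|Ex P (fun w => trunc M (X p w))| <= m) ->
  (forall p, upper_pairs N p -> Ex P (fun w => trunc M (X p w) ^+ 2) <= 1) ->
  outer P [set w | a <= sg * \sum_k offdiag (trunc M) w i k * offdiag (trunc M) w j k]
    (expR (- (l * a) + N%:R * (l * m ^+ 2 + 3 / 2 * l ^+ 2))).
Proof.
move=> ij M0 m0 l0 lM sg1 Xm Xs.
have bt := bm_trunc M0.
pose Qa (k : 'I_N) := (k != i) && (k != j).
pose v (e : 'I_N * bool) := edge (if e.2 then i else j) e.1.
(* Coefficients of the quadratic majorant; in the two excluded columns only the constant 1
   remains. *)
pose c (k : 'I_N) (q : 'I_3) : R :=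
  if Qa k then (if q == 0%N :> nat then 1 else if q == 1%N :> nat then sg * l else 3 / 2 * l ^+ 2)
  else (q == 0%N :> nat)%:R.
pose h (k : 'I_N) (q : 'I_3) (b : bool) (x : R) := trunc M x ^+ q.
have bh k q b : bounded_measurable (h k q b).
  case: q => [[|[|[|//]]] /= ?].
  - exact: (bm_ext (f := fun=> 1)) (bm_cst _ _).
  - exact: bt.
  - exact: (bm_mul bt bt).
have vinj : {in (fun e => Qa e.1) &, injective v}.
  move=> [k b] [k' b']; rewrite /in_mem/= /Qa => /andP[ki kj] /andP[ki' kj'].
  have {}ki : (k != i :> nat) by [].
  have {}kj : (k != j :> nat) by [].
  have {}ki' : (k' != i :> nat) by [].
  have {}kj' : (k' != j :> nat) by [].
  have {}ij : (i != j :> nat) by [].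
  rewrite /v/=; case: b; case: b' => /=; move=> [h1 h2].
  - by congr pair; apply: val_inj => /=; lia.
  - by exfalso; lia.
  - by exfalso; lia.
  - by congr pair; apply: val_inj => /=; lia.
have vJ e : Qa e.1 -> upper_pairs N (v e).
  by move=> _; rewrite /v; case: ifP => _; exact: edge_upper.
have := indep_blocks mX indX (Q := fun k => fun=> Qa k) c vinj vJ bh.
set G := (X in Ex P X) => EG.
have GE w : G w = \prod_k (if Qa k then 1 + (sg * l) * (trunc M (X (edge i k) w) * trunc M (X (edge j k) w))
   + 3 / 2 * l ^+ 2 * (trunc M (X (edge i k) w) * trunc M (X (edge j k) w)) ^+ 2 else 1).
  rewrite /G; apply: eq_bigr => k _.
  rewrite !big_ord_recl big_ord0/= /c /h /v/=; case: ifP => Qk.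
    by rewrite !big_bool/= !expr0 !expr1 exprMn; ring.
  by rewrite !big_pred0_eq/=; ring.
have bG : bounded_measurable G.
  apply: bm_prod => k _; apply: bm_sum => q _; apply: bm_scale; apply: bm_prod => b _.
  by apply: bm_comp.
have G0 w : expR (l * (sg * \sum_k offdiag (trunc M) w i k * offdiag (trunc M) w j k)) <= G w.
  rewrite GE mulrA mulr_sumr expR_sum; apply: ler_prod => k _; rewrite expR_ge0/=.
  rewrite /offdiag [i == k]eq_sym [j == k]eq_sym /Qa.
  case: eqP => /= ki; first by rewrite !mul0r mulr0 expR0.
  case: eqP => /= kj; first by rewrite !mulr0 expR0.
  set z := _ * trunc _ _.
  have zM : `|z| <= M ^+ 2 by rewrite normrM expr2 ler_pM// trunc_le.
  clearbody z.
  have -> : 1 + sg * l * z + 3 / 2 * l ^+ 2 * z ^+ 2 =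
      1 + l * sg * z + (2^-1 + 1) * (l * sg * z) ^+ 2.
    rewrite !exprMn.
    have -> : sg ^+ 2 = 1 by rewrite -real_normK ?num_real// sg1 expr1n.
    by field.
  apply: expR_le_taylor => //; rewrite !normrM sg1 mulr1 ger0_norm//.
  by rewrite (le_trans _ lM)// ler_wpM2l.
apply: (outer_le _ (@markov_outer _ _ _ P _ (fun w => expR (- (l * a)) * G w) _ _ _)).
- rewrite Ex_scale// expRD ler_wpM2l ?expR_ge0// EG.
  rewrite expRM_natl -[X in _ ^+ X]card_ord -prodr_const; apply: ler_prod => k _.
  rewrite !big_ord_recl big_ord0/= /c /h /v/=; case: ifP => Qk; last first.
    rewrite !big_pred0_eq/= !mul0r !addr0 mulr1 ler01/= -[leLHS]expR0 ler_expR.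
    by rewrite addr_ge0// mulr_ge0 ?sqr_ge0//; lra.
  rewrite !big_bool/=.
  have E0 p : Ex P (fun w => trunc M (X p w) ^+ 0) = 1 by exact: (Ex_cst P 1).
  rewrite !E0.
  set e1 := Ex P (fun w => trunc M (X (edge i k) w) ^+ _).
  set e2 := Ex P (fun w => trunc M (X (edge j k) w) ^+ _).
  set s1 := Ex P (fun w => trunc M (X (edge i k) w) ^+ _).
  set s2 := Ex P (fun w => trunc M (X (edge j k) w) ^+ _).
  have he1 : `|e1| <= m by apply: Xm; exact: edge_upper.
  have he2 : `|e2| <= m by apply: Xm; exact: edge_upper.
  have hs1 : 0 <= s1 <= 1.
    rewrite Ex_ge0 ?Xs//=; last by move=> w; exact: sqr_ge0.
    exact: edge_upper.
  have hs2 : 0 <= s2 <= 1.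
    rewrite Ex_ge0 ?Xs//=; last by move=> w; exact: sqr_ge0.
    exact: edge_upper.
  have bM p : `|Ex P (fun w => trunc M (X p w) ^+ bump 0 0)| <= M.
    by apply: Ex_norm_le => [|w]; [exact: (bm_comp bt)|exact: trunc_le].
  have le1M : `|e1| <= M by exact: bM.
  have le2M : `|e2| <= M by exact: bM.
  clearbody e1 e2 s1 s2.
  have sgz : `|sg * l * (e1 * e2)| = l * (`|e1| * `|e2|).
    by rewrite !normrM sg1 mul1r ger0_norm.
  (* This keeps each factor of the product nonnegative; the next bound is the one that enters the
     exponent. *)
  have ub1 : `|sg * l * (e1 * e2)| <= 1.
    rewrite sgz (le_trans _ lM)// ler_wpM2l// expr2 ler_pM//.
  have ubm : `|sg * l * (e1 * e2)| <= l * m ^+ 2.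
    by rewrite sgz ler_wpM2l// expr2 ler_pM.
  have ss : 0 <= 3 / 2 * l ^+ 2 * (s1 * s2) <= 3 / 2 * l ^+ 2.
    have l2 : 0 <= 3 / 2 * l ^+ 2 by rewrite mulr_ge0 ?sqr_ge0//; lra.
    move/andP: hs1 => [? ?]; move/andP: hs2 => [? ?].
    by rewrite mulr_ge0 ?mulr_ge0//= ler_piMr// mulr_ile1.
  move: ub1 ubm; rewrite !ler_norml => /andP[? ?] /andP[? ?].
  move/andP: ss => [? ?]; apply/andP; split; first lra.
  by apply: le_trans (expR_ge1Dx _); lra.
- exact: bm_scale.
- by move=> w; rewrite mulr_ge0 ?expR_ge0// (le_trans _ (G0 w))// expR_ge0.
- move=> w /= aS; apply: le_trans (ler_wpM2l (expR_ge0 _) (G0 w)).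
  by rewrite -expRD -[leLHS]expR0 ler_expR addrC subr_ge0 ler_wpM2l.
Qed.

End MatrixEvents.

(** * Norm of the off-diagonal part *)

Section NormOfTruncation.
Context (R : realType) d (T : measurableType d) (P : probability T R).
Context (N : nat) (X : nat * nat -> T -> R).
Hypothesis mX : forall p, measurable_fun setT (X p).
Hypothesis indX : mutually_independent P (upper_pairs N) X.
Context (K : R).
Hypothesis K0 : 0 <= K.
Hypothesis X_mean : forall p, upper_pairs N p -> forall t, 1 <= t ->
  `|Ex P (fun w => trunc t (X p w))| <= K / t ^+ 5.
Hypothesis X_var : forall p, upper_pairs N p -> forall t, 1 <= t ->
  Ex P (fun w => trunc t (X p w) ^+ 2) <= 1.
Hypothesis X_tail : forall p, upper_pairs N p -> forall M t, 1 <= M ->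
  Ex P (fun w => `|tail_between M t (X p w)|) <= K / M ^+ 5.
Context (L : R).
Hypothesis NL : N%:R = expR L.
Hypothesis L0 : 0 <= L.

(* [e a] is [N ^ a]. *)
Let e (a : R) : R := expR (a * L).

Let eD a b : e a * e b = e (a + b).
Proof. by rewrite -expRD -mulrDl. Qed.

Let e1 : e 1 = N%:R.
Proof. by rewrite /e mul1r NL. Qed.

Let e_ge0 a : 0 <= e a.
Proof. exact: expR_ge0. Qed.

Let e_gt0 a : 0 < e a.
Proof. exact: expR_gt0. Qed.

Let e_ge1 a : 0 <= a -> 1 <= e a.
Proof. by move=> a0; rewrite -expR0 ler_expR mulr_ge0. Qed.

Let e_le a b : a <= b -> e a <= e b.
Proof. by move=> ab; rewrite ler_expR ler_wpM2r. Qed.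

Let eX a n : e a ^+ n = e (a * n%:R).
Proof. by rewrite -expRM_natr /e mulrAC. Qed.

Let eV a : (e a)^-1 = e (- a).
Proof. by rewrite -expRN /e mulNr. Qed.

Let e_eq1 a : a = 0 -> e a = 1.
Proof. by move=> ->; rewrite /e mul0r expR0. Qed.

(** The level [N^(1/10)] at which small and large entries are separated. The mean of what lies above
    it is at most [K M^(-5) = K N^(-1/2)], which makes the expected absolute row sums of the large
    entries of order [sqrt N]. *)
Let M := e (10^-1).
Let M1 : 1 <= M.
Proof. by apply: e_ge1; lra. Qed.

Let KM : K / M ^+ 5 = K * e (- 2^-1).
Proof. by rewrite eX eV; congr (_ * e _); lra. Qed.

(** The tilt is the inverse of the upper cut, [N^(eta - 1/2)]. A row sum has mean at most
    [K sqrt N], costing [5/2 K N^eta] in the exponent, and the threshold gains [(3 K + 1) N^eta]. By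
    symmetry, rows serve for both halves of Schur's test. *)
Lemma norm_tail_event (eta : R) : 0 < eta -> eta <= 4^-1 ->
  outer P [set w | ~ opb (offdiag X (N := N) (tail_between M (e (2^-1 - eta))) w)
                       ((3 * K + 1) * e 2^-1)]
    (N%:R * expR (- e eta)).
Proof.
move=> eta0 eta4.
set t := e (2^-1 - eta).
have t0 : 0 <= t by exact: e_ge0.
pose g (x : R) := `|tail_between M t x|.
have bg : bounded_measurable g.
  have [mg [C gC]] := bm_tail_between M t0; split; first exact: measurableT_comp.
  by exists C => x; rewrite normr_id.
have gb x : 0 <= g x <= t.
  rewrite normr_ge0/= /g /tail_between; case: ifP => [/andP[]//|_].
  by rewrite normr0.
have m0 : 0 <= K * e (- 2^-1) by rewrite mulr_ge0.
have lt1 : e (eta - 2^-1) * t <= 1.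
  by rewrite /t eD e_eq1//; lra.
have gm p : upper_pairs N p -> Ex P (fun w => g (X p w)) <= K * e (- 2^-1).
  by move=> Jp; rewrite -KM; exact: X_tail.
apply: outer_sub (outer_le _ (row_sums_nonneg mX indX ((3 * K + 1) * e 2^-1)
  bg gb m0 (e_ge0 _) lt1 gm)); last first.
- rewrite ler_wpM2l// ler_expR.
  rewrite -e1.
  have -> : e (eta - 2^-1) * ((3 * K + 1) * e 2^-1) = (3 * K + 1) * e eta.
    by rewrite mulrCA eD; congr (_ * e _); lra.
  have -> : 5 / 2 * e (eta - 2^-1) * (K * e (- 2^-1)) * e 1 = 5 / 2 * K * e eta.
    have -> : e eta = e (eta - 2^-1) * e (- 2^-1) * e 1 by rewrite !eD; congr e; lra.
    by ring.
  by have := mulr_ge0 K0 (e_ge0 eta); lra.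
- move=> w /=; apply: contra_notP => /forallNP h.
  apply: opb_schur => [|i|j].
  + by rewrite mulr_ge0//; have := K0; lra.
  + have /negP := h i; rewrite -ltNge => /ltW; apply: le_trans.
    rewrite le_eqVlt; apply/orP; left; apply/eqP; apply: eq_bigr => j _.
    by rewrite /offdiag; case: ifP; rewrite ?normr0.
  + have /negP := h j; rewrite -ltNge => /ltW; apply: le_trans.
    rewrite le_eqVlt; apply/orP; left; apply/eqP; apply: eq_bigr => i _.
    by rewrite offdiag_sym /offdiag; case: ifP; rewrite ?normr0.
Qed.

(** Squares are bounded by [M^2], so the tilt is [M^(-2) = N^(-1/5)]; a threshold of 4 per column
    against a cost of 5/2 leaves an exponent of order [- N^(4/5)]. *)
Lemma row_norm_event :
  outer P [set w | exists i, 4 * N%:R <= \sum_k offdiag X (N := N) (trunc M) w i k ^+ 2]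
    (N%:R * expR (- e (4 / 5))).
Proof.
pose g (x : R) := trunc M x ^+ 2.
have M0 : 0 <= M by exact: e_ge0.
have bg : bounded_measurable g by apply: bm_mul; exact: bm_trunc.
have gb x : 0 <= g x <= M ^+ 2.
  rewrite sqr_ge0/= -[leLHS]real_normK ?num_real// lerXn2r ?nnegrE// trunc_le//.
have lt1 : e (- (5^-1)) * M ^+ 2 <= 1.
  by rewrite eX eD e_eq1//; lra.
have gm p : upper_pairs N p -> Ex P (fun w => g (X p w)) <= 1.
  by move=> Jp; exact: X_var.
apply: outer_sub (outer_le _ (row_sums_nonneg mX indX (4 * N%:R)
  bg gb ler01 (e_ge0 _) lt1 gm)); last first.
- rewrite ler_wpM2l// ler_expR -e1 mulr1.
  have -> : e (4 / 5) = e (- 5^-1) * e 1 by rewrite eD; congr e; lra.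
  by have := e_ge0 (- 5^-1); have := e_ge0 1; nra.
- move=> w /= [i h]; exists i; apply: (le_trans h); rewrite le_eqVlt; apply/orP; left; apply/eqP.
  by apply: eq_bigr => k _; rewrite /offdiag; case: ifP; rewrite ?expr0n.
Qed.

(** Inner products of distinct rows fluctuate by about [sqrt N]. The threshold [N^(11/20)] lies a
    power above that: with tilt [N^(-1/2)] the quadratic term stays bounded and the gain is
    [N^(1/20)]. *)
Lemma gram_event :
  outer P [set w | exists i j, i != j /\
     e (11 / 20) <= `|\sum_k offdiag X (N := N) (trunc M) w i k * offdiag X (trunc M) w j k| ]
    (2 * N%:R ^+ 2 * expR (- e (20^-1) + K ^+ 2 + 3 / 2)).
Proof.
have M0 : 0 <= M by exact: e_ge0.
have ev sg i j : `|sg| = 1 -> i != j -> outer P [set w | e (11 / 20) <=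
    sg * \sum_k offdiag X (N := N) (trunc M) w i k * offdiag X (trunc M) w j k]
    (expR (- e (20^-1) + K ^+ 2 + 3 / 2)).
  move=> sg1 ij.
  have m0 : 0 <= K * e (- 2^-1) by rewrite mulr_ge0.
  have lt1 : e (- 2^-1) * M ^+ 2 <= 1.
    by rewrite eX eD -[leRHS]expR0 ler_expR; have := L0; nra.
  have Xm p : upper_pairs N p -> `|Ex P (fun w => trunc M (X p w))| <= K * e (- 2^-1).
    by move=> Jp; rewrite -KM; exact: X_mean.
  apply: outer_le (row_inner_products mX indX (e (11 / 20)) ij M0 m0 (e_ge0 _) lt1 sg1 Xm _).
  - rewrite ler_expR eD -addrA lerD//.
      by rewrite lerN2 le_eqVlt; apply/orP; left; apply/eqP; congr e; lra.
    rewrite exprMn eX -e1.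
    have -> : e 1 * (e (- 2^-1) * (K ^+ 2 * e (- 2^-1 * 2)) + 3 / 2 * e (- 2^-1 * 2)) =
      K ^+ 2 * (e 1 * e (- 2^-1) * e (- 2^-1 * 2)) + 3 / 2 * (e 1 * e (- 2^-1 * 2)) by ring.
    rewrite !eD.
    have h1 : e (1 + (- 2^-1) + (- 2^-1 * 2)) <= 1.
      by rewrite -[leRHS]expR0 ler_expR; have := L0; nra.
    have -> : e (1 + (- 2^-1 * 2)) = 1.
      by rewrite e_eq1//; lra.
    by rewrite mulr1 lerD2r ler_piMr// sqr_ge0.
  - by move=> p Jp; exact: X_var.
have := outer_bigcup (P := P) (Q := fun ij : 'I_N * 'I_N => ij.1 != ij.2)
  (fun ij h => outerU (ev 1 ij.1 ij.2 (normr1 _) h) (ev (-1) ij.1 ij.2 (normrN1 _) h)).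
move=> ov; apply: outer_sub (outer_le _ ov); last first.
- rewrite sumr_const -[leLHS]mulr_natr.
  set c := #|_|; have cN : c%:R <= N%:R ^+ 2 :> R.
    by rewrite -natrX ler_nat (leq_trans (max_card _))// card_prod card_ord.
  rewrite -mulr2n -[_ *+ 2]mulr_natl mulrAC ler_wpM2r ?expR_ge0// ler_wpM2l//.
- move=> w /= [i [j [ij h]]]; exists (i, j); split=> //.
  move: h; rewrite ler_normr => /orP[h|h]; [left|right] => /=; first by rewrite mul1r.
  by rewrite mulN1r.
Qed.

Lemma net_event m (Q1 Q2 : pred {ffun 'I_N -> bool * 'I_m}) (h0 th th' l a : R) :
  0 <= l -> 0 <= th -> l * (2 * th * th') * M <= 1 ->
  (forall f, Q1 f -> nrm2 (gridvec h0 f) <= 1 /\ forall i, `|gridvec h0 f i| <= th) ->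
  (forall f, Q2 f -> nrm2 (gridvec h0 f) <= 1 /\ forall i, `|gridvec h0 f i| <= th') ->
  outer P [set w | exists f f', [/\ Q1 f, Q2 f' &
     a <= bil (offdiag X (trunc M) w) (gridvec h0 f) (gridvec h0 f')] ]
    (#|Q1|%:R * #|Q2|%:R * expR (- (l * a) + l * (K * e (- 2^-1)) * N%:R + 3 * l ^+ 2)).
Proof.
move=> l0 th0 lM Q1P Q2P.
have M0 : 0 <= M by exact: e_ge0.
have m0 : 0 <= K * e (- 2^-1) by rewrite mulr_ge0.
have Xm p : upper_pairs N p -> `|Ex P (fun w => trunc M (X p w))| <= K * e (- 2^-1).
  by move=> Jp; rewrite -KM; exact: X_mean.
have Xv p : upper_pairs N p -> Ex P (fun w => trunc M (X p w) ^+ 2) <= 1.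
  by move=> Jp; exact: X_var.
set p := expR _.
pose Q (ff : {ffun 'I_N -> bool * 'I_m} * {ffun 'I_N -> bool * 'I_m}) := Q1 ff.1 && Q2 ff.2.
pose E (ff : {ffun 'I_N -> bool * 'I_m} * {ffun 'I_N -> bool * 'I_m}) := [set w | a <= bil (offdiag X (trunc M) w)
  (gridvec (m := m) h0 ff.1) (gridvec (m := m) h0 ff.2)].
have oE ff : Q ff -> outer P (E ff) p.
  case: ff => [f f'] /= /andP[/Q1P[f1 fth] /Q2P[f1' fth']].
  exact: (bil_tail mX indX a M0 m0 l0 th0 Xm Xv f1 f1' fth fth' lM).
apply: outer_sub (outer_le _ (outer_bigcup (p := fun=> p) oE)); last first.
- rewrite sumr_const -[leLHS]mulr_natl ler_wpM2r ?expR_ge0// -natrM ler_nat.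
  by rewrite -cardX; apply: subset_leq_card; apply/fintype.subsetP => -[f f']; rewrite !inE.
- by move=> w /= [f [f' [q1 q2 h]]]; exists (f, f'); split=> //; rewrite /Q/= q1 q2.
Qed.

(** The step [h0 = N^(-1/2) / 12] makes the rounding error [N h0^2] equal to the [12^(-2)] that
    [opb_levels] requires; [gm] magnitudes cover the interval from 0 to 1. *)
Let gm := (Num.truncn (12 * e 2^-1)).+1.
Let h0 := (12 * e 2^-1)^-1.
(** [th1 = N^(-9/40)] is such that [N^(11/20) / th1^2 = N] in the Gram bound. [th2 = N^(-2/5)]
    balances the two nets: [sqrt N * th1 * th2 * M = N^(-1/40)] permits the tilt [sqrt N] when one
    vector is below [th2], and supports of size [th2^(-2) = N^(4/5)] keep the sparse net small. *)
Let th1 := e (- (9 / 40)).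
Let th2 := e (- (2 / 5)).

Let h0_gt0 : 0 < h0.
Proof. by rewrite invr_gt0 mulr_gt0. Qed.

(** Each net has at most [exp (146 N)] points, with [146 = 12^2 + 2]. At tilt [sqrt N] the threshold
    gains [(K + 296) N], against [292 N] for the two nets, [K N] for the bias and [3 N] for the
    quadratic term. *)
Lemma full_net_event : 2 * e (- 40^-1) <= 1 ->
  outer P [set w | exists f f' : {ffun 'I_N -> bool * 'I_gm},
     [/\ nrm2 (gridvec h0 f) <= 1 /\ (forall i, `|gridvec h0 f i| <= th2),
         nrm2 (gridvec h0 f') <= 1 /\ (forall i, `|gridvec h0 f' i| <= th1) &
     (K + 296) * e 2^-1 <= bil (offdiag X (trunc M) w) (gridvec h0 f) (gridvec h0 f')] ]
    (expR (- e 1)).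
Proof.
move=> small.
pose Q1 (f : {ffun 'I_N -> bool * 'I_gm}) :=
  (nrm2 (gridvec h0 f) <= 1) && [forall i, `|gridvec h0 f i| <= th2].
pose Q2 (f : {ffun 'I_N -> bool * 'I_gm}) :=
  (nrm2 (gridvec h0 f) <= 1) && [forall i, `|gridvec h0 f i| <= th1].
have lM : e 2^-1 * (2 * th2 * th1) * M <= 1.
  apply: le_trans small; rewrite le_eqVlt; apply/orP; left; apply/eqP.
  have -> : e (- 40^-1) = e 2^-1 * th2 * th1 * M by rewrite !eD; congr e; lra.
  by ring.
have cQ (Q : pred {ffun 'I_N -> bool * 'I_gm}) :
    (forall f, Q f -> nrm2 (gridvec h0 f) <= 1) -> #|Q|%:R <= expR (146 * e 1).
  move=> Qn; apply: (@le_trans _ _ (#|[pred f : {ffun 'I_N -> bool * 'I_gm} |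
      nrm2 (gridvec h0 f) <= 1]|%:R)).
    by rewrite ler_nat; apply: subset_leq_card; apply/fintype.subsetP => f; rewrite !inE; exact: Qn.
  apply: (le_trans (card_grid_ball _ _ h0_gt0)); rewrite ler_expR -e1.
  by rewrite /h0 exprVn invrK exprMn eX mulVf//; lra.
apply: outer_sub (outer_le _ (@net_event _ Q1 Q2 h0 th2 th1 (e 2^-1) ((K + 296) * e 2^-1)
  (e_ge0 _) (e_ge0 _) lM _ _)).
- move=> w /= [f [f' [[f1 f2] [f1' f2'] h]]]; exists f, f'; split=> //.
  + by rewrite /Q1 f1; apply/forallP.
  + by rewrite /Q2 f1'; apply/forallP.
- have c1 : #|Q1|%:R <= expR (146 * e 1) by apply: cQ => f /andP[].
  have c2 : #|Q2|%:R <= expR (146 * e 1) by apply: cQ => f /andP[].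
  apply: (@le_trans _ _ (expR (146 * e 1) * expR (146 * e 1) *
    expR (- (e 2^-1 * ((K + 296) * e 2^-1)) + e 2^-1 * (K * e (- 2^-1)) * N%:R + 3 * e 2^-1 ^+ 2))).
    by rewrite ler_wpM2r ?expR_ge0// ler_pM.
  rewrite -!expRD ler_expR eX -e1.
  have -> : e 2^-1 * ((K + 296) * e 2^-1) = (K + 296) * e 1.
    by rewrite mulrCA eD; congr (_ * e _); lra.
  have -> : e 2^-1 * (K * e (- 2^-1)) * e 1 = K * e 1.
    by rewrite mulrCA eD e_eq1 ?mulr1//; lra.
  have -> : 2^-1 * 2 = 1 :> R by lra.
  by lra.
- by move=> f /andP[f1 /forallP f2]; split.
- by move=> f /andP[f1 /forallP f2]; split.
Qed.

(** The tilt [N^(7/20) / 2] is the largest that [th1^2 M] permits. It is below [sqrt N], but its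
    gain [N^(17/20) / 2] still beats the entropy of sparse vectors, of order [N^(4/5) L]. The
    constant 26 comes from [gm <= 13 sqrt N]. *)
Lemma sparse_net_event : (0 < N)%N ->
  outer P [set w | exists f f' : {ffun 'I_N -> bool * 'I_gm},
     [/\ [/\ grid_reduced f, nrm2 (gridvec h0 f) <= 1, (forall i, `|gridvec h0 f i| <= th1) &
           #|[set i | gridvec h0 f i != 0]%SET|%:R * th2 ^+ 2 <= 1],
         [/\ grid_reduced f', nrm2 (gridvec h0 f') <= 1, (forall i, `|gridvec h0 f' i| <= th1) &
           #|[set i | gridvec h0 f' i != 0]%SET|%:R * th2 ^+ 2 <= 1] &
     (K + 1) * e 2^-1 <= bil (offdiag X (trunc M) w) (gridvec h0 f) (gridvec h0 f')] ]
    (expR (2 * (e (4 / 5) * (26 + 3 / 2 * L) + 1) - 2^-1 * e (17 / 20) + 3 / 4 * e (7 / 10))).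
Proof.
move=> N0.
pose Q (f : {ffun 'I_N -> bool * 'I_gm}) :=
  [&& grid_reduced f, nrm2 (gridvec h0 f) <= 1, [forall i, `|gridvec h0 f i| <= th1] &
    #|[set i | gridvec h0 f i != 0]%SET|%:R * th2 ^+ 2 <= 1].
have lM : 2^-1 * e (7 / 20) * (2 * th1 * th1) * M <= 1.
  have -> : 2^-1 * e (7 / 20) * (2 * th1 * th1) * M = e (7 / 20) * th1 * th1 * M by field.
  by rewrite !eD e_eq1//; lra.
have cQ : #|Q|%:R <= expR (e (4 / 5) * (26 + 3 / 2 * L) + 1).
  apply: (@le_trans _ _ (#|[pred f : {ffun 'I_N -> bool * 'I_gm} | grid_reduced f &&
     (#|[set i | gridvec h0 f i != 0]%SET|%:R * th2 ^+ 2 <= 1)]|%:R)).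
    rewrite ler_nat; apply: subset_leq_card; apply/fintype.subsetP => f; rewrite !inE.
    by move=> /and4P[-> _ _ ->].
  apply: (le_trans (card_grid_sparse N0 _ h0_gt0 (e_gt0 _))) => //.
  rewrite ler_expR lerD2r eX eV.
  have -> : - (- (2 / 5) * 2) = 4 / 5 :> R by lra.
  rewrite ler_wpM2l//.
  have gm13 : gm%:R <= 13 * e 2^-1.
    rewrite /gm -natr1.
    have /truncn_itv /andP[h _] : 0 <= 12 * e 2^-1 by rewrite mulr_ge0.
    by have := e_ge1 (a := 2^-1) ltac:(lra); lra.
  have gmp : 0 < gm%:R :> R by rewrite ltr0n.
  have Np : 0 < N%:R :> R by rewrite ltr0n.
  apply: (@le_trans _ _ (ln (26 * e (3 / 2)))).
    rewrite ler_ln ?posrE ?mulr_gt0//.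
    have -> : e (3 / 2) = e 2^-1 * e 1 by rewrite eD; congr e; lra.
    by rewrite -e1 [leRHS]mulrA ler_wpM2r//; lra.
  rewrite lnM ?posrE// expRK.
  by have := @ln_sublinear R 26 ltac:(lra); lra.
apply: outer_sub (outer_le _ (@net_event _ Q Q h0 th1 th1 (2^-1 * e (7 / 20)) ((K + 1) * e 2^-1)
  _ (e_ge0 _) lM _ _)).
- move=> w /= [f [f' [[f1 f2 f3 f4] [f1' f2' f3' f4'] h]]]; exists f, f'; split=> //.
  + by rewrite /Q f1 f2 f4 andbT; apply/forallP.
  + by rewrite /Q f1' f2' f4' andbT; apply/forallP.
- apply: (@le_trans _ _ (expR (e (4 / 5) * (26 + 3 / 2 * L) + 1) *
    expR (e (4 / 5) * (26 + 3 / 2 * L) + 1) *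
    expR (- (2^-1 * e (7 / 20) * ((K + 1) * e 2^-1)) +
      2^-1 * e (7 / 20) * (K * e (- 2^-1)) * N%:R + 3 * (2^-1 * e (7 / 20)) ^+ 2))).
    by rewrite ler_wpM2r ?expR_ge0// ler_pM.
  rewrite -!expRD ler_expR exprMn eX -e1.
  have -> : 2^-1 * e (7 / 20) * ((K + 1) * e 2^-1) = 2^-1 * (K + 1) * e (17 / 20).
    have -> : e (17 / 20) = e (7 / 20) * e 2^-1 by rewrite eD; congr e; lra.
    by ring.
  have -> : 2^-1 * e (7 / 20) * (K * e (- 2^-1)) * e 1 = 2^-1 * K * e (17 / 20).
    have -> : e (17 / 20) = e (7 / 20) * e (- 2^-1) * e 1 by rewrite !eD; congr e; lra.
    by ring.
  have -> : 7 / 20 * 2 = 7 / 10 :> R by lra.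
  by lra.
- by rewrite mulr_ge0.
- by move=> f /and4P[_ f1 /forallP f2 _]; split.
- by move=> f /and4P[_ f1 /forallP f2 _]; split.
Qed.

Lemma truncation_norm_event : (0 < N)%N -> 2 * e (- 40^-1) <= 1 ->
  outer P [set w | ~ opb (offdiag X (N := N) (trunc M) w) ((6 * K + 1198) * e 2^-1)]
   (N%:R * expR (- e (4 / 5)) + 2 * N%:R ^+ 2 * expR (- e (20^-1) + K ^+ 2 + 3 / 2) +
    expR (2 * (e (4 / 5) * (26 + 3 / 2 * L) + 1) - 2^-1 * e (17 / 20) + 3 / 4 * e (7 / 10)) +
    expR (- e 1)).
Proof.
move=> N0 small.
apply: outer_sub (outerU (outerU (outerU row_norm_event gram_event) (sparse_net_event N0))
  (full_net_event small)).
move=> w /=; apply: contra_notP => /not_orP[/not_orP[/not_orP[b1 b2] b3] b4].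
have -> : (6 * K + 1198) * e 2^-1 =
  2 * (2 * (3 * e 2^-1) + (K + 1) * e 2^-1 + 2 * ((K + 296) * e 2^-1)) by ring.
apply: (@opb_levels _ _ _ gm h0 th1 th2) => //.
- by move=> i j; exact: offdiag_sym.
- by rewrite invrK truncnS_gt.
- have -> : h0 = 12^-1 * e (- 2^-1) by rewrite /h0 invfM eV.
  by rewrite exprMn eX -e1 mulrCA eD e_eq1 ?mulr1//; lra.
- exact: e_ge0.
- by apply: e_le; lra.
- move=> x y x1 y1 xth.
  apply: (@bil_sparse_gram _ _ _ (4 * N%:R) (e (11 / 20)) th1) => //.
  + by move=> i; rewrite leNgt; apply/negP => h; apply: b1; exists i; exact: ltW.
  + move=> i j ij; rewrite leNgt; apply/negP => h; apply: b2; exists i, j; split=> //; exact: ltW.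
  + exact: e_gt0.
  + by rewrite mulr_gt0.
  (* The Gram bound gives [4 N + N = 5 N], below the square [9 N] of the claimed [3 sqrt N]. *)
  + rewrite -e1 exprMn !eX eV eD.
    have -> : 11 / 20 - - (9 / 40) * 2 = 1 :> R by lra.
    by rewrite mulVf//; have := e_ge0 1; lra.
- move=> f f' r r' n1 n1' s1 s1' c1 c1'; rewrite leNgt; apply/negP => h; apply: b3.
  by exists f, f'; split=> //; exact: ltW.
- move=> f f' n1 n1' s1 s1'; rewrite leNgt; apply/negP => h; apply: b4.
  by exists f, f'; split=> //; exact: ltW.
Qed.

End NormOfTruncation.

(** * Row sums *)

Section RowSums.
Context (R : realType) d (T : measurableType d) (P : probability T R).
Context (N : nat) (X : nat * nat -> T -> R).
Hypothesis mX : forall p, measurable_fun setT (X p).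
Hypothesis indX : mutually_independent P (upper_pairs N) X.

Lemma row_partial_sum_tail (t tau m s l a v : R) (i : 'I_N) (Q : pred 'I_N) :
  0 <= t -> 0 <= tau <= 1 -> 0 <= m -> 0 < s -> 0 <= l -> l * t <= tau ->
  (forall p, upper_pairs N p -> `|Ex P (fun w => trunc t (X p w))| <= m) ->
  (forall p, upper_pairs N p -> Ex P (fun w => trunc t (X p w) ^+ 2) <= s) ->
  #|Q|%:R * s <= v ->
  outer P [set w | a <= `|\sum_(k | Q k) trunc t (X (edge i k) w)| ]
    (2 * expR (- (l * a) + l * m * N%:R + (2^-1 + tau) * l ^+ 2 * v)).
Proof.
move=> t0 tau01 m0 s0 l0 lt Xm Xs Qv.
have ev sg : `|sg| = 1 -> outer P [set w | a <= \sum_(k | Q k) sg * trunc t (X (edge i k) w)]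
    (expR (- (l * a) + l * m * N%:R + (2^-1 + tau) * l ^+ 2 * v)).
  move=> sg1.
  have inj : {in Q &, injective (fun k : 'I_N => edge i k)}.
    by move=> j k _ _ /edge_inj/val_inj.
  have J k : Q k -> upper_pairs N (edge i k) by move=> _; exact: edge_upper.
  have c1 : \sum_(k | Q k) `|sg| <= N%:R.
    by rewrite sumr_const sg1 ler_nat -[leqRHS]card_ord max_card.
  have c2 : \sum_(k | Q k) sg ^+ 2 <= v / s.
    rewrite sumr_const -[sg ^+ 2]real_normK ?num_real// sg1 expr1n.
    by rewrite ler_pdivlMr.
  apply: outer_le (chernoff_sum mX indX inj J a t0 tau01 m0 (ltW s0) l0 _ _ _ c1 c2).
  - rewrite ler_expR lerD2l le_eqVlt; apply/orP; left; apply/eqP.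
    by field; rewrite gt_eqF.
  - by move=> k _; apply: Xm; exact: edge_upper.
  - by move=> k _; apply: Xs; exact: edge_upper.
  - by move=> k _; rewrite sg1 mulr1.
have -> : forall x : R, 2 * x = x + x by move=> x; ring.
apply: outer_sub (outerU (ev 1 (normr1 _)) (ev (-1) (normrN1 _))) => w /=.
rewrite ler_normr -sumrN => /orP[h|h]; [left|right].
  by under eq_bigr do rewrite mul1r.
by under eq_bigr do rewrite mulN1r.
Qed.

Context (m : nat) (t : R).
Hypothesis t0 : 0 <= t.
Hypothesis mN : (m <= N)%N.

Definition right_sum (w : T) (i : 'I_m) : R :=
  \sum_(k : 'I_N | (m <= k)%N) trunc t (X (edge i k) w).

Definition right_mgf (i : 'I_m) (r : R) : R :=
  \prod_(k : 'I_N | (m <= k)%N) Ex P (fun w => expR (r * trunc t (X (edge i k) w))).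

Definition right_var (i : 'I_m) : R :=
  \sum_(k : 'I_N | (m <= k)%N) Ex P (fun w => trunc t (X (edge i k) w) ^+ 2).

Let edge_upper_right (i : 'I_m) (k : 'I_N) : upper_pairs N (edge i k).
Proof. by have := edge_upper (widen_ord mN i) k. Qed.

Let bX p : bounded_measurable (fun w => trunc t (X p w)).
Proof. by apply: bm_comp => //; exact: bm_trunc. Qed.

Lemma bm_expR_right_sum i r : bounded_measurable (fun w => expR (r * right_sum w i)).
Proof. by apply/bm_expR/bm_scale/bm_sum. Qed.

Lemma Ex_expR_right_sum i r : Ex P (fun w => expR (r * right_sum w i)) = right_mgf i r.
Proof.
rewrite /right_mgf -(indep_prod mX indX (Q := fun k : 'I_N => (m <= k)%N)
  (v := fun k => edge i k) (h := fun=> fun x => expR (r * trunc t x))).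
- by apply: Ex_ext => w; rewrite /right_sum mulr_sumr expR_sum.
- by move=> j k _ _ /edge_inj/val_inj.
- by move=> k _; exact: edge_upper_right.
- by move=> k; apply/bm_expR/bm_scale; exact: bm_trunc.
Qed.

(* Kolmogorov-type bound: the indicator of [S >= a] dominates
   [e^{-l b} (e^{l S} - e^{u a} e^{(l - u) S} - e^{- u b} e^{(l + u) S})]. *)
Definition bump_fun (a b l u S : R) : R :=
  expR (- (l * b)) * expR (l * S) - expR (- (l * b) + u * a) * expR ((l - u) * S)
   - expR (- (l * b) - u * b) * expR ((l + u) * S).

Lemma bump_fun_le (a b l u S : R) : 0 <= u -> 0 <= l -> bump_fun a b l u S <= (a <= S)%R%:R.
Proof.
move=> u0 l0; rewrite /bump_fun -!expRD.
have h1 := expR_ge0 (- (l * b) + u * a + (l - u) * S).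
have h2 := expR_ge0 (- (l * b) - u * b + (l + u) * S).
(* Between [a] and [b] the main term is at most 1; above [b] the third term outweighs it, and below
   [a] the second one does. *)
case: (leP a S) => [aS|Sa] /=.
  have [Sb|/ltW bS] := leP S b.
    have : expR (- (l * b) + l * S) <= 1.
      by rewrite -[leRHS]expR0 ler_expR addrC subr_le0 ler_wpM2l.
    lra.
  have : expR (- (l * b) + l * S) <= expR (- (l * b) - u * b + (l + u) * S).
    by rewrite ler_expR; nra.
  lra.
have : expR (- (l * b) + l * S) <= expR (- (l * b) + u * a + (l - u) * S).
  by rewrite ler_expR; nra.
lra.
Qed.

Definition bump_mean (a b l u : R) (i : 'I_m) : R :=
  expR (- (l * b)) * right_mgf i l - expR (- (l * b) + u * a) * right_mgf i (l - u)
   - expR (- (l * b) - u * b) * right_mgf i (l + u).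

Lemma Ex_bump a b l u i :
  Ex P (fun w => 1 - bump_fun a b l u (right_sum w i)) = 1 - bump_mean a b l u i.
Proof.
have bb : bounded_measurable (fun w => bump_fun a b l u (right_sum w i)).
  by apply: bm_sub; [apply: bm_sub|]; apply: bm_scale; exact: bm_expR_right_sum.
rewrite Ex_sub//; last exact: bm_cst.
rewrite Ex_cst; congr (_ - _); rewrite /bump_fun.
rewrite Ex_sub; last 2 first.
- by apply: bm_sub; apply: bm_scale; exact: bm_expR_right_sum.
- by apply: bm_scale; exact: bm_expR_right_sum.
rewrite Ex_sub; last 2 first.
- by apply: bm_scale; exact: bm_expR_right_sum.
- by apply: bm_scale; exact: bm_expR_right_sum.
by rewrite !Ex_scale ?Ex_expR_right_sum//; exact: bm_expR_right_sum.
Qed.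

(** The product of the nonnegative factors [1 - bump_fun] dominates the indicator that no sum
    reaches [a]. Each factor combines four exponentials of one row, the constant being the
    exponential with rate 0, so independence factorises the expectation exactly; then
    [1 - x <= exp (- x)]. *)
Lemma all_right_sums_small (a : R) (b l u : 'I_m -> R) :
  (forall i, 0 <= u i) -> (forall i, 0 <= l i) ->
  outer P [set w | forall i, right_sum w i < a]
    (expR (- \sum_i bump_mean a (b i) (l i) (u i) i)).
Proof.
move=> u0 l0.
pose c (i : 'I_m) (q : 'I_4) : R :=
  match val q with
  | 0 => 1
  | 1 => - expR (- (l i * b i))
  | 2 => expR (- (l i * b i) + u i * a)
  | _ => expR (- (l i * b i) - u i * b i)
  end.
pose r (i : 'I_m) (q : 'I_4) : R :=
  match val q with 0 => 0 | 1 => l i | 2 => l i - u i | _ => l i + u i end.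
pose v (e : 'I_m * 'I_N) := edge e.1 e.2.
have vinj : {in (fun e : 'I_m * 'I_N => (m <= e.2)%N) &, injective v}.
  move=> [i k] [i' k']; rewrite /in_mem/= => mk mk' [h1 h2].
  have := ltn_ord i; have := ltn_ord i' => hi hi'.
  by congr pair; apply: val_inj => /=; lia.
have vJ (e : 'I_m * 'I_N) : (m <= e.2)%N -> upper_pairs N (v e).
  by case: e => [i k] _; exact: edge_upper_right.
have bh (i : 'I_m) (q : 'I_4) (k : 'I_N) : bounded_measurable (fun x => expR (r i q * trunc t x)).
  by apply/bm_expR/bm_scale; exact: bm_trunc.
have := indep_blocks mX indX (Q := fun=> fun k : 'I_N => (m <= k)%N) c vinj vJ bh.
set G := (X in Ex P X) => EG.
have GE w : G w = \prod_i (1 - bump_fun a (b i) (l i) (u i) (right_sum w i)).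
  apply: eq_bigr => i _.
  have rE q : \prod_(k : 'I_N | (m <= k)%N) expR (r i q * trunc t (X (edge i k) w)) =
      expR (r i q * right_sum w i).
    by rewrite /right_sum mulr_sumr expR_sum.
  under eq_bigr do rewrite rE.
  rewrite !big_ord_recl big_ord0/= /c /r/= mul0r expR0 /bump_fun.
  by clear; ring.
have E1 : Ex P G = \prod_i (1 - bump_mean a (b i) (l i) (u i) i).
  rewrite EG; apply: eq_bigr => i _.
  have rE q : \prod_(k : 'I_N | (m <= k)%N) Ex P (fun w => expR (r i q * trunc t (X (edge i k) w))) =
      right_mgf i (r i q) by [].
  under eq_bigr do rewrite rE.
  rewrite !big_ord_recl big_ord0/= /c /r/= /bump_mean.
  have -> : right_mgf i 0 = 1.
    rewrite /right_mgf big1// => k _.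
    by rewrite (Ex_ext P (g := fun=> 1)) ?Ex_cst// => w; rewrite mul0r expR0.
  by ring.
have bump1 i S : 0 <= 1 - bump_fun a (b i) (l i) (u i) S.
  rewrite subr_ge0 (le_trans (bump_fun_le a (b i) S (u0 i) (l0 i)))//.
  by case: (a <= S).
apply: (outer_le _ (@markov_outer _ _ _ P _ G _ _ _)).
- rewrite E1 -sumrN expR_sum; apply: ler_prod => i _.
  rewrite -Ex_bump Ex_ge0//= Ex_bump.
  by apply: le_trans (expR_ge1Dx _).
- apply: (bm_ext (f := fun w => \prod_i (1 - bump_fun a (b i) (l i) (u i) (right_sum w i)))).
    by move=> w; rewrite GE.
  apply: bm_prod => i _; apply: bm_sub; first exact: bm_cst.
  by apply: bm_sub; [apply: bm_sub|]; apply: bm_scale; exact: bm_expR_right_sum.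
- by move=> w; rewrite GE; apply: prodr_ge0.
- move=> w /= Sa; rewrite GE.
  apply: (@le_trans _ _ (\prod_(i < m) (1 : R))); first by rewrite big1.
  apply: ler_prod => i _; rewrite ler01/=.
  have := bump_fun_le a (b i) (right_sum w i) (u0 i) (l0 i).
  have -> : (a <= right_sum w i) = false by rewrite leNgt Sa.
  by rewrite /=; lra.
Qed.

Lemma right_mgf_le (i : 'I_m) (r tau m1 : R) : 0 <= r -> r * t <= tau -> tau <= 1 ->
  (forall p, upper_pairs N p -> `|Ex P (fun w => trunc t (X p w))| <= m1) -> 0 <= m1 ->
  right_mgf i r <= expR (r * m1 * N%:R + (2^-1 + tau) * r ^+ 2 * right_var i).
Proof.
move=> r0 rt tau1 Xm m10; rewrite /right_var mulr_sumr.
apply: (@le_trans _ _ (expR (\sum_(k : 'I_N | (m <= k)%N) (r * m1 +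
    (2^-1 + tau) * r ^+ 2 * Ex P (fun w => trunc t (X (edge i k) w) ^+ 2))))).
  rewrite expR_sum; apply: ler_prod => k _.
  apply/andP; split; first by apply: Ex_ge0 => w; exact: expR_ge0.
  apply: le_trans (mgf_le P (bX (edge i k)) (b := t) _ _ tau1) _.
  - by move=> w; exact: trunc_le.
  - by rewrite ger0_norm.
  - by rewrite ler_expR lerD2r ger0_norm// ler_wpM2l// Xm.
rewrite ler_expR big_split/= lerD2r sumr_const -[leLHS]mulr_natr ler_wpM2l ?mulr_ge0//.
by rewrite ler_nat -[leqRHS]card_ord max_card.
Qed.

(** Each factor is at least [exp (u - u^2)], and [0 <= u <= r^2] turns the quadratic loss into the
    overall factor [1 - r^2]. The lower bound on the truncated variances makes the bias too small to
    bring [u] below 0. *)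
Lemma right_mgf_ge (i : 'I_m) (r tau m1 : R) : 0 <= r -> r * t <= tau -> 0 <= tau ->
  (forall p, upper_pairs N p -> `|Ex P (fun w => trunc t (X p w))| <= m1) -> 0 <= m1 ->
  (forall p, upper_pairs N p -> m1 <= (2^-1 - tau) * r * Ex P (fun w => trunc t (X p w) ^+ 2)) ->
  (forall p, upper_pairs N p -> Ex P (fun w => trunc t (X p w) ^+ 2) <= 1) ->
  r <= 1 ->
  expR ((1 - r ^+ 2) * ((2^-1 - tau) * r ^+ 2 * right_var i - r * m1 * N%:R)) <= right_mgf i r.
Proof.
move=> r0 rt tau0 Xm m10 Xv Xs r1.
pose u k := (2^-1 - tau) * r ^+ 2 * Ex P (fun w => trunc t (X (edge i k) w) ^+ 2) -
  `|r| * `|Ex P (fun w => trunc t (X (edge i k) w))|.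
have r21 : 0 <= 1 - r ^+ 2 by rewrite subr_ge0 expr_le1.
have u0 (k : 'I_N) : 0 <= u k.
  rewrite /u subr_ge0 ger0_norm//.
  apply: (@le_trans _ _ (r * m1)); first by rewrite ler_wpM2l// Xm.
  have := Xv _ (edge_upper_right i k).
  by move=> /(ler_wpM2l r0); rewrite expr2; set y := Ex _ _; nra.
have ur (k : 'I_N) : u k <= r ^+ 2.
  rewrite /u lerBlDr (@le_trans _ _ (r ^+ 2))//; last by rewrite lerDl mulr_ge0.
  have s0 : 0 <= Ex P (fun w => trunc t (X (edge i k) w) ^+ 2).
    by apply: Ex_ge0 => w; exact: sqr_ge0.
  have s1 := Xs _ (edge_upper_right i k).
  rewrite mulrAC -[leRHS]mul1r ler_wpM2r ?sqr_ge0//.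
  by move: s0 s1; set y := Ex _ _; nra.
apply: (@le_trans _ _ (expR (\sum_(k : 'I_N | (m <= k)%N) (u k - u k ^+ 2)))).
  rewrite ler_expR.
  apply: (@le_trans _ _ ((1 - r ^+ 2) * \sum_(k : 'I_N | (m <= k)%N) u k)).
    rewrite ler_wpM2l// /u sumrB -mulr_sumr lerD2l lerN2.
    rewrite -mulr_sumr ger0_norm// -mulrA ler_wpM2l//.
    apply: (@le_trans _ _ (\sum_(k : 'I_N | (m <= k)%N) m1)).
      by apply: ler_sum => k _; exact: Xm.
    rewrite sumr_const -[leLHS]mulr_natr ler_wpM2l//.
    by rewrite ler_nat -[leqRHS]card_ord max_card.
  rewrite mulr_sumr; apply: ler_sum => k _.
  have := u0 k; have := ur k; rewrite expr2; set z := u k; nra.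
rewrite expR_sum; apply: ler_prod => k _; rewrite expR_ge0/=.
have rt' : `|r| * t <= tau by rewrite ger0_norm.
exact: (@mgf_ge _ _ _ P _ r t tau (bX (edge i k)) (fun w => trunc_le _ t0) rt' (u0 k)).
Qed.

End RowSums.

(** * Tail bounds for all large [N] *)

Section NearBounds.
Context (R : realType).

(** Here [y = a^2 / V] for variance [V], with tilt [(1 + g) a / V], shift [u = g a / V] and upper
    end [b = (1 + 2 g) a]. For an exact Gaussian, each subtracted term is [exp (- g^2 y / 2)] times
    the main one; relative errors [g^2 / 40] in the three exponents still leave [exp (- g^2 y / 4)],
    at most 1/4, so half of the main term survives. *)
Lemma bump_mean_lower (y g F1 F2 F3 : R) : 0 < g <= 1 -> 0 <= y ->
  expR (- (g ^+ 2 / 4 * y)) <= 4^-1 ->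
  expR ((1 - g ^+ 2 / 40) / 2 * (1 + g) ^+ 2 * y) <= F1 ->
  F2 <= expR ((1 + g ^+ 2 / 40) / 2 * y) ->
  F3 <= expR ((1 + g ^+ 2 / 40) / 2 * (1 + 2 * g) ^+ 2 * y) ->
  2^-1 * expR (- ((2^-1 + 5 * g) * y)) <=
  expR (- ((1 + g) * (1 + 2 * g) * y)) * F1 -
  expR (- ((1 + g) * (1 + 2 * g) * y) + g * y) * F2 -
  expR (- ((1 + g) * (1 + 2 * g) * y) - g * (1 + 2 * g) * y) * F3.
Proof.
move=> /andP[g0 g1] y0 small h1 h2 h3.
set q := - ((1 + g) * (1 + 2 * g) * y).
set A := expR ((1 - g ^+ 2 / 40) / 2 * (1 + g) ^+ 2 * y) in h1 *.
have A0 : 0 <= A by exact: expR_ge0.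
have g2 : 0 <= g ^+ 2 <= g by rewrite sqr_ge0/= expr2 ler_piMr// ltW.
have r2 : expR (g * y) * F2 <= A / 4.
  apply: (@le_trans _ _ (A * expR (- (g ^+ 2 / 4 * y)))); last by rewrite ler_wpM2l.
  apply: (@le_trans _ _ (expR (g * y) * expR ((1 + g ^+ 2 / 40) / 2 * y))).
    by rewrite ler_wpM2l// expR_ge0.
  rewrite -!expRD ler_expR.
  have h : 0 <= g ^+ 2 * (4^-1 - (1 + (1 + g) ^+ 2) / 80).
    by rewrite mulr_ge0 ?sqr_ge0// sqrrD expr1n mul1r; lra.
  by have := mulr_ge0 y0 h; lra.
have r3 : expR (- (g * (1 + 2 * g) * y)) * F3 <= A / 4.
  apply: (@le_trans _ _ (A * expR (- (g ^+ 2 / 4 * y)))); last by rewrite ler_wpM2l.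
  apply: (@le_trans _ _ (expR (- (g * (1 + 2 * g) * y)) *
      expR ((1 + g ^+ 2 / 40) / 2 * (1 + 2 * g) ^+ 2 * y))).
    by rewrite ler_wpM2l// expR_ge0.
  rewrite -!expRD ler_expR.
  have h : 0 <= g ^+ 2 * (4^-1 - ((1 + g) ^+ 2 + (1 + 2 * g) ^+ 2) / 80).
    by rewrite mulr_ge0 ?sqr_ge0// !sqrrD expr1n !mul1r exprMn; lra.
  by have := mulr_ge0 y0 h; lra.
have -> : expR q * F1 - expR (q + g * y) * F2 - expR (q - g * (1 + 2 * g) * y) * F3 =
  expR q * (F1 - expR (g * y) * F2 - expR (- (g * (1 + 2 * g) * y)) * F3).
  by rewrite !expRD; ring.
apply: (@le_trans _ _ (expR q * (A / 2))); last first.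
  by rewrite ler_wpM2l ?expR_ge0//; lra.
rewrite mulrA [leRHS]mulrC ler_wpM2l// /q /A -expRD ler_expR.
have h : g ^+ 2 * (3 / 2 + (1 + g) ^+ 2 / 80) <= g * 2.
  apply: ler_pM => //; try by case/andP: g2.
  - by rewrite addr_ge0// ?divr_ge0// sqr_ge0.
  - by rewrite sqrrD expr1n mul1r; lra.
by have := ler_wpM2l y0 h; have := mulr_ge0 y0 (ltW g0); lra.
Qed.

Lemma sqrt2L_le (L : R) : 0 <= L -> Num.sqrt (2 * L) <= 1 + L.
Proof.
move=> L0; rewrite -[leRHS]ger0_norm; last lra.
rewrite -sqrtr_sqr ler_sqrt ?sqr_ge0//.
by rewrite sqrrD expr1n mul1r; have := sqr_ge0 L; lra.
Qed.

Lemma sqrt_scale (n : nat) : (0 < n)%N ->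
  Num.sqrt (2 * n%:R * ln n%:R) = expR (2^-1 * ln n%:R) * Num.sqrt (2 * ln n%:R) :> R.
Proof.
move=> n0; rewrite -mulrA mulrCA sqrtrM ?ler0n//; congr (_ * _).
rewrite -{1}(expR_ln_nat R n0) -[RHS]ger0_norm ?expR_ge0// -sqrtr_sqr; congr Num.sqrt.
by rewrite -expRM_natl; congr expR; field.
Qed.

Lemma near_nat_gt0 : \forall n \near \oo, (0 < n)%N.
Proof. exact: nbhs_infty_gt. Qed.

Context d (T : measurableType d) (P : probability T R).
Context (X : nat -> nat * nat -> T -> R).
Hypothesis mX : forall N p, measurable_fun setT (X N p).
Hypothesis indX : forall N, mutually_independent P (upper_pairs N) (X N).
Context (K : R).
Hypothesis K0 : 0 <= K.
Hypothesis X_mean : forall N p, upper_pairs N p -> forall t, 1 <= t ->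
  `|Ex P (fun w => trunc t (X N p w))| <= K / t ^+ 5.
Hypothesis X_tail : forall N p, upper_pairs N p -> forall M t, 1 <= M ->
  Ex P (fun w => `|tail_between M t (X N p w)|) <= K / M ^+ 5.
Context (eta : R).
Hypothesis eta0 : 0 < eta.
Hypothesis eta4 : eta <= 4^-1.

Definition level (N : nat) : R := expR ((2^-1 - eta) * ln N%:R).

Lemma level_ge1 N : 1 <= level N.
Proof.
rewrite -[leLHS]expR0 ler_expR mulr_ge0// ?ln_nat_ge0//.
by have := eta4; lra.
Qed.

Ltac clra := clear - R d T P X mX indX K K0 X_mean X_tail eta eta0 eta4; lra.

Lemma near_offdiag_norm :
  (forall N p, upper_pairs N p -> forall t, 1 <= t ->
    Ex P (fun w => trunc t (X N p w) ^+ 2) <= 1) ->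
  \forall N \near \oo, outer P
    [set w | ~ opb (offdiag (X N) (N := N) (trunc (level N)) w)
                  ((9 * K + 1199) * expR (2^-1 * ln N%:R))]
    (expR (- (2 * ln N%:R))).
Proof.
move=> X_var.
have n1 : \forall N \near \oo, expR (0 - expR (eta * ln N%:R)) <= expR (- (4 * ln N%:R)).
  by apply: (near_ln (expRN_expR_le 0 4 eta0)).
have [k2 k2E] : {k : R | k = 4 / 5} by exists (4 / 5).
have k20 : 0 < k2 by rewrite k2E; lra.
have n2 : \forall N \near \oo, expR (0 - expR (k2 * ln N%:R)) <= expR (- (4 * ln N%:R)).
  exact: (near_ln (expRN_expR_le 0 4 k20)).
have [C3 C3E] : {C : R | C = K ^+ 2 + 3 / 2} by exists (K ^+ 2 + 3 / 2).
have [k3 k3E] : {k : R | k = 20^-1} by exists (20^-1).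
have k30 : 0 < k3 by rewrite k3E; lra.
have n3 : \forall N \near \oo, expR (C3 - expR (k3 * ln N%:R)) <= expR (- (6 * ln N%:R)).
  exact: (near_ln (expRN_expR_le C3 6 k30)).
have [k4 k4E] : {k : R | k = 4 / 5} by exists (4 / 5).
have k40 : 0 < k4 by rewrite k4E; lra.
have n4 : \forall N \near \oo, expR (0 - expR (k4 * ln N%:R)) <= expR (- (3 * ln N%:R)).
  exact: (near_ln (expRN_expR_le 0 3 k40)).
have [k5 k5E] : {k : R | k = 1} by exists (1).
have k50 : 0 < k5 by rewrite k5E; lra.
have n5 : \forall N \near \oo, expR (0 - expR (k5 * ln N%:R)) <= expR (- (3 * ln N%:R)).
  exact: (near_ln (expRN_expR_le 0 3 k50)).
have [k6 k6E] : {k : R | k = 20^-1} by exists (20^-1).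
have k60 : 0 < k6 by rewrite k6E; lra.
have n6 : \forall N \near \oo, 120 * (1 + ln N%:R) <= expR (k6 * ln N%:R).
  exact: (near_ln (expR_dominates 120 k60)).
have [k7 k7E] : {k : R | k = 1} by exists (1).
have k70 : 0 < k7 by rewrite k7E; lra.
have n7 : \forall N \near \oo, 6 <= expR (k7 * ln N%:R).
  exact: (near_ln (expR_ge_near 6 k70)).
have [k8 k8E] : {k : R | k = 40^-1} by exists (40^-1).
have k80 : 0 < k8 by rewrite k8E; lra.
have n8 : \forall N \near \oo, 2 <= expR (k8 * ln N%:R).
  exact: (near_ln (expR_ge_near 2 k80)).
apply: filterS (filterI near_nat_gt0 (filterI n1 (filterI n2 (filterI n3 (filterI n4
  (filterI n5 (filterI n6 (filterI n7 n8)))))))).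
move=> N /= [N0 [N1 [N2 [N3 [N4 [N5 [N6 [N7 N8]]]]]]]].
rewrite k2E in N2; rewrite k3E C3E in N3; rewrite k4E in N4; rewrite k5E in N5.
rewrite k6E in N6; rewrite k7E in N7; rewrite k8E in N8.
set L : R := ln N%:R.
rewrite -/L in N1 N2 N3 N4 N5 N6 N7 N8.
have L0 : 0 <= L by exact: ln_nat_ge0.
have NL : N%:R = expR L by rewrite expR_ln_nat.
have M1 : 1 <= expR (10^-1 * L) by rewrite -[leLHS]expR0 ler_expR mulr_ge0.
have small : 2 * expR (- 40^-1 * L) <= 1.
  by rewrite mulNr expRN ler_pdivrMr ?expR_gt0// mul1r.
have ev1 := norm_tail_event (mX N) (@indX N) K0 (X_tail (N := N)) NL L0 eta0 eta4.
have ev2 := truncation_norm_event (mX N) (@indX N) K0 (X_mean (N := N)) (X_var N) NL L0 N0 small.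
apply: outer_sub (outer_le _ (outerU ev1 ev2)).
  move=> w /=; apply: contra_notP => /not_orP[/contrapT h1 /contrapT h2].
  have := opbD h2 h1; rewrite -mulrDl.
  have -> : 6 * K + 1198 + (3 * K + 1) = 9 * K + 1199 by ring.
  apply: opb_ext => i j; rewrite /offdiag; case: ifP => _; first by rewrite addr0.
  rewrite [RHS](trunc_split (M := expR (10^-1 * L)))// /level ler_expR ler_wpM2r//.
  by move: eta4; clra.
clear n1 n2 n3 n4 n5 n6 n7 n8 ev1 ev2 small M1.
(* The five error terms amount to six times [N^(-3)], the Gram event counting twice; the spare
   factor [N] pays for the six. *)
have e3 : expR (- (3 * L)) * 6 <= expR (- (2 * L)).
  apply: (@le_trans _ _ (expR (- (3 * L)) * expR (1 * L))).
    by rewrite ler_wpM2l ?expR_ge0.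
  by rewrite -expRD ler_expR; move: L0; clra.
have b1 : N%:R * expR (- expR (eta * L)) <= expR (- (3 * L)).
  rewrite NL; move: N1; rewrite add0r => N1.
  apply: (le_trans (ler_wpM2l (expR_ge0 L) N1)).
  by rewrite -expRD ler_expR; move: L0; clra.
have b2 : N%:R * expR (- expR (4 / 5 * L)) <= expR (- (3 * L)).
  rewrite NL; move: N2; rewrite add0r => N2.
  apply: (le_trans (ler_wpM2l (expR_ge0 L) N2)).
  by rewrite -expRD ler_expR; move: L0; clra.
have b3 : 2 * N%:R ^+ 2 * expR (- expR (20^-1 * L) + K ^+ 2 + 3 / 2) <= 2 * expR (- (3 * L)).
  rewrite NL -mulrA ler_wpM2l// -addrA addrC.
  apply: (le_trans (ler_wpM2l (exprn_ge0 2 (expR_ge0 L)) N3)).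
  by rewrite -expRM_natl -expRD ler_expR; move: L0; clra.
(* The 120 in the bound on [N^(1/20)] makes [N^(17/20) / 2] at least [60 (1 + L) N^(4/5)], which
   covers the entropy, the quadratic term and the [N^(4/5)] to be left over. *)
have b4 : expR (2 * (expR (4 / 5 * L) * (26 + 3 / 2 * L) + 1) - 2^-1 * expR (17 / 20 * L) +
    3 / 4 * expR (7 / 10 * L)) <= expR (- (3 * L)).
  move: N4; rewrite add0r; apply: le_trans; rewrite ler_expR.
  have -> : expR (17 / 20 * L) = expR (20^-1 * L) * expR (4 / 5 * L).
    by rewrite -expRD; congr expR; clra.
  have h1 : 1 <= expR (4 / 5 * L) by rewrite -[leLHS]expR0 ler_expR mulr_ge0.
  have h2 : expR (7 / 10 * L) <= expR (4 / 5 * L) by rewrite ler_expR ler_wpM2r//; clra.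
  by move: (ler_wpM2r (expR_ge0 (4 / 5 * L)) N6) h1 h2 (mulr_ge0 L0 (expR_ge0 (4 / 5 * L))); clra.
have b5 : expR (- expR (1 * L)) <= expR (- (3 * L)) by move: N5; rewrite add0r.
by move: e3 b1 b2 b3 b4 b5; clra.
Qed.

(** At [a = c sqrt (2 N L)] and total variance [v N], the Gaussian-optimal tilt [a / (v N)] yields
    the rate [c^2 / v]; any smaller [q] is reached. Row and column set are quantified after [N], so
    that union bounds over rows can use it. *)
Lemma near_row_tail (c v q s : R) : 0 < c -> 0 < v -> 0 < s -> 0 < q -> q < c ^+ 2 / v ->
  (forall N p, upper_pairs N p -> forall t, 1 <= t ->
    Ex P (fun w => trunc t (X N p w) ^+ 2) <= s) ->
  \forall N \near \oo, forall (i : 'I_N) (Q : pred 'I_N), #|Q|%:R * s <= v * N%:R ->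
    outer P [set w | c * Num.sqrt (2 * N%:R * ln N%:R) <=
        `|\sum_(k | Q k) trunc (level N) (X N (edge i k) w)| ] (expR (- (q * ln N%:R))).
Proof.
move=> c0 v0 s0 q0 qcv X_var.
(* [tau] solves [(1 - 2 tau) b = q'], so the Taylor error lowers the rate from [b] to [q']; the gap
   from [q'] to [q] absorbs the prefactor [2 exp 1]. *)
pose b := c ^+ 2 / v; pose q' := (q + b) / 2; pose tau := (1 - q' / b) / 2.
have b0 : 0 < b by rewrite divr_gt0// exprn_gt0.
have qb : q < b by [].
have q'b : q' / b < 1 by rewrite ltr_pdivrMr// mul1r /q'; lra.
have q'b0 : 0 < q' / b by rewrite divr_gt0// /q'; lra.
have tau01 : 0 <= tau <= 1 by rewrite /tau; lra.
have tau0 : 0 < tau by rewrite /tau; lra.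
have n1 : \forall N \near \oo, c / v / tau * (1 + ln N%:R) <= expR (eta * ln N%:R).
  by apply: (near_ln (expR_dominates (c / v / tau) eta0)).
have [k2 k2E] : {k : R | k = 3 / 4} by exists (3 / 4).
have k20 : 0 < k2 by rewrite k2E; lra.
have n2 : \forall N \near \oo, c / v * K * (1 + ln N%:R) <= expR (k2 * ln N%:R).
  exact: (near_ln (expR_dominates (c / v * K) k20)).
have q'q : 0 < q' - q by rewrite /q'; lra.
have n3 : \forall N \near \oo, 2 * expR 1 <= expR ((q' - q) * ln N%:R).
  by apply: (near_ln (expR_ge_near (2 * expR 1) q'q)).
near=> N => i Q Qv.
have N0 : (0 < N)%N by near: N; exact: near_nat_gt0.
have N1 : c / v / tau * (1 + ln N%:R) <= expR (eta * ln N%:R) by near: N; exact: n1.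
have N2 : c / v * K * (1 + ln N%:R) <= expR (k2 * ln N%:R) by near: N; exact: n2.
rewrite k2E in N2.
have N3 : 2 * expR 1 <= expR ((q' - q) * ln N%:R) by near: N; exact: n3.
rewrite sqrt_scale//; set L : R := ln N%:R.
rewrite -/L in N1 N2 N3.
have L0 : 0 <= L by exact: ln_nat_ge0.
have NL : N%:R = expR L by rewrite expR_ln_nat.
set sL := Num.sqrt (2 * L).
have sL0 : 0 <= sL by exact: sqrtr_ge0.
have sL2 : sL ^+ 2 = 2 * L by rewrite sqr_sqrtr// mulr_ge0.
have sL1 : sL <= 1 + L by exact: sqrt2L_le.
have cv0 : 0 <= c / v by rewrite divr_ge0// ltW.
pose l := c / v * (sL * expR (- (2^-1 * L))).
have l0 : 0 <= l by apply: mulr_ge0 => //; apply: mulr_ge0 => //; exact: expR_ge0.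
pose m := K / level N ^+ 5.
have m0 : 0 <= m by rewrite divr_ge0// exprn_ge0// expR_ge0.
have lt : l * level N <= tau.
  have -> : l * level N = c / v * sL * expR (- (eta * L)).
    rewrite /l /level -!mulrA; congr (_ * (_ * (_ * _))).
    by rewrite -expRD; congr expR; rewrite -/L; ring.
  rewrite expRN ler_pdivrMr ?expR_gt0//.
  apply: (@le_trans _ _ (c / v * (1 + L))); first by rewrite ler_wpM2l.
  by move: N1; rewrite mulrAC ler_pdivrMr// [X in _ <= X]mulrC.
apply: outer_le (row_partial_sum_tail (mX N) (@indX N) (c * (expR (2^-1 * L) * sL)) i
  (expR_ge0 _) tau01 m0 s0 l0 lt _ _ Qv).
- have la : l * (c * (expR (2^-1 * L) * sL)) = b * (2 * L).
    rewrite /l /b -sL2 expRN; field.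
    by rewrite !gt_eqF ?expR_gt0.
  have ll : l ^+ 2 * (v * N%:R) = b * (2 * L).
    rewrite NL /l /b -sL2.
    have -> : expR L = expR (2^-1 * L) ^+ 2 by rewrite -expRM_natl; congr expR; field.
    by rewrite expRN; field; rewrite !gt_eqF ?expR_gt0.
  have lmN : l * m * N%:R <= 1.
    have hm : m <= K * expR (- (5 / 4 * L)).
      rewrite /m ler_wpM2l// expRN lef_pV2 ?posrE ?exprn_gt0 ?expR_gt0//.
      rewrite /level -expRM_natl ler_expR -/L mulrA ler_wpM2r//.
      by have := eta4; lra.
    apply: (@le_trans _ _ (l * (K * expR (- (5 / 4 * L))) * N%:R)).
      by rewrite ler_wpM2r// ler_wpM2l.
    have -> : l * (K * expR (- (5 / 4 * L))) * N%:R = c / v * K * sL * expR (- (3 / 4 * L)).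
      have -> : expR (- (3 / 4 * L)) = expR (- (2^-1 * L)) * expR (- (5 / 4 * L)) * expR L.
        by rewrite -!expRD; congr expR; lra.
      by rewrite NL /l; ring.
    rewrite expRN ler_pdivrMr ?expR_gt0// mul1r; apply: le_trans N2.
    by rewrite ler_wpM2l// mulr_ge0.
  have -> : (2^-1 + tau) * l ^+ 2 * (v * N%:R) = (2^-1 + tau) * (b * (2 * L)).
    by rewrite -mulrA ll.
  rewrite la.
  have hq : (1 - 2 * tau) * b = q' by rewrite /tau; field; rewrite gt_eqF.
  apply: (@le_trans _ _ (2 * expR (1 - q' * L))).
    by rewrite ler_wpM2l// ler_expR -hq; lra.
  rewrite expRD mulrA.
  apply: (le_trans (ler_wpM2r (expR_ge0 _) N3)).
  by rewrite -expRD ler_expR; lra.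
- by move=> p Jp; exact: (X_mean Jp (level_ge1 N)).
- by move=> p Jp; exact: (X_var _ _ Jp _ (level_ge1 N)).
Unshelve. all: by end_near. Qed.

End NearBounds.

Lemma card_ord_geq (N m : nat) : (#|(fun k : 'I_N => (m <= k)%N)| = N - m)%N.
Proof.
rewrite -sum1_card -(big_mkord (fun k => m <= k)%N (fun=> 1%N)).
by rewrite -(big_nat_widenl m 0 N xpredT) // sum_nat_const_nat muln1.
Qed.

Section SmallRowSums.
Context (R : realType).
Context d (T : measurableType d) (P : probability T R).
Context (X : nat -> nat * nat -> T -> R).
Hypothesis mX : forall N p, measurable_fun setT (X N p).
Hypothesis indX : forall N, mutually_independent P (upper_pairs N) (X N).
Context (K : R).
Hypothesis K0 : 0 <= K.
Hypothesis X_mean : forall N p, upper_pairs N p -> forall t, 1 <= t ->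
  `|Ex P (fun w => trunc t (X N p w))| <= K / t ^+ 5.
Context (eta : R).
Hypothesis eta0 : 0 < eta.
Hypothesis eta4 : eta <= 4^-1.

Ltac clra := clear - R d T P X mX indX K K0 X_mean eta eta0 eta4; lra.

(** Every right sum has variance at least [v0 N], so it reaches the threshold with probability at
    least [N^(-(1 + b)/2) / 2], where [b = c^2 / v0 < 1]. Over about [k0 N] independent rows these
    add up to order [N^((1 - b)/2)]. [d0] is the variance that truncation may remove from an
    entry. *)
Lemma near_all_right_sums_small (A1 c v0 k0 d0 : R) :
  (forall N p, upper_pairs N p -> forall t, 1 <= t ->
    Ex P (fun w => trunc t (X N p w) ^+ 2) <= 1) ->
  (forall N p, upper_pairs N p -> forall t, 1 <= t ->
    A1 - K / t ^+ 4 <= Ex P (fun w => trunc t (X N p w) ^+ 2)) ->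
  0 < A1 -> 0 < c -> c ^+ 2 < v0 -> 0 < k0 -> k0 < 1 -> 0 < d0 -> d0 <= A1 / 2 ->
  v0 <= (1 - k0) * (A1 - d0) ->
  \forall N \near \oo, outer P
    [set w | forall i : 'I_(Num.truncn (k0 * N%:R)),
       right_sum N (X N) (level eta N) w i < c * Num.sqrt (2 * N%:R * ln N%:R)]
    (expR (- (2 * ln N%:R))).
Proof.
move=> X_var X_lb A10 c0 cv k00 k01 d00 dA vA.
have v00 : 0 < v0 by rewrite (lt_trans _ cv)// exprn_gt0.
pose b := c ^+ 2 / v0.
have b1 : b < 1 by rewrite ltr_pdivrMr// mul1r.
have b0 : 0 < b by rewrite divr_gt0// exprn_gt0.
(* With this [g] the exponent [(1/2 + 5 g) * 2 b] equals [(1 + b)/2 - (1 - b)^2/2], which is below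
   1. *)
pose g := (1 - b) / 20.
have g0 : 0 < g by rewrite /g; lra.
have g1 : g <= 1 by rewrite /g; lra.
have [rho rhoE] : {r : R | r = g ^+ 2 / 40} by exists (g ^+ 2 / 40).
have g2 : 0 < g ^+ 2 <= 1 by rewrite exprn_gt0//= expr_le1// ltW.
have rho0 : 0 < rho <= 1 by rewrite rhoE; lra.
have [tau tauE] : {r : R | r = rho / 8} by exists (rho / 8).
have tau0 : 0 < tau <= 1 by rewrite tauE; lra.
have taup : 0 < tau by case/andP: tau0.
have rhop : 0 < rho by case/andP: rho0.
have rho8 : 0 <= rho / 8 by rewrite divr_ge0// ltW.
have A12 : 0 <= A1 / 2 by rewrite divr_ge0// ltW.
have th4 : 4^-1 <= 2^-1 - tau by rewrite tauE; lra.
have th0 : 0 <= 2^-1 - tau by rewrite (le_trans _ th4).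
have rq : 0 <= 2^-1 - rho / 4 by lra.
have rq1 : 0 <= 1 - rho / 4 by lra.
have Ad2 : A1 / 2 <= A1 - d0 by move: dA; clra.
have Ad0 : 0 <= A1 - d0 by exact: le_trans A12 Ad2.
have g13 : 1 <= 1 + g <= 3 by lra.
have g23 : 1 <= 1 + 2 * g <= 3 by lra.
have o13 : (1 : R) <= (1 : R) <= (3 : R) by apply/andP; split; lra.
have gg : 0 <= 1 + g by lra.
have h5 : 0 <= 2^-1 + 5 * g by lra.
have [k34 k34E] : {k : R | k = 3 / 4} by exists (3 / 4).
have k340 : 0 < k34 by rewrite k34E; lra.
have [k12 k12E] : {k : R | k = 2^-1} by exists (2^-1).
have k120 : 0 < k12 by rewrite k12E; lra.
have [k1 k1E] : {k : R | k = 1} by exists 1.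
have k10 : 0 < k1 by rewrite k1E.
have [kg kgE] : {k : R | k = g ^+ 2 / 4 * (2 * c ^+ 2)} by exists (g ^+ 2 / 4 * (2 * c ^+ 2)).
have kg0 : 0 < kg by rewrite kgE; apply: mulr_gt0; [rewrite divr_gt0// exprn_gt0|rewrite mulr_gt0// exprn_gt0].
have [kb kbE] : {k : R | k = (1 - b) / 2} by exists ((1 - b) / 2).
have kb0 : 0 < kb by rewrite kbE; lra.
have [c3 c3E] : {k : R | k = 3 * c / v0} by exists (3 * c / v0).
have c30 : 0 < c3 by rewrite c3E divr_gt0// mulr_gt0.
have [C1 C1E] : {k : R | k = c3 / tau} by exists (c3 / tau).
have [C2 C2E] : {k : R | k = K / (rho / 8 * c)} by exists (K / (rho / 8 * c)).
have [C3 C3E] : {k : R | k = K / (A1 / 8 * c)} by exists (K / (A1 / 8 * c)).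
have [C4 C4E] : {k : R | k = c3 / (rho / 4)} by exists (c3 / (rho / 4)).
have [C7 C7E] : {k : R | k = 8 / k0} by exists (8 / k0).
have [C8 C8E] : {k : R | k = 2 / k0} by exists (2 / k0).
have [C9 C9E] : {k : R | k = K / d0} by exists (K / d0).
have n1 : \forall N \near \oo, C1 * (1 + ln N%:R) <= expR (eta * ln N%:R).
  exact: (near_ln (expR_dominates C1 eta0)).
have n2 : \forall N \near \oo, C2 <= expR (k34 * ln N%:R).
  exact: (near_ln (expR_ge_near C2 k340)).
have n3 : \forall N \near \oo, C3 <= expR (k34 * ln N%:R).
  exact: (near_ln (expR_ge_near C3 k340)).
have n4 : \forall N \near \oo, C4 * (1 + ln N%:R) <= expR (k12 * ln N%:R).
  exact: (near_ln (expR_dominates C4 k120)).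
have n5 : \forall N \near \oo, 1 <= ln N%:R :> R.
  exact: (near_ln (near_pinfty_ge 1)).
have n6 : \forall N \near \oo, 4 <= expR (kg * ln N%:R).
  exact: (near_ln (expR_ge_near 4 kg0)).
have n7 : \forall N \near \oo, C7 * (1 + ln N%:R) <= expR (kb * ln N%:R).
  exact: (near_ln (expR_dominates C7 kb0)).
have n8 : \forall N \near \oo, C8 <= expR (k1 * ln N%:R).
  exact: (near_ln (expR_ge_near C8 k10)).
have n9 : \forall N \near \oo, C9 <= expR (k1 * ln N%:R).
  exact: (near_ln (expR_ge_near C9 k10)).
near=> N.
have N0 : (0 < N)%N by near: N; exact: near_nat_gt0.
have N1 : C1 * (1 + ln N%:R) <= expR (eta * ln N%:R) by near: N; exact: n1.
have N2 : C2 <= expR (k34 * ln N%:R) by near: N; exact: n2.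
have N3 : C3 <= expR (k34 * ln N%:R) by near: N; exact: n3.
have N4 : C4 * (1 + ln N%:R) <= expR (k12 * ln N%:R) by near: N; exact: n4.
have N5 : 1 <= ln N%:R :> R by near: N; exact: n5.
have N6 : 4 <= expR (kg * ln N%:R) by near: N; exact: n6.
have N7 : C7 * (1 + ln N%:R) <= expR (kb * ln N%:R) by near: N; exact: n7.
have N8 : C8 <= expR (k1 * ln N%:R) by near: N; exact: n8.
have N9 : C9 <= expR (k1 * ln N%:R) by near: N; exact: n9.
rewrite sqrt_scale//; set L : R := ln N%:R.
rewrite -/L in N1 N2 N3 N4 N5 N6 N7 N8 N9.
have L0 : 0 <= L by exact: ln_nat_ge0.
have NL : N%:R = expR L by rewrite expR_ln_nat.
have EL0 : 0 < expR L by exact: expR_gt0.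
rewrite k1E mul1r in N8 N9.
set sL := Num.sqrt (2 * L).
have sL0 : 0 <= sL by exact: sqrtr_ge0.
have sL2 : sL ^+ 2 = 2 * L by rewrite sqr_sqrtr// mulr_ge0.
have sL1 : sL <= 1 + L by exact: sqrt2L_le.
have sLge1 : 1 <= sL.
  by rewrite -(@ler_pXn2r _ 2)// ?nnegrE// sL2 expr1n; move: N5; clra.
have sLp : 0 < sL by exact: lt_le_trans sLge1.
set a := c * (expR (2^-1 * L) * sL).
have a0 : 0 < a by rewrite mulr_gt0// mulr_gt0// expR_gt0.
have EL : expR L = expR (2^-1 * L) ^+ 2 by rewrite -expRM_natl; congr expR; field.
have a2 : a ^+ 2 = c ^+ 2 * (2 * L) * expR L.
  by rewrite /a !exprMn -EL sL2; ring.
set m := Num.truncn (k0 * N%:R).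
have mk : m%:R <= k0 * N%:R.
  by have /truncn_itv /andP[] : 0 <= k0 * N%:R :> R by rewrite mulr_ge0// ltW.
have mN : (m <= N)%N.
  by rewrite -(ler_nat R) (le_trans mk)// ler_piMl// ltW.
(* Rounding [k0 N] down loses at most 1, hence at most half of it once [k0 N >= 2]. *)
have mlb : k0 / 2 * expR L <= m%:R.
  have : k0 * N%:R < m.+1%:R by exact: truncnS_gt.
  rewrite -natr1 NL.
  have : 2 <= k0 * expR L by move: N8; rewrite C8E ler_pdivrMr// mulrC.
  clra.
have t1 := level_ge1 eta4 N.
set t := level eta N in t1 *.
have t0 : 0 <= t by exact: le_trans ler01 t1.
have tE : t = expR ((2^-1 - eta) * L) by [].
set m1 := K / t ^+ 5.
have m10 : 0 <= m1 by rewrite divr_ge0// exprn_ge0.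
have m1le : m1 <= K * expR (- (5 / 4 * L)).
  rewrite /m1 ler_wpM2l// expRN lef_pV2 ?posrE ?exprn_gt0 ?expR_gt0//.
  rewrite tE -expRM_natl ler_expR mulrA ler_wpM2r//.
  by have := eta4; clra.
have Kt4 : K / t ^+ 4 <= d0.
  apply: (@le_trans _ _ (K / expR L)).
    rewrite ler_wpM2l// lef_pV2 ?posrE ?exprn_gt0 ?expR_gt0//.
    rewrite tE -expRM_natl ler_expR mulrA -[leLHS]mul1r ler_wpM2r//.
    by have := eta4; clra.
  by rewrite ler_pdivrMr//; move: N9; rewrite C9E ler_pdivrMr// mulrC.
have Xm p : upper_pairs N p -> `|Ex P (fun w => trunc t (X N p w))| <= m1.
  by move=> Jp; exact: X_mean.
have Xs p : upper_pairs N p -> Ex P (fun w => trunc t (X N p w) ^+ 2) <= 1.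
  by move=> Jp; exact: (X_var _ _ Jp).
have Xl p : upper_pairs N p -> A1 - d0 <= Ex P (fun w => trunc t (X N p w) ^+ 2).
  by move=> Jp; apply: le_trans (X_lb _ _ Jp _ t1); rewrite lerD2l lerN2.
have eu (i : 'I_m) (k : 'I_N) : upper_pairs N (edge i k).
  by have := edge_upper (widen_ord mN i) k.
pose V (i : 'I_m) := right_var P N (X N) t i.
have Vlb i : v0 * expR L <= V i.
  apply: (@le_trans _ _ (\sum_(k < N | (m <= k)%N) (A1 - d0))); last first.
    by apply: ler_sum => k _; apply: Xl; exact: eu.
  rewrite sumr_const -[leRHS]mulr_natl.
  have -> : #|(fun k : 'I_N => (m <= k)%N)| = (N - m)%N by exact: card_ord_geq.
  rewrite natrB// -NL.
  apply: (@le_trans _ _ ((1 - k0) * (A1 - d0) * N%:R)); first by rewrite ler_wpM2r.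
  by rewrite mulrAC ler_wpM2r//; move: mk; clra.
have Vub i : V i <= expR L.
  apply: (@le_trans _ _ (\sum_(k < N | (m <= k)%N) 1)).
    by apply: ler_sum => k _; apply: Xs; exact: eu.
  by rewrite sumr_const -NL ler_nat -[leqRHS]card_ord max_card.
have Vp i : 0 < V i by rewrite (lt_le_trans _ (Vlb i))// mulr_gt0.
(* Row [i] is tilted by [z a / V i] with [z] equal to 1, [1 + g] or [1 + 2 g], all between 1 and 3,
   and [z^2 y i / 2] is the Gaussian value of the log moment generating function there. *)
pose y i := a ^+ 2 / V i.
have y0 i : 0 <= y i by rewrite divr_ge0 ?sqr_ge0// ltW.
have yub i : y i <= 2 * b * L.
  rewrite /y ler_pdivrMr// a2.
  have h : 0 <= 2 * b * L by rewrite mulr_ge0// mulr_ge0// ltW.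
  apply: le_trans (ler_wpM2l h (Vlb i)).
  by rewrite /b le_eqVlt; apply/orP; left; apply/eqP; field; rewrite gt_eqF.
have ylb i : 2 * c ^+ 2 * L <= y i.
  rewrite /y ler_pdivlMr// a2.
  have h : 0 <= 2 * c ^+ 2 * L by rewrite mulr_ge0// mulr_ge0// sqr_ge0.
  apply: le_trans (ler_wpM2l h (Vub i)) _.
  by rewrite le_eqVlt; apply/orP; left; apply/eqP; ring.
have rate (i : 'I_m) (z : R) : 1 <= z <= 3 ->
  [/\ 0 <= z * (a / V i), z * (a / V i) * t <= tau, z * (a / V i) <= rho / 4,
     m1 * expR L <= rho / 8 * (z * (a / V i) * V i) &
     m1 <= (2^-1 - tau) * (z * (a / V i)) * (A1 / 2)].
  move=> /andP[z1 z3].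
  have r0 : 0 <= a / V i by rewrite divr_ge0 ?ltW.
  have rub : z * (a / V i) <= c3 * (1 + L) * expR (- (2^-1 * L)).
    apply: (@le_trans _ _ (3 * (a / (v0 * expR L)))).
      apply: ler_pM => //; first by exact: le_trans ler01 z1.
      by rewrite ler_wpM2l ?(ltW a0)// lef_pV2 ?posrE// mulr_gt0.
    have -> : 3 * (a / (v0 * expR L)) = c3 * sL * expR (- (2^-1 * L)).
      by rewrite /a c3E EL expRN; field; rewrite !gt_eqF ?expR_gt0.
    by rewrite ler_wpM2r ?expR_ge0// ler_wpM2l// ltW.
  have rlb : c * expR (- (2^-1 * L)) <= z * (a / V i).
    apply: (@le_trans _ _ (1 * (a / expR L))).
      rewrite mul1r ler_pdivlMr// EL /a -mulrA ler_wpM2l ?(ltW c0)//.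
      by rewrite expRN expr2 mulKf ?gt_eqF ?expR_gt0// ler_peMr// expR_ge0.
    apply: ler_pM => //; first by rewrite divr_ge0// ltW.
    by rewrite ler_wpM2l ?(ltW a0)// lef_pV2 ?posrE.
  split.
  - by rewrite mulr_ge0// (le_trans ler01).
  - apply: (@le_trans _ _ (c3 * (1 + L) * expR (- (2^-1 * L)) * t)); first by rewrite ler_wpM2r.
    have -> : c3 * (1 + L) * expR (- (2^-1 * L)) * t = c3 * (1 + L) * expR (- (eta * L)).
      by rewrite tE -[LHS]mulrA -expRD; congr (_ * expR _); ring.
    rewrite expRN ler_pdivrMr ?expR_gt0//.
    by move: N1; rewrite C1E mulrAC ler_pdivrMr// [X in _ <= X]mulrC.
  - apply: (le_trans rub); rewrite expRN ler_pdivrMr ?expR_gt0//.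
    by move: N4; rewrite C4E k12E mulrAC ler_pdivrMr ?divr_gt0// [X in _ <= X]mulrC.
  - apply: (@le_trans _ _ (rho / 8 * a)); last first.
      rewrite ler_wpM2l//.
      by rewrite -mulrA divfK ?gt_eqF// ler_peMl// ltW.
    apply: (@le_trans _ _ (K * expR (- (5 / 4 * L)) * expR L)); first by rewrite ler_wpM2r// ltW.
    apply: (@le_trans _ _ (rho / 8 * (c * expR (2^-1 * L)))); last first.
      rewrite ler_wpM2l//.
      by rewrite /a ler_wpM2l ?(ltW c0)// ler_peMr// expR_ge0.
    have h8 : 0 < rho / 8 * c by rewrite mulr_gt0// divr_gt0.
    move: N2; rewrite C2E k34E ler_pdivrMr//.
    have -> : K * expR (- (5 / 4 * L)) * expR L = K * expR (- (4^-1 * L)).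
      by rewrite -mulrA -expRD; congr (_ * expR _); field.
    have -> : expR (2^-1 * L) = expR (3 / 4 * L) * expR (- (4^-1 * L)).
      by rewrite -expRD; congr expR; field.
    move=> h; have := ler_wpM2r (expR_ge0 (- (4^-1 * L))) h.
    by set u1 := expR (3 / 4 * L); set u2 := expR (- (4^-1 * L)); clra.
  - apply: (le_trans m1le).
    apply: (@le_trans _ _ (4^-1 * (c * expR (- (2^-1 * L))) * (A1 / 2))); last first.
      rewrite ler_wpM2r//.
      have h0 : 0 <= c * expR (- (2^-1 * L)) by rewrite mulr_ge0 ?expR_ge0// ltW.
      by apply: ler_pM.
    have h8 : 0 < A1 / 8 * c by rewrite mulr_gt0// divr_gt0.
    move: N3; rewrite C3E k34E ler_pdivrMr//.
    have -> : expR (- (2^-1 * L)) = expR (3 / 4 * L) * expR (- (5 / 4 * L)).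
      by rewrite -expRD; congr expR; field.
    move=> h; have := ler_wpM2r (expR_ge0 (- (5 / 4 * L))) h.
    by set u1 := expR (3 / 4 * L); set u2 := expR (- (5 / 4 * L)); clra.
have mgf_ub i z : 1 <= z <= 3 ->
    right_mgf P N (X N) t i (z * (a / V i)) <= expR ((1 + rho) / 2 * z ^+ 2 * y i).
  move=> /(rate i)[r0 rt r1 rm rs].
  apply: le_trans (right_mgf_le (mX N) t0 mN i r0 rt _ Xm m10) _; first by case/andP: tau0.
  rewrite ler_expR NL -/(V i).
  have -> : (1 + rho) / 2 * z ^+ 2 * y i = (1 + rho) / 2 * (z * (a / V i)) ^+ 2 * V i.
    by rewrite /y; field; rewrite gt_eqF.
  have := ler_wpM2l r0 rm; set r := z * _; rewrite tauE expr2 => h.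
  have : 0 <= rho * (r * r * V i).
    by apply: mulr_ge0; [exact: ltW|apply: mulr_ge0; [exact: mulr_ge0|exact: ltW]].
  by move: h; clra.
have mgf_lb i z : 1 <= z <= 3 ->
    expR ((1 - rho) / 2 * z ^+ 2 * y i) <= right_mgf P N (X N) t i (z * (a / V i)).
  move=> /(rate i)[r0 rt r1 rm rs].
  have rle1 : z * (a / V i) <= 1 by apply: (le_trans r1); case/andP: rho0 => _; clra.
  apply: le_trans (right_mgf_ge (mX N) t0 mN i r0 rt (ltW taup) Xm m10 _ Xs rle1).
    rewrite ler_expR NL -/(V i).
    have -> : (1 - rho) / 2 * z ^+ 2 * y i = (1 - rho) / 2 * (z * (a / V i)) ^+ 2 * V i.
      by rewrite /y; field; rewrite gt_eqF.
    have := ler_wpM2l r0 rm; move: r0 r1 rle1; set r := z * _ => r0 r1 rle1 h.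
    have r2V : 0 <= r ^+ 2 * V i by rewrite mulr_ge0 ?sqr_ge0// ltW.
    have r2 : r ^+ 2 <= rho / 4.
      by apply: le_trans r1; rewrite expr2 ler_piMl.
    have h2 : (2^-1 - rho / 4) * (r ^+ 2 * V i) <=
      (2^-1 - tau) * r ^+ 2 * V i - r * m1 * expR L.
      by move: h; rewrite tauE expr2; clra.
    have h3 : 0 <= (2^-1 - rho / 4) * (r ^+ 2 * V i).
      by rewrite mulr_ge0//.
    apply: (@le_trans _ _ ((1 - rho / 4) * ((2^-1 - rho / 4) * (r ^+ 2 * V i)))); last first.
      by apply: ler_pM => //; rewrite lerD2l lerN2.
    have : 0 <= rho ^+ 2 * (r ^+ 2 * V i) by rewrite mulr_ge0// sqr_ge0.
    have : 0 <= rho * (r ^+ 2 * V i) by rewrite mulr_ge0// ltW.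
    by rewrite expr2; clra.
  move=> p Jp; apply: (le_trans rs); rewrite ler_wpM2l//.
    by rewrite mulr_ge0//.
  exact: le_trans Ad2 (Xl p Jp).
have bm i : 2^-1 * expR (- ((2^-1 + 5 * g) * y i)) <=
  bump_mean P N (X N) t a ((1 + 2 * g) * a) ((1 + g) * (a / V i)) (g * (a / V i)) i.
  have yE z z' : z * (a / V i) * (z' * a) = z * z' * y i by rewrite /y; field; rewrite gt_eqF.
  rewrite /bump_mean !yE.
  have -> : g * (a / V i) * a = g * y i by rewrite /y; field; rewrite gt_eqF.
  have -> : (1 + g) * (a / V i) - g * (a / V i) = 1 * (a / V i) by ring.
  have -> : (1 + g) * (a / V i) + g * (a / V i) = (1 + 2 * g) * (a / V i) by ring.
  apply: bump_mean_lower => //.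
  - by rewrite g0.
  - rewrite expRN lef_pV2 ?posrE ?expR_gt0//; apply: (le_trans N6).
    have hg : 0 <= g ^+ 2 / 4 by rewrite divr_ge0// sqr_ge0.
    rewrite ler_expR; apply: le_trans (ler_wpM2l hg (ylb i)).
    by rewrite kgE -[X in X <= _]mulrA.
  - by rewrite -rhoE; exact: mgf_lb.
  - by rewrite -rhoE; have := mgf_ub i 1; rewrite expr1n mulr1; apply.
  - by rewrite -rhoE; exact: mgf_ub.
have r0 i : 0 <= a / V i by apply: divr_ge0; exact: ltW.
have u0 i : 0 <= g * (a / V i) by apply: mulr_ge0 => //; exact: ltW.
have l0 i : 0 <= (1 + g) * (a / V i) by exact: mulr_ge0.
apply: outer_le (all_right_sums_small (mX N) (@indX N) t0 mN a (fun=> (1 + 2 * g) * a) u0 l0).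
rewrite ler_expR lerN2.
apply: (@le_trans _ _ (\sum_(i < m) 2^-1 * expR (- ((1 + b) / 2 * L)))); last first.
  apply: ler_sum => i _; apply: le_trans (bm i); rewrite ler_wpM2l// ler_expR lerN2.

  apply: (le_trans (ler_wpM2l h5 (yub i))).
  have -> : (2^-1 + 5 * g) * (2 * b * L) = (1 + 10 * g) * b * L by field.
  rewrite ler_wpM2r// /g.
  have -> : (1 + 10 * ((1 - b) / 20)) * b = (1 + b) / 2 - (1 - b) ^+ 2 / 2 by field.
  by rewrite lerBlDr lerDl divr_ge0// sqr_ge0.
rewrite sumr_const card_ord -[leRHS]mulr_natl.
apply: (@le_trans _ _ (k0 / 2 * expR L * (2^-1 * expR (- ((1 + b) / 2 * L))))); last first.
  by rewrite ler_wpM2r// mulr_ge0 ?expR_ge0.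
have -> : k0 / 2 * expR L * (2^-1 * expR (- ((1 + b) / 2 * L))) = k0 / 4 * expR (kb * L).
  have -> : expR (kb * L) = expR L * expR (- ((1 + b) / 2 * L)).
    by rewrite -expRD kbE; congr expR; field.
  by field.
have : C7 * (1 + L) * k0 = 8 * (1 + L) by rewrite C7E; field; rewrite gt_eqF.
by have := ler_wpM2r (ltW k00) N7; clra.
Unshelve. all: by end_near. Qed.

End SmallRowSums.

(** * Almost sure bounds on the Laplacian *)

Section Moments.
Context (R : realType) d (T : measurableType d) (P : probability T R).
Context (Z : T -> R) (p K : R).
Hypothesis mZ : measurable_fun setT Z.
Hypothesis p6 : 6 <= p.
Hypothesis Z_mean : (\int[P]_w (Z w)%:E = 0)%E.
Hypothesis Z_moment : (\int[P]_w (`|Z w| `^ p)%:E <= K%:E)%E.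

Let G w := `|Z w| `^ p.

Let mG : measurable_fun setT G.
Proof.
apply: (@measurableT_comp _ _ _ _ _ _ (fun x : R => x `^ p)) => //.
exact: measurableT_comp.
Qed.

Let G0 w : 0 <= G w.
Proof. exact: powR_ge0. Qed.

Let iG : P.-integrable setT (EFin \o G).
Proof.
apply/integrableP; split; first exact/measurable_EFinP.
apply: le_lt_trans (ltry K); apply: le_trans Z_moment.
by apply: ge0_le_integral => //=; [exact/measurable_EFinP/measurableT_comp|
  exact/measurable_EFinP|move=> w _; rewrite lee_fin ger0_norm].
Qed.

Let RG : Rintegral P setT G <= K.
Proof.
rewrite -lee_fin /Rintegral fineK//; exact: integrable_fin_num.
Qed.

(** Trades the surplus of moments for powers of the cut: above [t], a [q]-th power is at most the
    [p]-th power divided by [t^(6 - q)]. Hence [t^5] in the bounds on means and [t^4] in those on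
    variances. *)
Lemma pow_le_powR (x t : R) (q : nat) : (q <= 6)%N -> 1 <= t -> t <= x ->
  x ^+ q * t ^+ (6 - q) <= x `^ p.
Proof.
move=> q6 t1 tx; have x1 : 1 <= x by exact: le_trans tx.
have x0 : 0 <= x by exact: le_trans x1.
apply: (@le_trans _ _ (x ^+ 6)).
  rewrite -[leRHS](_ : x ^+ q * x ^+ (6 - q) = _); last by rewrite -exprD subnKC.
  rewrite ler_wpM2l ?exprn_ge0//.
  by rewrite lerXn2r ?nnegrE//; exact: le_trans t1.
by rewrite -powR_mulrn// ler_powR.
Qed.

Lemma integrable_dominated (f : T -> R) (c : R) : measurable_fun setT f ->
  (forall w, `|f w| <= 1 + c * G w) -> P.-integrable setT (EFin \o f).
Proof.
move=> mf fG.
apply: (@le_integrable _ _ _ P setT measurableT _ (EFin \o (fun w => 1 + c * G w))).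
- exact/measurable_EFinP.
- by move=> w _; rewrite /= lee_fin (le_trans (fG w))// ler_norm.
- have -> : EFin \o (fun w => 1 + c * G w) = (EFin \o (fun=> 1 : R)) \+ (fun w => c%:E * (EFin \o G) w)%E.
    by apply/funext => w /=; rewrite EFinD EFinM.
  apply: integrableD => //; last exact: integrableZl.
  by apply: bm_integrable; exact: bm_cst.
Qed.

Lemma Rintegral_le_moment (f : T -> R) (c : R) : 0 <= c -> measurable_fun setT f ->
  (forall w, `|f w| <= c * G w) -> `|Rintegral P setT f| <= c * K.
Proof.
move=> c0 mf fG.
have iF : P.-integrable setT (EFin \o f).
  by apply: (@integrable_dominated f c) => // w; rewrite (le_trans (fG w))// lerDr.
have iN : P.-integrable setT (EFin \o (fun w => `|f w|)) by exact: integrable_norm.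
have iC : P.-integrable setT (EFin \o (fun w => c * G w)).
  apply: (@integrable_dominated _ c) => [|w]; first exact: measurable_funM.
  by rewrite ger0_norm ?mulr_ge0// lerDr.
apply: (le_trans (le_normr_Rintegral _ iF)) => //.
apply: (@le_trans _ _ (Rintegral P setT (fun w => c * G w))).
  by apply: le_Rintegral.
by rewrite RintegralZl// ler_wpM2l.
Qed.

Lemma trunc_mean_le (t : R) : 1 <= t ->
  `|Ex P (fun w => trunc t (Z w))| <= K / t ^+ 5.
Proof.
move=> t1; have t0 : 0 <= t by exact: le_trans t1.
have tp : 0 < t ^+ 5 by rewrite exprn_gt0// (lt_le_trans _ t1).
have bt : bounded_measurable (fun w => trunc t (Z w)) by apply: bm_comp => //; exact: bm_trunc.
have it := bm_integrable P bt.
have iZ : P.-integrable setT (EFin \o Z).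
  apply: (@integrable_dominated _ 1) => // w; rewrite mul1r.
  have [Z1|/ltW Z1] := leP `|Z w| 1; first by rewrite (le_trans Z1)// lerDl.
  rewrite (@le_trans _ _ (G w))// ?lerDr//.
  by have := @pow_le_powR `|Z w| 1 1 isT (lexx _) Z1; rewrite expr1n mulr1 expr1.
have EZ : Rintegral P setT Z = 0 by rewrite /Rintegral Z_mean.
(* As [Z] is centred, its truncated mean is minus the mean of the part cut off, which the moment
   controls. *)
have -> : Ex P (fun w => trunc t (Z w)) = - Rintegral P setT (fun w => Z w - trunc t (Z w)).
  by rewrite RintegralB// EZ sub0r opprK.
rewrite normrN mulrC; apply: Rintegral_le_moment.
- by rewrite invr_ge0 ltW.
- by apply: measurable_funB => //; case: bt.
- move=> w; rewrite /trunc; case: (leP `|Z w| t) => [_|/ltW tZ].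
    by rewrite subrr normr0 mulr_ge0// invr_ge0 ltW.
  rewrite subr0 mulrC ler_pdivlMr//.
  by have := @pow_le_powR `|Z w| t 1 isT t1 tZ; rewrite expr1.
Qed.

Let iZ2 : P.-integrable setT (EFin \o (fun w => Z w ^+ 2)).
Proof.
apply: (@integrable_dominated _ 1) => [|w]; first exact: measurable_funX.
rewrite mul1r normrX.
have [Z1|/ltW Z1] := leP `|Z w| 1.
  by rewrite (le_trans (exprn_ile1 2 (normr_ge0 _) Z1))// lerDl.
rewrite (@le_trans _ _ (G w))// ?lerDr//.
by have := @pow_le_powR `|Z w| 1 2 isT (lexx _) Z1; rewrite expr1n mulr1.
Qed.

Lemma trunc_var_le (t : R) : 0 <= t ->
  Ex P (fun w => trunc t (Z w) ^+ 2) <= Rintegral P setT (fun w => Z w ^+ 2).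
Proof.
move=> t0; apply: le_Rintegral => //.
  apply: bm_integrable.
  have bt : bounded_measurable (fun w => trunc t (Z w)) by apply: bm_comp => //; exact: bm_trunc.
  exact: bm_mul.
by move=> w _; rewrite /trunc; case: ifP => // _; rewrite expr0n sqr_ge0.
Qed.

Lemma trunc_var_ge (t : R) : 1 <= t ->
  Rintegral P setT (fun w => Z w ^+ 2) - K / t ^+ 4 <= Ex P (fun w => trunc t (Z w) ^+ 2).
Proof.
move=> t1; have t0 : 0 <= t by exact: le_trans t1.
have tp : 0 < t ^+ 4 by rewrite exprn_gt0// (lt_le_trans _ t1).
have bt : bounded_measurable (fun w => trunc t (Z w)) by apply: bm_comp => //; exact: bm_trunc.
have bt2 : bounded_measurable (fun w => trunc t (Z w) ^+ 2) by exact: bm_mul.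
have it := bm_integrable P bt2.
rewrite lerBlDr -lerBlDl -RintegralB//.
apply: (le_trans (ler_norm _)); rewrite mulrC; apply: Rintegral_le_moment.
- by rewrite invr_ge0 ltW.
- by apply: measurable_funB; [exact: measurable_funX|case: bt2].
- move=> w; rewrite /trunc; case: (leP `|Z w| t) => [_|/ltW tZ].
    by rewrite subrr normr0 mulr_ge0// invr_ge0 ltW.
  rewrite expr0n subr0 mulrC ler_pdivlMr// normrX.
  exact: (@pow_le_powR `|Z w| t 2 isT t1 tZ).
Qed.

Lemma tail_mean_le (M t : R) : 1 <= M ->
  Ex P (fun w => `|tail_between M t (Z w)|) <= K / M ^+ 5.
Proof.
move=> M1.
have Mp : 0 < M ^+ 5 by rewrite exprn_gt0// (lt_le_trans _ M1).
have mt : measurable_fun setT (fun w => `|tail_between M t (Z w)|).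
  apply: measurableT_comp => //; apply: (@measurableT_comp _ _ _ _ _ _ (tail_between M t)) => //.
  apply: measurable_fun_ifT => //; apply: measurable_and; last exact: measurable_fun_ler.
  exact: measurable_fun_ltr.
apply: (le_trans (ler_norm _)); rewrite mulrC; apply: Rintegral_le_moment => //.
- by rewrite invr_ge0 ltW.
- move=> w; rewrite normr_id /tail_between; case: ifPn => [/andP[/ltW MZ _]|_].
    rewrite mulrC ler_pdivlMr//.
    by have := @pow_le_powR `|Z w| M 1 isT M1 MZ; rewrite expr1.
  by rewrite normr0 mulr_ge0// invr_ge0 ltW.
Qed.

Lemma tail_outer (t : R) : 1 <= t ->
  outer P [set w | t < `|Z w|] (K * t `^ (- p)).
Proof.
move=> t1; have tp : 0 < t `^ p by rewrite powR_gt0// (lt_le_trans _ t1).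
pose F := [set w | t < `|Z w|].
have mF : measurable F.
  have -> : F = setT `&` (fun w => `|Z w|) @^-1` `]t, +oo[.
    by rewrite setTI; apply/seteqP; split=> x /=; rewrite in_itv/= andbT.
  have mn : measurable_fun setT (fun w => `|Z w|) by exact: measurableT_comp.
  exact: mn.
exists F; split=> //.
rewrite -[leLHS]fineK ?fin_num_measure// lee_fin -Ex_indic//.
apply: (le_trans (ler_norm _)); rewrite mulrC; apply: Rintegral_le_moment.
- exact: powR_ge0.
- by apply: measurable_indic.
- move=> w; rewrite powRN indicE; case: (boolP (w \in F)) => [|_].
    rewrite inE /F/= => /ltW tZ; rewrite normr1 mulrC ler_pdivlMr// mul1r.
    by rewrite ge0_ler_powR ?nnegrE// ?(le_trans _ t1)// ?(le_trans _ p6).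
  by rewrite normr0 mulr_ge0// invr_ge0 ltW.
Qed.

End Moments.

Lemma limn_esup_le_near (R : realType) (u : (\bar R)^nat) (l : \bar R) :
  (\forall n \near \oo, (u n <= l)%E) -> (limn_esup u <= l)%E.
Proof.
move=> ul; apply: (@le_trans _ _ (ereal_sup (u @` [set n | (u n <= l)%E]))).
  by apply: ereal_inf_lbound; exists [set n | (u n <= l)%E].
by apply: ge_ereal_sup => _ [n /= nl <-].
Qed.

Lemma limn_einf_ge_near (R : realType) (u : (\bar R)^nat) (l : \bar R) :
  (\forall n \near \oo, (l <= u n)%E) -> (l <= limn_einf u)%E.
Proof.
move=> lu; rewrite /limn_einf leeNr; apply: limn_esup_le_near.
by apply: filterS lu => n ln; rewrite /= leeN2.
Qed.

Section LaplacianNorm.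
Context (R : realType) d (T : measurableType d) (P : probability T R).
Context (X : nat -> nat * nat -> T -> R).
Hypothesis mX : forall N p, measurable_fun setT (X N p).
Hypothesis indX : forall N, mutually_independent P (upper_pairs N) (X N).
Context (K A1 A2 delta : R).
Hypothesis K0 : 0 <= K.
Hypothesis X_mean : forall N p, upper_pairs N p -> forall t, 1 <= t ->
  `|Ex P (fun w => trunc t (X N p w))| <= K / t ^+ 5.
Hypothesis X_tail : forall N p, upper_pairs N p -> forall M t, 1 <= M ->
  Ex P (fun w => `|tail_between M t (X N p w)|) <= K / M ^+ 5.
Hypothesis X_ub : forall N p, upper_pairs N p -> forall t, 1 <= t ->
  Ex P (fun w => trunc t (X N p w) ^+ 2) <= A2.
Hypothesis X_lb : forall N p, upper_pairs N p -> forall t, 1 <= t ->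
  A1 - K / t ^+ 4 <= Ex P (fun w => trunc t (X N p w) ^+ 2).
Hypothesis X_outer : forall N p, upper_pairs N p -> forall t, 1 <= t ->
  outer P [set w | t < `|X N p w|] (K * t `^ (- (6 + delta))).
Hypothesis A10 : 0 < A1.
Hypothesis A20 : 0 < A2.
Hypothesis A21 : A2 <= 1.
Hypothesis delta0 : 0 < delta.
Context (M : forall N, T -> 'M[R]_N).
Hypothesis ME : forall N w i j, M N w i j =
  if i == j then - \sum_(k < N | k != i) X N (edge i k) w else X N (edge i j) w.

(** Chosen so that [(6 + delta) (1/2 - eta) = 3 + delta / 4]: the union over at most [N^2] entries
    then has probability of order [N^(-1 - delta/4)], which is summable. *)
Let eta := delta / (4 * (6 + delta)).

Let eta0 : 0 < eta.
Proof. by rewrite divr_gt0// mulr_gt0// addr_gt0. Qed.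

Let eta4 : eta <= 4^-1.
Proof.
rewrite /eta ler_pdivrMr; last by rewrite mulr_gt0// addr_gt0.
by rewrite mulrA mulVf// mul1r lerDr.
Qed.

Let X_ub1 N p : upper_pairs N p -> forall t, 1 <= t ->
  Ex P (fun w => trunc t (X N p w) ^+ 2) <= 1.
Proof. by move=> Jp t t1; exact: le_trans (X_ub Jp t1) A21. Qed.

Lemma truncation_event N : (0 < N)%N ->
  outer P [set w | exists p, upper_pairs N p /\ level eta N < `|X N p w|]
    (K * expR (- (1 + delta / 4) * ln N%:R)).
Proof.
move=> N0; set t := level eta N.
have t1 : 1 <= t by exact: level_ge1.
apply: outer_sub (outer_le _ (outer_bigcup (Q := fun e : 'I_N * 'I_N => (e.1 <= e.2)%N)
  (E := fun e => [set w | t < `|X N (val e.1, val e.2) w|])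
  (p := fun=> K * t `^ (- (6 + delta))) _)).
- move=> w /= [[i j] [/= /andP[ij jN] h]].
  have iN : (i < N)%N by exact: leq_ltn_trans jN.
  by exists (Ordinal iN, Ordinal jN).
- rewrite sumr_const -[leLHS]mulr_natl.
  apply: (@le_trans _ _ (N%:R ^+ 2 * (K * t `^ (- (6 + delta))))).
    rewrite ler_wpM2r ?mulr_ge0 ?powR_ge0// -natrX ler_nat.
    by rewrite (leq_trans (max_card _))// card_prod card_ord.
  rewrite mulrCA ler_wpM2l// /t /level -expRM.
  rewrite -[X in X ^+ 2](expR_ln_nat R N0) -expRM_natl -expRD ler_expR.
  set L := ln _; rewrite le_eqVlt; apply/orP; left; apply/eqP.
  rewrite /eta; field.
  by rewrite gt_eqF// addr_gt0.
- by move=> [i j] /= ij; apply: X_outer => //; rewrite /upper_pairs/= ij ltn_ord.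
Qed.

Lemma opnorm_laplacian_le N w B D : (0 < N)%N -> 0 <= D ->
  (forall p, upper_pairs N p -> `|X N p w| <= level eta N) ->
  opb (offdiag (X N) (N := N) (trunc (level eta N)) w) B ->
  (forall i : 'I_N, `|\sum_(k < N | k != i) trunc (level eta N) (X N (edge i k) w)| <= D) ->
  opnorm (M N w) <= B + D.
Proof.
move=> N0 D0 good oB hD; apply: opnorm_le => //.
have tE (i j : 'I_N) : trunc (level eta N) (X N (edge i j) w) = X N (edge i j) w.
  by rewrite /trunc good//; exact: edge_upper.
have oD := @opb_diag _ _ (fun i : 'I_N =>
  - \sum_(k < N | k != i) trunc (level eta N) (X N (edge i k) w)) D _ D0.
apply: opb_ext (opbD oB (oD _)) => [i j|i]; last by rewrite normrN.
rewrite ME /offdiag; case: eqP => _; last by rewrite addr0 tE.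
by rewrite add0r; congr (- _); apply: eq_bigr => k _; rewrite tE.
Qed.

(** The norm dominates every diagonal entry, and on the diagonal the Laplacian holds, up to sign, a
    row sum: the right sum plus the columns below [m]. *)
Lemma opnorm_laplacian_ge N w m a D (i : 'I_m) : (m <= N)%N ->
  (forall p, upper_pairs N p -> `|X N p w| <= level eta N) ->
  a <= right_sum N (X N) (level eta N) w i ->
  `|\sum_(k < N | (k < m)%N && (k != i :> nat)) trunc (level eta N) (X N (edge i k) w)| <= D ->
  a - D <= opnorm (M N w).
Proof.
move=> mN good ai hD.
pose i' : 'I_N := widen_ord mN i.
apply: le_trans (opnorm_ge_diag (M N w) i'); rewrite ME eqxx normrN.
have -> : \sum_(k < N | k != i') X N (edge i' k) w =
    \sum_(k < N | (k < m)%N && (k != i :> nat)) trunc (level eta N) (X N (edge i k) w) +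
    right_sum N (X N) (level eta N) w i.
  rewrite /right_sum (bigID (fun k : 'I_N => (k < m)%N))/=; congr (_ + _).
    apply: eq_big => [k|k _]; first by rewrite andbC.
    by rewrite /trunc good//; exact: (edge_upper i' k).
  apply: eq_big => [k|k _]; last by rewrite /trunc good//; exact: (edge_upper i' k).
  rewrite -leqNgt andbC; case: leqP => //= mk; rewrite ?andbT//.
  by apply/eqP => ki; have := ltn_ord i; rewrite ltnNge -[i : nat]/(i' : nat) -ki mk.
set S1 := \sum_(k < N | _) _ in hD *; set S2 := right_sum _ _ _ _ _ in ai *.
have := ler_norm (S1 + S2); have := hD; rewrite ler_norml => /andP[h _].
lra.
Qed.

Lemma ae_opnorm_ratio_le (eps : R) : 0 < eps ->
  {ae P, forall w, \forall N \near \oo,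
    opnorm (M N w) / Num.sqrt (2 * N%:R * ln N%:R) <= Num.sqrt (2 * A2) + eps}.
Proof.
move=> eps0.
pose c := Num.sqrt (2 * A2) + eps / 2.
have sA : 0 < Num.sqrt (2 * A2) by rewrite sqrtr_gt0 mulr_gt0.
have sA2 : Num.sqrt (2 * A2) ^+ 2 = 2 * A2 by rewrite sqr_sqrtr// mulr_ge0// ltW.
have c0 : 0 < c by rewrite /c; lra.
have c2 : 2 < c ^+ 2 / A2.
  rewrite ltr_pdivlMr// -sA2 ltrXn2r ?nnegrE ?ltW// /c; lra.
have cE : c = Num.sqrt (2 * A2) + eps / 2 by [].
clearbody c.
(* Strictly between 2 and the available rate, so that [N * N^(-q)] remains summable after the union
   over rows. *)
pose q := (2 + c ^+ 2 / A2) / 2.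
have q0 : 0 < q by rewrite /q; lra.
have qc : q < c ^+ 2 / A2 by rewrite /q; lra.
have q2 : 2 < q by rewrite /q; lra.
pose g := Num.min (delta / 4) (Num.min (q - 2) 1).
have g0 : 0 < g by rewrite !lt_min divr_gt0//= subr_gt0 q2 ltr01.
have gd : g <= delta / 4 by rewrite ge_min lexx.
have gq : g <= q - 2 by rewrite !ge_min lexx orbT.
have g1 : g <= 1 by rewrite !ge_min lexx !orbT.
pose C := 9 * K + 1199.
have C0 : 0 <= C by have := K0; rewrite /C; lra.
have CE : C = 9 * K + 1199 by [].
have r1 := near_offdiag_norm mX indX K0 X_mean X_tail eta0 eta4 X_ub1.
rewrite -CE in r1; clearbody C.
have r2 := near_row_tail mX indX K0 X_mean eta0 eta4 c0 A20 A20 q0 qc X_ub.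
(* For such [L] the off-diagonal bound [C sqrt N] is at most [eps / 2] times [sqrt (2 N L)]; the
   other half of [eps] went into [c]. *)
have [C3 C3E] : {x : R | x = (2 * C / eps) ^+ 2 + 1} by exists ((2 * C / eps) ^+ 2 + 1).
have r3 : \forall N \near \oo, C3 <= ln N%:R by exact: (near_ln (near_pinfty_ge C3)).
pose E N := [set w | ~ (opnorm (M N w) / Num.sqrt (2 * N%:R * ln N%:R) <=
  Num.sqrt (2 * A2) + eps)].
have : {ae P, forall w, \forall N \near \oo, ~ E N w}.
  apply: (@borel_cantelli_outer _ _ _ P E g (K + 2) g0).
  near=> N.
  have N0 : (0 < N)%N by near: N; exact: near_nat_gt0.
  have R1 : outer P [set w | ~ opb (offdiag (X N) (N := N) (trunc (level eta N)) w)
      (C * expR (2^-1 * ln N%:R))] (expR (- (2 * ln N%:R))) by near: N; exact: r1.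
  have R2 (i : 'I_N) (Q : pred 'I_N) : #|Q|%:R * A2 <= A2 * N%:R ->
      outer P [set w | c * Num.sqrt (2 * N%:R * ln N%:R) <=
        `|\sum_(k | Q k) trunc (level eta N) (X N (edge i k) w)| ] (expR (- (q * ln N%:R))).
    by move: i Q; near: N; exact: r2.
  have R3 : C3 <= ln N%:R by near: N; exact: r3.
  move: R3; rewrite C3E => R3.
  set L : R := ln N%:R in R1 R2 R3 *.
  have L0 : 0 <= L by exact: ln_nat_ge0.
  have Lp : 0 < L by apply: lt_le_trans R3; rewrite ltr_wpDl// sqr_ge0.
  have NL : N%:R = expR L by rewrite expR_ln_nat.
  have t1 := level_ge1 eta4 N.
  have row : outer P [set w | exists i : 'I_N, c * Num.sqrt (2 * N%:R * L) <=
      `|\sum_(k < N | k != i) trunc (level eta N) (X N (edge i k) w)| ]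
      (N%:R * expR (- (q * L))).
    pose Er (i : 'I_N) := [set w | c * Num.sqrt (2 * N%:R * L) <=
        `|\sum_(k < N | k != i) trunc (level eta N) (X N (edge i k) w)| ].
    have oE i : xpredT i -> outer P (Er i) (expR (- (q * L))).
      move=> _; apply: R2; rewrite mulrC ler_wpM2l ?(ltW A20)//.
      by rewrite ler_nat -[leqRHS]card_ord max_card.
    apply: outer_sub (outer_le _ (outer_bigcup (p := fun=> expR (- (q * L))) oE)).
      by move=> w [i h]; exists i.
    by rewrite sumr_const card_ord mulr_natl.
  apply: outer_sub (outer_le _ (outerU (outerU (truncation_event N0) R1) row)).
    move=> w; apply: contra_notP => /not_orP[/not_orP[b1 /contrapT b2] b3].
    have sp : 0 < Num.sqrt (2 * N%:R * L) by rewrite sqrtr_gt0 !mulr_gt0// ltr0n.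
    rewrite ler_pdivrMr//.
    have h := @opnorm_laplacian_le N w _ (c * Num.sqrt (2 * N%:R * L)) N0 _ _ b2 _.
    apply: (le_trans (h _ _ _)).
    - by rewrite mulr_ge0 ?ltW.
    - by move=> p Jp; rewrite leNgt; apply/negP => hp; apply: b1; exists p.
    - by move=> i; rewrite leNgt; apply/negP => /ltW hi; apply: b3; exists i.
    - have -> : Num.sqrt (2 * A2) + eps = eps / 2 + c by rewrite cE; field.
      rewrite -/L [leRHS]mulrDl lerD2r sqrt_scale// -/L mulrC [leRHS]mulrCA ler_wpM2l ?expR_ge0//.
      have : 2 * C / eps <= Num.sqrt (2 * L).
        rewrite -[leLHS]ger0_norm; last by rewrite divr_ge0 ?mulr_ge0// ltW.
        by rewrite -sqrtr_sqr ler_sqrt ?mulr_ge0//; lra.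
      by rewrite ler_pdivrMr//; lra.
  have EL := expR_ge0 (- (1 + g) * L).
  have h1 : expR (- (1 + delta / 4) * L) <= expR (- (1 + g) * L).
    by rewrite ler_expR ler_wpM2r// lerN2 lerD2l.
  have h2 : expR (- (2 * L)) <= expR (- (1 + g) * L).
    by rewrite ler_expR -mulNr ler_wpM2r// lerN2; lra.
  have h3 : N%:R * expR (- (q * L)) <= expR (- (1 + g) * L).
    rewrite NL -expRD ler_expR -[X in X + _]mul1r -mulNr -mulrDl ler_wpM2r//; lra.
  have h4 := ler_wpM2l K0 h1.
  lra.
apply: filterS => w; apply: filterS => N /contrapT.
by [].
Unshelve. all: by end_near. Qed.

Lemma ae_opnorm_ratio_ge (b : R) : 0 < b -> b < Num.sqrt A1 ->
  {ae P, forall w, \forall N \near \oo,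
    b <= opnorm (M N w) / Num.sqrt (2 * N%:R * ln N%:R)}.
Proof.
move=> b0 bA.
have [c cE] : {c : R | c = (b + Num.sqrt A1) / 2} by exists ((b + Num.sqrt A1) / 2).
have bc : b < c by rewrite cE; lra.
have cA : c < Num.sqrt A1 by rewrite cE; lra.
have c0 : 0 < c by exact: lt_trans bc.
have c2 : c ^+ 2 < A1.
  rewrite -[ltRHS]sqr_sqrtr ?(ltW A10)// ltrXn2r ?nnegrE ?sqrtr_ge0//; exact: ltW.
have [v0 v0E] : {v : R | v = (c ^+ 2 + A1) / 2} by exists ((c ^+ 2 + A1) / 2).
have cv : c ^+ 2 < v0 by rewrite v0E; lra.
have vA : v0 < A1 by rewrite v0E; lra.
have v00 : 0 < v0 by apply: le_lt_trans cv; exact: sqr_ge0.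
have [e0 e0E] : {x : R | x = (A1 - v0) / 2} by exists ((A1 - v0) / 2).
have e00 : 0 < e0 by rewrite e0E; lra.
have eA : e0 <= A1 / 2 by rewrite e0E; lra.
have Av : 0 < A1 + v0 by rewrite addr_gt0.
have cb0 : 0 < (c - b) ^+ 2 by rewrite exprn_gt0// subr_gt0.
(* The first bound leaves enough columns: [(1 - k0) (A1 - e0) >= v0], as [A1 - e0 = (A1 + v0) / 2].
   The second makes the rate [(c - b)^2 / k0] of the omitted columns at least 4, above the 3 used in
   the union over rows. *)
pose k0 := Num.min ((A1 - v0) / (A1 + v0)) ((c - b) ^+ 2 / 4).
have k00 : 0 < k0 by rewrite lt_min !divr_gt0// subr_gt0.
have k0a : k0 <= (A1 - v0) / (A1 + v0) by rewrite ge_min lexx.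
have k0b : k0 <= (c - b) ^+ 2 / 4 by rewrite ge_min lexx orbT.
clearbody k0.
have k01 : k0 < 1.
  by apply: le_lt_trans k0a _; rewrite ltr_pdivrMr// mul1r; lra.
have vk : v0 <= (1 - k0) * (A1 - e0).
  have -> : A1 - e0 = (A1 + v0) / 2 by rewrite e0E; field.
  move: k0a; rewrite ler_pdivlMr//; lra.
have q3 : 3 < (c - b) ^+ 2 / k0.
  by rewrite ltr_pdivlMr//; lra.
pose g := Num.min (delta / 4) 1.
have g0 : 0 < g by rewrite lt_min ltr01 andbT divr_gt0.
have gd : g <= delta / 4 by rewrite ge_min lexx.
have g1 : g <= 1 by rewrite ge_min lexx orbT.
clearbody g.
have cb : 0 < c - b by rewrite subr_gt0.
have r1 := near_all_right_sums_small mX indX K0 X_mean eta0 eta4 X_ub1 X_lb A10 c0 cv k00 k01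
  e00 eA vk.
have r2 := near_row_tail mX indX K0 X_mean eta0 eta4 cb k00 ltr01 (ltr0n R 3) q3 X_ub1.
have r3 : \forall N \near \oo, 1 <= ln N%:R :> R by exact: (near_ln (near_pinfty_ge 1)).
pose E N := [set w | ~ (b <= opnorm (M N w) / Num.sqrt (2 * N%:R * ln N%:R))].
have : {ae P, forall w, \forall N \near \oo, ~ E N w}.
  apply: (@borel_cantelli_outer _ _ _ P E g (K + 2) g0).
  near=> N.
  have N0 : (0 < N)%N by near: N; exact: near_nat_gt0.
  have R1 : outer P [set w | forall i : 'I_(Num.truncn (k0 * N%:R)),
       right_sum N (X N) (level eta N) w i < c * Num.sqrt (2 * N%:R * ln N%:R)]
      (expR (- (2 * ln N%:R))) by near: N; exact: r1.
  have R2 (i : 'I_N) (Q : pred 'I_N) : #|Q|%:R * 1 <= k0 * N%:R ->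
      outer P [set w | (c - b) * Num.sqrt (2 * N%:R * ln N%:R) <=
        `|\sum_(k | Q k) trunc (level eta N) (X N (edge i k) w)| ] (expR (- (3 * ln N%:R))).
    by move: i Q; near: N; exact: r2.
  have R3 : 1 <= ln N%:R :> R by near: N; exact: r3.
  set L : R := ln N%:R in R1 R2 R3 *.
  have L0 : 0 <= L by exact: ln_nat_ge0.
  have Lp : 0 < L by exact: lt_le_trans R3.
  have NL : N%:R = expR L by rewrite expR_ln_nat.
  set m := Num.truncn (k0 * N%:R) in R1 *.
  have mk : m%:R <= k0 * N%:R.
    by have /truncn_itv /andP[] : 0 <= k0 * N%:R :> R by rewrite mulr_ge0// ltW.
  have mN : (m <= N)%N.
    by rewrite -(ler_nat R) (le_trans mk)// ler_piMl// ltW.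
  pose Er (i : 'I_N) := [set w | (c - b) * Num.sqrt (2 * N%:R * L) <=
      `|\sum_(k < N | (k < m)%N && (k != i :> nat)) trunc (level eta N) (X N (edge i k) w)| ].
  have row : outer P [set w | exists i, Er i w] (N%:R * expR (- (3 * L))).
    have oE i : xpredT i -> outer P (Er i) (expR (- (3 * L))).
      move=> _; apply: R2; rewrite mulr1; apply: le_trans mk.
      have inj : injective (widen_ord mN) by move=> x y /(congr1 val) h; apply: val_inj.
      rewrite ler_nat -[leqRHS]card_ord -(fintype.card_image inj).
      apply: subset_leq_card; apply/fintype.subsetP => k.
      rewrite unfold_in => /andP[km _]; apply/fintype.imageP.
      by exists (Ordinal km) => //; apply: val_inj.
    have := outer_bigcup (p := fun=> expR (- (3 * L))) oE.
    rewrite sumr_const card_ord -[X in outer _ _ X]mulr_natl => H; apply: outer_sub H.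
    by move=> w [i h]; exists i.
  apply: outer_sub (outer_le _ (outerU (outerU (truncation_event N0) R1) row)).
    move=> w; apply: contra_notP => /not_orP[/not_orP[b1 /existsNP[i b2]] b3].
    have sp : 0 < Num.sqrt (2 * N%:R * L) by rewrite sqrtr_gt0 !mulr_gt0// ltr0n.
    rewrite -/L ler_pdivlMr//.
    have -> : b * Num.sqrt (2 * N%:R * L) =
      c * Num.sqrt (2 * N%:R * L) - (c - b) * Num.sqrt (2 * N%:R * L) by ring.
    apply: (@opnorm_laplacian_ge N w m _ _ i) => //.
    - by move=> p Jp; rewrite leNgt; apply/negP => hp; apply: b1; exists p.
    - by rewrite leNgt; apply/negP.
    - by rewrite leNgt; apply/negP => /ltW hi; apply: b3; exists (widen_ord mN i).
  have EL := expR_ge0 (- (1 + g) * L).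
  have h1 : expR (- (1 + delta / 4) * L) <= expR (- (1 + g) * L).
    by rewrite ler_expR ler_wpM2r// lerN2 lerD2l.
  have h2 : expR (- (2 * L)) <= expR (- (1 + g) * L).
    by rewrite ler_expR -mulNr ler_wpM2r// lerN2; lra.
  have h3 : N%:R * expR (- (3 * L)) <= expR (- (1 + g) * L).
    rewrite NL -expRD ler_expR -[X in X + _]mul1r -mulNr -mulrDl ler_wpM2r//; lra.
  have h4 := ler_wpM2l K0 h1.
  lra.
apply: filterS => w; apply: filterS => N /contrapT.
by [].
Unshelve. all: by end_near. Qed.

Lemma ae_limn_esup_ratio_le :
  {ae P, forall w, (limn_esup (fun N =>
     (opnorm (M N w) / Num.sqrt (2 * N%:R * ln N%:R))%:E) <= (Num.sqrt (2 * A2))%:E)%E}.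
Proof.
have /ae_foralln : forall n, {ae P, forall w, \forall N \near \oo,
    opnorm (M N w) / Num.sqrt (2 * N%:R * ln N%:R) <= Num.sqrt (2 * A2) + n.+1%:R^-1}.
  by move=> n; apply: ae_opnorm_ratio_le; rewrite invr_gt0 ltr0n.
apply: filterS => w h; apply/lee_addgt0Pr => e e0.
have [n ne] : exists n : nat, n.+1%:R^-1 <= e.
  exists (Num.truncn e^-1); rewrite -[leRHS]invrK lef_pV2 ?posrE ?invr_gt0 ?ltr0n//.
  exact/ltW/truncnS_gt.
apply: limn_esup_le_near; apply: filterS (h n) => N hN.
by rewrite -EFinD lee_fin (le_trans hN)// lerD2l.
Qed.

Lemma ae_limn_einf_ratio_ge :
  {ae P, forall w, ((Num.sqrt A1)%:E <= limn_einf (fun N =>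
     (opnorm (M N w) / Num.sqrt (2 * N%:R * ln N%:R))%:E))%E}.
Proof.
have s0 : 0 < Num.sqrt A1 by rewrite sqrtr_gt0.
(* The denominator [n + 2] is at least 2, which keeps the lower level positive as
   [ae_opnorm_ratio_ge] requires. *)
have /ae_foralln : forall n, {ae P, forall w, \forall N \near \oo,
    Num.sqrt A1 - Num.sqrt A1 / n.+2%:R <= opnorm (M N w) / Num.sqrt (2 * N%:R * ln N%:R)}.
  move=> n; apply: ae_opnorm_ratio_ge.
    by rewrite subr_gt0 ltr_pdivrMr ?ltr0n// ltr_pMr// ltr1n.
  by rewrite ltrBlDr ltrDl divr_gt0// ltr0n.
apply: filterS => w h; apply/lee_addgt0Pr => e e0.
have [n ne] : exists n : nat, Num.sqrt A1 / n.+2%:R <= e.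
  exists (Num.truncn (Num.sqrt A1 / e)); rewrite ler_pdivrMr ?ltr0n// mulrC -ler_pdivrMr//.
  rewrite (le_trans (ltW (truncnS_gt _)))// ler_nat//.
rewrite -leeBlDr//; apply: limn_einf_ge_near; apply: filterS (h n) => N hN.
by rewrite -EFinB lee_fin (le_trans _ hN)// lerD2l lerN2.
Qed.

End LaplacianNorm.
Unset Implicit Arguments.

Theorem mainTheorem5 (R : realType) (d : measure_display) (T : measurableType d)
  (P : probability T R) (X : nat -> nat -> nat -> {RV P >-> R})
  (W : R -> R -> R) (delta K : R) :
  (* independence of {X^{(N)}_{i,j} : 1 <= i <= j <= N} for each N (0-based) *)
  (forall N : nat, mutually_independent P [set p : nat * nat | (p.1 <= p.2 < N)%N]
                     (fun p => (X N p.1 p.2 : T -> R))) ->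
  (* centred entries *)
  (forall N i j : nat, (i <= j < N)%N -> ('E_P[X N i j] = 0)%E) ->
  (* (S.1) *)
  0 < inf [set r | exists N i j : nat, (i <= j < N)%N /\ r = sig2 P (fun N i j => X N i j) N i j] ->
  (forall N i j : nat, (i <= j < N)%N -> sig2 P (fun N i j => X N i j) N i j <= 1) ->
  (* (S.2) *)
  0 < delta ->
  (forall N i j : nat, (i <= j < N)%N ->
     ('E_P[fun w => (`|X N i j w - fine 'E_P[X N i j]| `^ (6 + delta))%R] <= K%:E)%E) ->
  (* (S.3) *)
  graphon W ->
  cut_dist (emp_graphon N (sig2 P (fun N i j => X N i j) N)) W @[N --> \oo] --> 0%E ->
  let A1 := inf [set r | exists N i j : nat, (i <= j < N)%N /\ r = sig2 P (fun N i j => X N i j) N i j] in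
  let A2 := sup [set r | exists N i j : nat, (i <= j < N)%N /\ r = sig2 P (fun N i j => X N i j) N i j] in
  let ratio := fun (N : nat) w =>
    (opnorm (laplacian (fun N i j => X N i j) N w) / Num.sqrt (2 * N%:R * ln N%:R))%:E in
  {ae P, forall w, ((Num.sqrt A1)%:E <= limn_einf (ratio ^~ w))%E} /\
  {ae P, forall w, (limn_esup (ratio ^~ w) <= (Num.sqrt (2 * A2))%:E)%E}.
Proof.
move=> indX meanX A10 sig1 delta0 momX _ _ A1 A2 ratio.
pose Xf N (p : nat * nat) : T -> R := X N p.1 p.2.
have mX N p : measurable_fun setT (Xf N p) by exact: measurable_funP.
have p6 : 6 <= 6 + delta by rewrite lerDl ltW.
have p60 : 0 <= 6 + delta by rewrite (le_trans _ p6).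
have Z_mean N p : upper_pairs N p -> (\int[P]_w (Xf N p w)%:E = 0)%E.
  by move=> /meanX; rewrite unlock.
have Z_moment N p : upper_pairs N p -> (\int[P]_w (`|Xf N p w| `^ (6 + delta))%:E <= K%:E)%E.
  move=> Jp; have := momX N p.1 p.2 Jp; rewrite meanX// unlock.
  by under eq_integral do rewrite /= subr0.
have K0 : 0 <= K.
  rewrite -lee_fin; apply: le_trans (Z_moment 1%N (0%N, 0%N) _) => //.
  by apply: integral_ge0 => w _; rewrite lee_fin powR_ge0.
have sigE N p : upper_pairs N p -> sig2 P (fun N i j => X N i j) N p.1 p.2 =
    Rintegral P setT (fun w => Xf N p w ^+ 2).
  move=> Jp; have /andP[p12 _] := Jp.
  rewrite /sig2 /entA (minn_idPl p12) (maxn_idPr p12) /variance unlock meanX// unlock.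
  rewrite /Rintegral; congr fine; apply: eq_integral => w _.
  by rewrite -[LHS]/(((Xf N p w - 0) * (Xf N p w - 0))%:E) !subr0.
(* Nonemptiness and two-sided bounds of this set are what make its real [inf] and [sup] genuine
   bounds on the variances. *)
pose S := [set r | exists N i j : nat, (i <= j < N)%N /\
  r = sig2 P (fun N i j => X N i j) N i j].
have S1 : ubound S 1 by move=> _ [N [i [j [ijN ->]]]]; exact: sig1.
have S0 : lbound S 0.
  move=> _ [N [i [j [ijN ->]]]]; rewrite (sigE N (i, j) ijN).
  by apply: Rintegral_ge0 => w _; rewrite sqr_ge0.
have Sx : S !=set0 by exists (sig2 P (fun N i j => X N i j) 1 0 0), 1%N, 0%N, 0%N.
have Sp N p : upper_pairs N p -> S (Rintegral P setT (fun w => Xf N p w ^+ 2)).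
  by move=> Jp; rewrite -sigE//; exists N, p.1, p.2.
have lbA N p : upper_pairs N p -> A1 <= Rintegral P setT (fun w => Xf N p w ^+ 2).
  by move=> Jp; apply: ge_inf; [exists 0|exact: Sp].
have ubA N p : upper_pairs N p -> Rintegral P setT (fun w => Xf N p w ^+ 2) <= A2.
  by move=> Jp; apply: ub_le_sup; [exists 1|exact: Sp].
have A21 : A2 <= 1 by exact: ge_sup.
have A20 : 0 < A2.
  by apply: lt_le_trans A10 (le_trans (lbA 1%N (0%N, 0%N) _) (ubA 1%N (0%N, 0%N) _)).
have ME N w i j : laplacian (fun N i j => X N i j) N w i j =
  if i == j then - \sum_(k < N | k != i) Xf N (edge i k) w else Xf N (edge i j) w.
  by rewrite mxE.
have X_mean N p (Jp : upper_pairs N p) t (t1 : 1 <= t) :=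
  trunc_mean_le (mX N p) p6 (Z_mean N p Jp) (Z_moment N p Jp) t1.
have X_tail N p (Jp : upper_pairs N p) M t (M1 : 1 <= M) :=
  tail_mean_le (mX N p) p6 (Z_moment N p Jp) t M1.
have X_ub N p (Jp : upper_pairs N p) t (t1 : 1 <= t) :
    Ex P (fun w => trunc t (Xf N p w) ^+ 2) <= A2.
  apply: le_trans (ubA N p Jp).
  exact: (trunc_var_le (mX N p) p6 (Z_moment N p Jp) (le_trans ler01 t1)).
have X_lb N p (Jp : upper_pairs N p) t (t1 : 1 <= t) :
    A1 - K / t ^+ 4 <= Ex P (fun w => trunc t (Xf N p w) ^+ 2).
  apply: le_trans (trunc_var_ge (mX N p) p6 (Z_moment N p Jp) t1).
  by rewrite lerD2r lbA.
have X_outer N p (Jp : upper_pairs N p) t (t1 : 1 <= t) :=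
  tail_outer (mX N p) p6 (Z_moment N p Jp) t1.
split.
- exact: (ae_limn_einf_ratio_ge mX indX K0 X_mean X_ub X_lb X_outer A10 A21 delta0 ME).
- exact: (ae_limn_esup_ratio_le mX indX K0 X_mean X_tail X_ub X_outer A20 A21 delta0 ME).
Qed.
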